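(* Let $d,l,\alpha_2,\alpha_3$ be integers with $d\ge 2$, $l\ge 1$, $2\le \alpha_2\le\alpha_3$ and $\gcd(\alpha_2,d)=\gcd(\alpha_2,\alpha_3)=1$, and let $$X=\{x+y(x^{d}+z^{\alpha_2})^{l}+t^{\alpha_3}=0\}\subset \mathbb{A}^4=\mathrm{Spec}(\mathbb{C}[x,y,z,t]).$$ Then the automorphism group of $X$ is generated by $\mathbb{G}_a$-actions and $\mathbb{G}_m$-actions.
   Context: The base field is $\mathbb{C}$. $\mathbb{G}_a=(\mathbb{C},+)$ and $\mathbb{G}_m=(\mathbb{C}^*,\cdot)$ are the additive and multiplicative algebraic groups. The automorphism group of $X$ is $\mathrm{Aut}_{\mathbb{C}}(\mathbb{C}[X])$, the group of $\mathbb{C}$-algebra automorphisms of the coordinate ring (equivalently, algebraic automorphisms of $X$). ''Generated by $\mathbb{G}_a$-actions and $\mathbb{G}_m$-actions'' means: generated as an abstract group by the union of all images of $\mathbb{G}_a$ and $\mathbb{G}_m$ in the automorphism group under algebraic actions $\mathbb{G}_a\times X\to X$ and $\mathbb{G}_m\times X\to X$. *)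

(* Defs.v *)
From HB Require Import structures.
From mathcomp Require Import all_boot all_order all_algebra.
From mathcomp Require Import boolp reals complex.
From mathcomp Require Import mpoly.

Set Implicit Arguments.
Unset Strict Implicit.
Unset Printing Implicit Defensive.

Import GRing.Theory.
Local Open Scope ring_scope.
Local Open Scope quotient_scope.

(* The library only gives [{ideal_quot I}] a ring structure; when the ring is a
   commutative K-algebra, so is the quotient, by c *: \pi p = \pi (c *: p). *)
Section QuotientAlgebra.
Variables (K : comNzRingType) (S : comAlgType K) (I : idealr S).
Local Notation Q := {ideal_quot I}.

Definition quot_scale (c : K) (u : Q) : Q := \pi_Q (c *: repr u).

Lemma pi_quot_scale (c : K) (p : S) :
  quot_scale c (\pi_Q p) = \pi_Q (c *: p).
Proof.
rewrite /quot_scale; apply/eqP.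
rewrite -Quotient.idealrBE -scalerBr -mulr_algl.
by apply: idealMr; rewrite Quotient.idealrBE reprK.
Qed.

Lemma quot_scalerA a b u : quot_scale a (quot_scale b u) = quot_scale (a * b) u.
Proof.
by rewrite -[u]reprK [quot_scale b _]pi_quot_scale !pi_quot_scale scalerA.
Qed.

Lemma quot_scale1r : left_id 1 quot_scale.
Proof. by move=> u; rewrite -[u]reprK pi_quot_scale scale1r. Qed.

Lemma quot_scalerDr : right_distributive quot_scale +%R.
Proof.
move=> a u v; rewrite -[u]reprK -[v]reprK -rmorphD !pi_quot_scale -rmorphD.
by rewrite scalerDr.
Qed.

Lemma quot_scalerDl u : {morph quot_scale^~ u : a b / a + b}.
Proof. by move=> a b; rewrite -[u]reprK !pi_quot_scale -rmorphD scalerDl. Qed.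

HB.instance Definition _ := GRing.Zmodule_isLmodule.Build K Q
  quot_scalerA quot_scale1r quot_scalerDr quot_scalerDl.

Lemma quot_scalerAl (a : K) (u v : Q) : a *: (u * v) = (a *: u) * v.
Proof.
rewrite -[u]reprK -[v]reprK -rmorphM [LHS]pi_quot_scale.
by rewrite [a *: _ in RHS]pi_quot_scale -rmorphM scalerAl.
Qed.

HB.instance Definition _ := GRing.Lmodule_isLalgebra.Build K Q quot_scalerAl.
HB.instance Definition _ := GRing.Lalgebra_isComAlgebra.Build K Q.

End QuotientAlgebra.

Section AlgAut.
Variables (K : fieldType) (A : comAlgType K).

Definition is_alg_aut (f : A -> A) : Prop :=
  [/\ linear f, monoid_morphism f & bijective f].

Record alg_aut := AlgAut {
  alg_aut_fun :> A -> A;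
  alg_autP : is_alg_aut alg_aut_fun
}.

HB.instance Definition _ := gen_eqMixin alg_aut.
HB.instance Definition _ := gen_choiceMixin alg_aut.

Lemma alg_aut_ext (f g : alg_aut) : f =1 g -> f = g.
Proof.
case: f g => [f fP] [g gP] /= /funext E; case: g / E gP => gP.
by congr AlgAut; apply: Prop_irrelevance.
Qed.

Lemma id_is_alg_aut : is_alg_aut id.
Proof. by split=> //; exists id. Qed.

Lemma comp_is_alg_aut (f g : alg_aut) : is_alg_aut (f \o g).
Proof.
case: f g => [f [fL [f1 fM] fB]] [g [gL [g1 gM] gB]] /=; split.
- by move=> c u v /=; rewrite gL fL.
- by split=> [|u v] /=; rewrite ?g1 ?f1 ?gM ?fM.
- exact: bij_comp.
Qed.

Lemma inv_subproof (f : alg_aut) :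
  exists g : A -> A, is_alg_aut g /\ cancel g f /\ cancel f g.
Proof.
case: f => f [fL [f1 fM] [g fK gK]]; exists g; split=> //=; split.
- by move=> c u v; apply: (can_inj fK); rewrite gK fL !gK.
- by split=> [|u v]; apply: (can_inj fK); rewrite ?gK ?f1 // fM !gK.
- by exists f.
Qed.

Definition alg_aut1 : alg_aut := AlgAut id_is_alg_aut.
Definition alg_aut_mul (f g : alg_aut) : alg_aut := AlgAut (comp_is_alg_aut f g).
Definition alg_aut_inv (f : alg_aut) : alg_aut :=
  let: exist g gP := cid (inv_subproof f) in AlgAut gP.1.

Lemma alg_aut_mulA : associative alg_aut_mul.
Proof. by move=> f g h; apply: alg_aut_ext. Qed.
Lemma alg_aut_mul1g : left_id alg_aut1 alg_aut_mul.
Proof. by move=> f; apply: alg_aut_ext. Qed.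
Lemma alg_aut_mulg1 : right_id alg_aut1 alg_aut_mul.
Proof. by move=> f; apply: alg_aut_ext. Qed.
Lemma alg_aut_mulVg : left_inverse alg_aut1 alg_aut_inv alg_aut_mul.
Proof.
move=> f; apply: alg_aut_ext => u /=; rewrite /alg_aut_inv.
by case: cid => g [? [? fK]] /=; apply: fK.
Qed.
Lemma alg_aut_mulgV : right_inverse alg_aut1 alg_aut_inv alg_aut_mul.
Proof.
move=> f; apply: alg_aut_ext => u /=; rewrite /alg_aut_inv.
by case: cid => g [? [gK ?]] /=; apply: gK.
Qed.

HB.instance Definition _ := isGroup.Build alg_aut
  alg_aut_mulA alg_aut_mul1g alg_aut_mulg1 alg_aut_mulVg alg_aut_mulgV.

(* Let X be the affine variety with coordinate ring A, G a commutative affine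
   algebraic group, and G x X -> X an action of the group G(K) given through
   rho : G(K) -> Aut(A), the pull-back of functions.  (For commutative G it
   makes no difference whether one pulls back along s or s^-1.)  The map
   G x X -> X is a morphism iff for every function u on X the function
   (s, x) |-> u (s x) lies in O(G x X) = O(G) (x) A, i.e. is a finite sum
   of c_i(s) u_i(x) with c_i in O(G) and u_i in A.  Below, G(K) is the subset D
   of K, and O(G) is the set OG of functions on D. *)
Definition algebraic_family (D : {pred K}) (OG : (K -> K) -> Prop)
    (rho : K -> alg_aut) : Prop :=
  forall u : A, exists (n : nat) (c : 'I_n -> K -> K) (v : 'I_n -> A),
    (forall i, OG (c i)) /\
    {in D, forall s, rho s u = \sum_(i < n) c i s *: v i}.

(* O(Ga) = K[s] *)
Definition regular_Ga (c : K -> K) : Prop :=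
  exists p : {poly K}, forall s, c s = p.[s].

(* O(Gm) = K[s, s^-1] *)
Definition regular_Gm (c : K -> K) : Prop :=
  exists (p : {poly K}) (k : nat), forall s, s != 0 -> c s = p.[s] / s ^+ k.

Definition Ga_action (rho : K -> alg_aut) : Prop :=
  {morph rho : a b / a + b >-> (a * b)%g} /\
  algebraic_family predT regular_Ga rho.

(* Gm(K) is [predC1 0]; the value of rho at 0 is irrelevant. *)
Definition Gm_action (rho : K -> alg_aut) : Prop :=
  {in predC1 0 &, {morph rho : a b / a * b >-> (a * b)%g}} /\
  algebraic_family (predC1 0) regular_Gm rho.

Definition in_Ga_image (g : alg_aut) : Prop :=
  exists2 rho, Ga_action rho & exists a, g = rho a.

Definition in_Gm_image (g : alg_aut) : Prop :=
  exists2 rho, Gm_action rho & exists2 a, a != 0 & g = rho a.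

End AlgAut.

Definition in_generated_subgroup (G : groupType) (S : G -> Prop) (g : G) : Prop :=
  forall H : {pred G}, group_closed H -> (forall s, S s -> s \in H) -> g \in H.

Definition generated_by (G : groupType) (S : G -> Prop) : Prop :=
  forall g : G, in_generated_subgroup S g.

Section Hypersurface.
Variables (R : realType) (d l a2 a3 : nat).

Definition hypersurface_eq : {mpoly R[i][4]} :=
  let x := 'X_(@Ordinal 4 0 isT) in let y := 'X_(@Ordinal 4 1 isT) in
  let z := 'X_(@Ordinal 4 2 isT) in let t := 'X_(@Ordinal 4 3 isT) in
  x + y * (x ^+ d + z ^+ a2) ^+ l + t ^+ a3.

Definition hypersurface_ideal : {pred {mpoly R[i][4]}} :=
  fun p => `[< exists q, p = q * hypersurface_eq >].

(* 1 is not in the ideal because (-1, 0, 0, 1) is a zero of the equation. *)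
Lemma hypersurface_ideal_closed : idealr_closed hypersurface_ideal.
Proof.
split; first by apply/asboolP; exists 0; rewrite mul0r.
- apply/negP => /asboolP[q] /(congr1 (fun p =>
    p.@[fun i : 'I_4 => if i == 0%N :> nat then -1 else (i == 3%N :> nat)%:R])).
  rewrite /hypersurface_eq meval1 mevalM !mevalD mevalM !rmorphXn mevalXU /=.
  by rewrite !mevalXU /= mul0r addr0 expr1n addNr mulr0 => /eqP; rewrite oner_eq0.
- move=> a p q /asboolP[p' ->] /asboolP[q' ->]; apply/asboolP.
  by exists (a * p' + q'); rewrite mulrDl mulrA.
Qed.

HB.instance Definition _ :=
  isIdealr.Build {mpoly R[i][4]} hypersurface_ideal hypersurface_ideal_closed.

(* C[x,y,z,t] / (x + y (x^d + z^a2)^l + t^a3) *)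
Definition hypersurface_ring : comAlgType R[i] := {ideal_quot hypersurface_ideal}.

End Hypersurface.

(* Main.v *)
From HB Require Import structures.
Require Import Defs.
From mathcomp Require Import all_boot all_order all_algebra.
From mathcomp Require Import boolp reals complex.
From mathcomp Require Import mpoly.
From mathcomp Require Import zify ring.

Set Implicit Arguments.
Unset Strict Implicit.
Unset Printing Implicit Defensive.

Import Order.TTheory GRing.Theory Num.Theory.
Local Open Scope ring_scope.

(** Write f = x^d + z^a2, S = K[x,z] and A for the coordinate ring, where K is
    algebraically closed of characteristic 0.  After f is inverted, y becomes
    - (x + t^a3) / f^l, so A embeds in K(x,z)[t], and every element of A is a
    combination over S of the monomials t^i y^j with i < a3, in one way.

    The theorem follows from the form of the automorphisms ([aut_structure]):
    each of them is x -> k^a3 x, z -> g z, t -> k t + f^l p with p in S and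
    g^a2 = k^(a3 d).  The powers of a parameter s with s^a2 = k and
    s^(d a3) = g, which exists because a2 is coprime to d and to a3, place the
    diagonal part in an action of the torus ([torus_action]); what remains is
    the time 1/k of the action of the additive group t -> t + s f^l p
    ([shear_action]).  Since f^l is not a zero divisor, an automorphism is
    determined by the images of x, z and t ([alg_aut_eq]).

    The main point is that automorphisms preserve S.  The derivation f^l d/dt
    is locally nilpotent with kernel S, and its conjugate by an automorphism phi
    is locally nilpotent with kernel phi(S).  So it is enough to prove
    [ker_in_emb]: if a locally nilpotent derivation D of A is not zero and kills
    a polynomial ring in two variables, then its kernel lies in S.  For this, x
    and z get the weights a2 and d, and A the lexicographic degree given by the
    degree in t followed by the weight of the leading coefficient.  A leading
    form is a product of factors x, z, t, y and x^d - c z^a2 with c <> 0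
    ([leading_form]), and leading forms satisfy y f^l + t^a3 = 0.  D has a
    degree, hence a leading part, and the exponential of the latter sends
    leading forms to polynomials in one variable, multiplicatively, with
    constant values at leading forms of the kernel ([symp], [Phi]).  Let X, Y,
    Z, T be the polynomials that x, y, z, t are sent to.
    - If X and Z are constant, then Y and T are not, and no leading form of the
      kernel contains t or y: the kernel is in S.
    - Otherwise no X^d - c Z^a2 is constant ([binomial_constant]), hence neither
      is T, and at most one of X, Z, Y is constant: X and Z are not both
      constant by assumption, and the other pairs are excluded by comparing the
      degrees in t of derivatives ([flow_degree]).  So the leading forms of the
      kernel are multiples of powers of a single element, which is too few
      for a kernel that contains two independent elements ([rank_two]).

    Once phi(S) = S, a comparison of degrees in t gives phi(t) = k t + c0 and
    phi(y) = b y + (polynomial in t), and the coefficients of the image of the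
    equation show that phi(f)^l is a multiple of f^l by a constant, that f^l
    divides c0, and that phi(x) = k^a3 x mod f^l.  Finally an automorphism of
    the plane that multiplies f by a constant does not raise the weights of x
    and z ([plane_weight], a Jacobian estimate), so that phi(x) = k^a3 x and
    phi(z) = g z. *)

(** * Degree of rational functions *)

(** The element type of [size p] occurs in several convertible forms, which
    [lia] takes for different numbers. *)
Ltac unify_sizes := repeat match goal with
  | |- context [@size ?T (@polyseq ?R ?p)] =>
      lazymatch T with GRing.NzSemiRing.sort _ => fail
      | _ => change (@size T (@polyseq R p))
               with (@size (GRing.NzSemiRing.sort R) (@polyseq R p)) end
  | H : context [@size ?T (@polyseq ?R ?p)] |- _ =>
      lazymatch T with GRing.NzSemiRing.sort _ => fail
      | _ => change (@size T (@polyseq R p))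
               with (@size (GRing.NzSemiRing.sort R) (@polyseq R p)) in H end
  end.
Ltac slia := unify_sizes; lia.

(** The degree of rational functions over E: [vle m r] bounds the degree of r
    by m, and [vcoef m r] is then the coefficient of degree m in the expansion
    of r at infinity.  A relation takes the place of a function to the
    integers because 0 has every bound. *)
Record degree_valuation (F E : fieldType) := DegreeValuation {
  vle : int -> F -> Prop;
  vcoef : int -> F -> E;
  vle0 : forall m, vle m 0;
  vcoef0 : forall m, vcoef m 0 = 0;
  vleD : forall m r r', vle m r -> vle m r' -> vle m (r + r');
  vcoefD : forall m r r', vle m r -> vle m r' ->
    vcoef m (r + r') = vcoef m r + vcoef m r';
  vleM : forall m m' r r', vle m r -> vle m' r' -> vle (m + m') (r * r');
  vcoefM : forall m m' r r', vle m r -> vle m' r' ->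
    vcoef (m + m') (r * r') = vcoef m r * vcoef m' r';
  vle_trans : forall m m' r, m <= m' -> vle m r -> vle m' r;
  vcoef_lt : forall m m' r, m < m' -> vle m r -> vcoef m' r = 0;
  vexact : forall r, r != 0 -> exists m, vle m r /\ vcoef m r != 0
}.

Section RationalFunctionDegree.
Variable E : fieldType.
Local Notation F := {fraction {poly E}}.
Local Notation fr := (@FracField.tofrac {poly E}).
Implicit Types (p q : {poly E}) (r : F) (m : int).

Let szM p q : p != 0 -> q != 0 -> size (p * q) = (size p + size q).-1.
Proof. exact: size_mul. Qed.
Let sz_gt0 p : p != 0 -> (0 < size p)%N.
Proof. by rewrite size_poly_gt0. Qed.

Definition ratnum r : {poly E} := \n_(repr r).
Definition ratden r : {poly E} := \d_(repr r).

Lemma ratden_neq0 r : ratden r != 0.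
Proof. exact: denom_ratioP. Qed.

Lemma ratnumden r : r = fr (ratnum r) / fr (ratden r).
Proof.
apply: (canRL (mulfK _)); first by rewrite tofrac_eq0 ratden_neq0.
rewrite /ratnum /ratden -[in LHS](reprK r); set u := repr r.
rewrite /FracField.tofrac; unlock FracField.tofrac; rewrite -[LHS]FracField.pi_mul.
apply/eqmodP; rewrite /= FracField.equivfE /FracField.mulf.
rewrite !numden_Ratio ?(mulf_neq0, oner_neq0, denom_ratioP) //.
by rewrite !mulr1 /u reprK mulrC.
Qed.

Definition intcoef p m : E := if m is Posz n then p`_n else 0.

(** Degree at most m, and coefficient of degree m, read on one fraction that
    represents r; [deg_leE] and [deg_coefE] show that any other fraction gives
    the same. *)
Definition deg_le m r : Prop :=
  r = 0 \/ ((size (ratnum r))%:Z <= m + (size (ratden r))%:Z).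

Definition deg_coef m r : E :=
  intcoef (ratnum r) (m + (size (ratden r))%:Z - 1) / lead_coef (ratden r).

Lemma ratnumden_eq p q r : q != 0 -> r = fr p / fr q ->
  ratnum r * q = p * ratden r.
Proof.
move=> q0 rE; apply/eqP; rewrite -tofrac_eq !rmorphM /= -eqr_div.
- by rewrite -ratnumden rE.
- by rewrite tofrac_eq0 ratden_neq0.
- by rewrite tofrac_eq0.
Qed.

Let intcoef0 m : intcoef 0 m = 0.
Proof. by case: m => // n; rewrite /= coef0. Qed.

Lemma deg_leE m p q r : q != 0 -> r = fr p / fr q ->
  deg_le m r <-> (p = 0 \/ ((size p)%:Z <= m + (size q)%:Z)).
Proof.
move=> q0 rE; have := ratnumden_eq q0 rE; have d0 := ratden_neq0 r.
have [p0 _|pn0] := eqVneq p 0.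
  by split=> _; left=> //; rewrite rE p0 rmorph0 mul0r.
have rn0 : r != 0 by rewrite rE mulf_neq0 // ?invr_eq0 tofrac_eq0.
have nn0 : ratnum r != 0.
  by apply: contra rn0 => /eqP n0; rewrite [r]ratnumden n0 rmorph0 mul0r.
move=> eqn; have {eqn} := congr1 (fun u : {poly E} => size u) eqn.
rewrite /= !szM // => sE.
have [n1 d1 q1 p1] := And4 (sz_gt0 nn0) (sz_gt0 d0) (sz_gt0 q0) (sz_gt0 pn0).
split=> -[/eqP|H]; rewrite ?(negPf rn0) ?(negPf pn0) //; right; slia.
Qed.

(** After cross-multiplication both sides are the coefficient of one and the
    same polynomial: in u * w, where the degree of u is at most k, only the
    product of u_k with the leading coefficient of w reaches the top degree. *)
Lemma deg_coefE m p q r : q != 0 -> r = fr p / fr q -> deg_le m r ->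
  deg_coef m r = intcoef p (m + (size q)%:Z - 1) / lead_coef q.
Proof.
move=> q0 rE /[dup] vr /(deg_leE _ q0 rE) vp; rewrite /deg_coef.
have := ratnumden_eq q0 rE; have d0 := ratden_neq0 r.
have [p0|pn0] := eqVneq p 0.
  rewrite p0 mul0r => /eqP; rewrite mulf_eq0 (negPf q0) orbF => /eqP ->.
  by rewrite !intcoef0 !mul0r.
case: vp => [/eqP|vp]; first by rewrite (negPf pn0).
have rn0 : r != 0 by rewrite rE mulf_neq0 // ?invr_eq0 tofrac_eq0.
case: vr => [/eqP|vr]; first by rewrite (negPf rn0).
have nn0 : ratnum r != 0.
  by apply: contra rn0 => /eqP n0; rewrite [r]ratnumden n0 rmorph0 mul0r.
have [n1 d1 q1 p1] := And4 (sz_gt0 nn0) (sz_gt0 d0) (sz_gt0 q0) (sz_gt0 pn0).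
move=> eqn; apply/eqP; rewrite eqr_div ?lead_coef_eq0 //.
have key (u w : {poly E}) (k : int) : w != 0 -> ((size u)%:Z <= k + 1) -> 0 <= k ->
    intcoef u k * lead_coef w = (u * w)`_(`|k|%N + (size w).-1)%N.
  case: k => // k w0 uk _ /=; have {uk}uk : (size u <= k.+1)%N by slia.
  have kl : (k < (k + (size w).-1).+1)%N by rewrite ltnS leq_addr.
  rewrite coefM (bigD1 (Ordinal kl)) //= addKn lead_coefE big1 ?addr0 // => i ik.
  have [ki|ki] := ltnP k i; first by rewrite nth_default ?mul0r //; slia.
  rewrite [w`__]nth_default ?mulr0 //.
  have ik' : nat_of_ord i != k by apply: contra ik => /eqP H; apply/eqP/val_inj.
  slia.
rewrite !key //; try slia.
have -> : (`|(m + size (ratden r) - 1)%R| + (size q).-1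
        = `|(m + size q - 1)%R| + (size (ratden r)).-1)%N by slia.
by rewrite eqn.
Qed.

Lemma deg_le0 m : deg_le m 0. Proof. by left. Qed.

Lemma deg_coef0 m : deg_coef m 0 = 0.
Proof. by rewrite (@deg_coefE m 0 1) ?oner_neq0 ?intcoef0 ?rmorph0 ?mul0r //; left. Qed.

Lemma common_denominator r r' : exists p p' q,
  [/\ q != 0, r = fr p / fr q & r' = fr p' / fr q].
Proof.
have [d0 d0'] := (ratden_neq0 r, ratden_neq0 r').
exists (ratnum r * ratden r'), (ratnum r' * ratden r), (ratden r * ratden r').
split; first exact: mulf_neq0.
  by rewrite !rmorphM /= -mulf_div divff ?tofrac_eq0 // mulr1 -ratnumden.
rewrite [X in fr X / _]mulrC !rmorphM /= -mulf_div divff ?tofrac_eq0 //.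
by rewrite mul1r -ratnumden.
Qed.

Lemma deg_leD m r r' : deg_le m r -> deg_le m r' -> deg_le m (r + r').
Proof.
have [p [p' [q [q0 rE rE']]]] := common_denominator r r'.
have sE : r + r' = fr (p + p') / fr q by rewrite rE rE' rmorphD mulrDl.
move=> /(deg_leE _ q0 rE) vp /(deg_leE _ q0 rE') vp'; apply/(deg_leE _ q0 sE).
case: vp vp' => [->|vp] [->|vp']; rewrite ?add0r ?addr0; first (by left);
  try by right.
have := size_polyD p p'; right; slia.
Qed.

Lemma intcoefD p q m : intcoef (p + q) m = intcoef p m + intcoef q m.
Proof. by case: m => m; rewrite /= ?coefD ?addr0. Qed.

Lemma deg_coefD m r r' : deg_le m r -> deg_le m r' ->
  deg_coef m (r + r') = deg_coef m r + deg_coef m r'.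
Proof.
have [p [p' [q [q0 rE rE']]]] := common_denominator r r'.
have sE : r + r' = fr (p + p') / fr q by rewrite rE rE' rmorphD mulrDl.
move=> vr vr'; rewrite (deg_coefE q0 sE (deg_leD vr vr')) (deg_coefE q0 rE vr).
by rewrite (deg_coefE q0 rE' vr') intcoefD mulrDl.
Qed.

Lemma deg_leM m m' r r' : deg_le m r -> deg_le m' r' -> deg_le (m + m') (r * r').
Proof.
have [q0 q0'] := (ratden_neq0 r, ratden_neq0 r').
have pE : r * r' = fr (ratnum r * ratnum r') / fr (ratden r * ratden r').
  by rewrite !rmorphM -mulf_div -!ratnumden.
move=> vr vr'; apply/(deg_leE _ (mulf_neq0 q0 q0') pE).
move: vr vr' => /(deg_leE _ q0 (ratnumden r)) vr /(deg_leE _ q0' (ratnumden r')) vr'.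
have [->|n0] := eqVneq (ratnum r) 0; first by left; rewrite mul0r.
have [->|n0'] := eqVneq (ratnum r') 0; first by left; rewrite mulr0.
case: vr vr' => [H|vr] [H'|vr']; rewrite ?H ?H' ?eqxx // in n0 n0' *.
rewrite (szM n0 n0') (szM q0 q0').
have [b0 b1] := (sz_gt0 n0, sz_gt0 n0').
have b2 := sz_gt0 q0; have b3 := sz_gt0 q0'; right; slia.
Qed.

Lemma intcoefM p q m n : ((size p)%:Z <= m + 1) -> ((size q)%:Z <= n + 1) ->
  intcoef (p * q) (m + n) = intcoef p m * intcoef q n.
Proof.
move=> pm qn; have [m0|m0] := leP 0 m; last first.
  have -> : p = 0 by apply/eqP; case: eqP => // /eqP /sz_gt0; slia.
  by rewrite mul0r !intcoef0 mul0r.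
have [n0|n0] := leP 0 n; last first.
  have -> : q = 0 by apply/eqP; case: eqP => // /eqP /sz_gt0; slia.
  by rewrite mulr0 !intcoef0 mulr0.
case: m n m0 n0 pm qn => [] m // [] n // _ _ pm qn /=.
have {}pm : (size p <= m.+1)%N by slia.
have {}qn : (size q <= n.+1)%N by slia.
have kl : (m < (m + n).+1)%N by rewrite ltnS leq_addr.
rewrite coefM (bigD1 (Ordinal kl)) //= addKn big1 ?addr0 // => i ik.
have [ki|ki] := ltnP m i; first by rewrite nth_default ?mul0r //; slia.
rewrite [q`__]nth_default ?mulr0 //.
have ik' : nat_of_ord i != m by apply: contra ik => /eqP H; apply/eqP/val_inj.
slia.
Qed.

Lemma deg_coefM m m' r r' : deg_le m r -> deg_le m' r' ->
  deg_coef (m + m') (r * r') = deg_coef m r * deg_coef m' r'.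
Proof.
have [q0 q0'] := (ratden_neq0 r, ratden_neq0 r').
have pE : r * r' = fr (ratnum r * ratnum r') / fr (ratden r * ratden r').
  by rewrite !rmorphM -mulf_div -!ratnumden.
move=> vr vr'; rewrite (deg_coefE (mulf_neq0 q0 q0') pE (deg_leM vr vr')).
rewrite lead_coefM invfM.
move: vr vr' => /(deg_leE _ q0 (ratnumden r)) vr /(deg_leE _ q0' (ratnumden r')) vr'.
rewrite /deg_coef.
have [->|n0] := eqVneq (ratnum r) 0; first by rewrite mul0r !intcoef0 !mul0r.
have [->|n0'] := eqVneq (ratnum r') 0.
  by rewrite mulr0 !intcoef0 !(mul0r, mulr0).
case: vr vr' => [H|vr] [H'|vr']; rewrite ?H ?H' ?eqxx // in n0 n0' *.
rewrite mulrACA -intcoefM; try slia.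
congr (intcoef _ _ * _); rewrite (szM q0 q0').
have b2 := sz_gt0 q0; have b3 := sz_gt0 q0'; slia.
Qed.

Lemma deg_le_trans m m' r : m <= m' -> deg_le m r -> deg_le m' r.
Proof. by move=> mm' [->|H]; [left | right; slia]. Qed.

Lemma deg_coef_lt m m' r : m < m' -> deg_le m r -> deg_coef m' r = 0.
Proof.
move=> mm' vr; have vr' : deg_le m' r by apply: deg_le_trans vr; slia.
move: vr vr' => /(deg_leE _ (ratden_neq0 r) (ratnumden r)) vr _.
rewrite /deg_coef; case: vr => [->|vr]; first by rewrite intcoef0 mul0r.
rewrite /intcoef; case nE : (m' + _ - 1) => [n|n]; last by rewrite mul0r.
  by rewrite nth_default ?mul0r //; slia.
Qed.

Lemma deg_exact r : r != 0 -> exists m, deg_le m r /\ deg_coef m r != 0.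
Proof.
move=> rn0; have q0 := ratden_neq0 r.
have nn0 : ratnum r != 0.
  by apply: contra rn0 => /eqP n0; rewrite [r]ratnumden n0 rmorph0 mul0r.
exists ((size (ratnum r))%:Z - (size (ratden r))%:Z); split; first by right; slia.
rewrite /deg_coef mulf_neq0 ?invr_eq0 ?lead_coef_eq0 //.
have -> : (size (ratnum r))%:Z - (size (ratden r))%:Z + (size (ratden r))%:Z - 1
  = ((size (ratnum r)).-1)%:Z :> int.
  have b0 := sz_gt0 nn0; slia.
by rewrite /= -lead_coefE lead_coef_eq0.
Qed.

Lemma deg_le_frac p m : (size p)%:Z <= m + 1 -> deg_le m (fr p).
Proof.
move=> H; apply/(deg_leE m (p := p) (q := 1)); rewrite ?oner_neq0 //.
  by rewrite rmorph1 divr1.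
by right; rewrite size_poly1; slia.
Qed.

Lemma deg_le_fracE p m : p != 0 -> deg_le m (fr p) -> (size p)%:Z <= m + 1.
Proof.
move=> p0; have pE : fr p = fr p / fr 1 by rewrite rmorph1 divr1.
move=> /(deg_leE _ (oner_neq0 _) pE) [/eqP|]; first by rewrite (negPf p0).
by rewrite size_poly1.
Qed.

Lemma deg_coef_frac p m : deg_le m (fr p) -> deg_coef m (fr p) = intcoef p m.
Proof.
have pE : fr p = fr p / fr 1 by rewrite rmorph1 divr1.
move=> /(deg_coefE (oner_neq0 _) pE) ->.
by rewrite size_poly1 lead_coefC divr1 addrK.
Qed.

End RationalFunctionDegree.

Definition ratfun_degree (E : fieldType) : degree_valuation {fraction {poly E}} E :=
  DegreeValuation (@deg_le0 E) (@deg_coef0 E) (@deg_leD E) (@deg_coefD E) (@deg_leM E)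
    (@deg_coefM E) (@deg_le_trans E) (@deg_coef_lt E) (@deg_exact E).

(** * Derivations and symbol polynomials *)

Section Derivations.
Variables (A : comNzRingType) (D : A -> A).
Hypothesis derD : {morph D : a b / a + b}.
Hypothesis derM : forall a b, D (a * b) = D a * b + a * D b.

Lemma der0 : D 0 = 0.
Proof. by apply: (addrI (D 0)); rewrite -derD !addr0. Qed.

Lemma der_sum (I : Type) (r : seq I) (P : pred I) (g : I -> A) :
  D (\sum_(i <- r | P i) g i) = \sum_(i <- r | P i) D (g i).
Proof. exact: (big_morph D derD der0). Qed.

Lemma derMn n : {morph D : a / a *+ n}.
Proof.
by move=> a; elim: n => [|n IH]; rewrite ?mulr0n ?der0 // !mulrS derD IH.
Qed.

Lemma derX a n : D (a ^+ n) = a ^+ n.-1 * D a *+ n.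
Proof.
elim: n => [|n IH].
  by apply: (addrI (D 1)); rewrite mulr0n addr0 expr0 -{3}[1]mulr1 derM mulr1 mul1r.
rewrite exprS derM IH; case: n IH => [|n] _; first by rewrite mulr0n mulr0 addr0 expr0 mulrC.
by rewrite mulrnAr mulrA -exprS /= [D a * _]mulrC -mulrS.
Qed.

Lemma iter_der0 k : iter k D 0 = 0.
Proof. by elim: k => //= k ->; rewrite der0. Qed.

Lemma iter_derD k a b : iter k D (a + b) = iter k D a + iter k D b.
Proof. by elim: k => //= k ->. Qed.

Lemma iter_der_Leibniz k a b :
  iter k D (a * b) =
  \sum_(i < k.+1) iter i D a * iter (k - i) D b *+ 'C(k, i).
Proof.
elim: k => [|k IH]; first by rewrite big_ord_recl big_ord0 addr0.
rewrite iterS IH der_sum.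
under eq_bigr => i _ do rewrite derMn derM mulrnDl.
rewrite big_split [RHS]big_ord_recl bin0.
under [in RHS]eq_bigr => i _ do rewrite lift0 subSS binS mulrnDr.
rewrite big_split /= addrA [LHS]addrC; congr (_ + _).
pose g i := iter i D a * iter (k.+1 - i) D b *+ 'C(k, i).
transitivity (\sum_(i < k.+2) g i).
  rewrite [RHS]big_ord_recr [in X in _ = _ + X]/g /= bin_small // mulr0n addr0.
  by apply: eq_bigr => i _; rewrite /g -iterS subSn // -ltnS.
by rewrite big_ord_recl /g subn0 bin0.
Qed.

End Derivations.

(** A filtration of A by a group T, with sym s a the class of a in the s-th graded
    piece, embedded in E.  A locally nilpotent derivation of degree e acts on
    leading forms, and exp(u D) maps the leading form of a to the polynomial
    in u with coefficients sym (D^k a) / k!.  It is multiplicative by the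
    Leibniz rule, and its values at elements of the kernel are constant. *)
Section SymbolPolynomial.
Variables (A : comNzRingType) (E : fieldType) (T : zmodType).
Hypothesis char0 : forall n, n.+1%:R != 0 :> E.
Variables (fil : T -> A -> Prop) (sym : T -> A -> E).
Hypothesis filD : forall s a b, fil s a -> fil s b -> fil s (a + b).
Hypothesis filM : forall s s' a b, fil s a -> fil s' b -> fil (s + s') (a * b).
Hypothesis symD : forall s a b, fil s a -> fil s b ->
  sym s (a + b) = sym s a + sym s b.
Hypothesis symM : forall s s' a b, fil s a -> fil s' b ->
  sym (s + s') (a * b) = sym s a * sym s' b.
Hypothesis fil0 : forall s, fil s 0.
Variables (D : A -> A) (e : T).
Hypothesis derD : {morph D : a b / a + b}.
Hypothesis derM : forall a b, D (a * b) = D a * b + a * D b.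
Hypothesis locnil : forall a, exists n, iter n D a = 0.
Hypothesis filDer : forall s a, fil s a -> fil (s + e) (D a).
Hypothesis symDer : forall s a, fil s a -> sym s a = 0 -> sym (s + e) (D a) = 0.

Lemma sym0 s : sym s 0 = 0.
Proof. by apply: (addrI (sym s 0)); rewrite -symD // !addr0. Qed.

Lemma fil_iter s a k : fil s a -> fil (s + e *+ k) (iter k D a).
Proof.
move=> sa; elim: k => [|k IH]; first by rewrite mulr0n addr0.
by rewrite iterS mulrSr addrA; apply: filDer.
Qed.

Lemma sym_iter s a k : fil s a -> sym s a = 0 -> sym (s + e *+ k) (iter k D a) = 0.
Proof.
move=> sa s0; elim: k => [|k IH]; first by rewrite mulr0n addr0.
by rewrite iterS mulrSr addrA symDer //; apply: fil_iter.
Qed.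

Lemma fil_sum s (I : Type) (r : seq I) (P : pred I) (g : I -> A) :
  (forall i, P i -> fil s (g i)) -> fil s (\sum_(i <- r | P i) g i).
Proof.
move=> sg; apply: big_rec => [|i a Pi sa]; first exact: fil0.
by apply: filD => //; apply: sg.
Qed.

Lemma sym_sum s (I : Type) (r : seq I) (P : pred I) (g : I -> A) :
  (forall i, P i -> fil s (g i)) ->
  sym s (\sum_(i <- r | P i) g i) = \sum_(i <- r | P i) sym s (g i).
Proof.
move=> sg; elim: r => [|i r IH]; first by rewrite !big_nil sym0.
rewrite !big_cons; case: ifP => // Pi; rewrite symD ?IH //; first exact: sg.
exact: fil_sum.
Qed.

Lemma filMn s a n : fil s a -> fil s (a *+ n).
Proof. by move=> sa; elim: n => [|n IH]; rewrite ?mulr0n // mulrS; apply: filD. Qed.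

Lemma symMn s a n : fil s a -> sym s (a *+ n) = sym s a *+ n.
Proof.
move=> sa; elim: n => [|n IH]; first by rewrite !mulr0n sym0.
by rewrite !mulrS symD ?IH //; apply: filMn.
Qed.

Definition nilorder a : nat := sval (cid (locnil a)).

Lemma iter_nilorder a k : (nilorder a <= k)%N -> iter k D a = 0.
Proof.
move=> /subnK <-; rewrite iterD /nilorder; case: cid => /= n ->.
exact: iter_der0.
Qed.

Definition symp s a : {poly E} :=
  \poly_(k < nilorder a) (sym (s + e *+ k) (iter k D a) / k`!%:R).

Lemma coef_symp s a k :
  (symp s a)`_k = sym (s + e *+ k) (iter k D a) / k`!%:R.
Proof.
rewrite coef_poly; case: ltnP => // /iter_nilorder ->.
by rewrite sym0 mul0r.
Qed.

Lemma factE_neq0 k : k`!%:R != 0 :> E.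
Proof. by case: k`! (fact_gt0 k). Qed.

Lemma sympD s a b : fil s a -> fil s b -> symp s (a + b) = symp s a + symp s b.
Proof.
move=> sa sb; apply/polyP => k; rewrite coefD !coef_symp -mulrDl.
by rewrite iter_derD // symD //; apply: fil_iter.
Qed.

Lemma sympM s s' a b : fil s a -> fil s' b ->
  symp (s + s') (a * b) = symp s a * symp s' b.
Proof.
move=> sa sb; apply/polyP => k; rewrite coefM coef_symp iter_der_Leibniz //.
have shE (i : 'I_k.+1) :
    s + s' + e *+ k = (s + e *+ i) + (s' + e *+ (k - i)).
  by rewrite addrACA -mulrnDr subnKC // -ltnS.
rewrite sym_sum => [|i _]; last first.
  by apply: filMn; rewrite (shE i); apply: filM; apply: fil_iter.
rewrite mulr_suml; apply: eq_bigr => i _; rewrite symMn; last first.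
  by rewrite (shE i); apply: filM; apply: fil_iter.
rewrite (shE i) symM; try exact: fil_iter.
rewrite !coef_symp [RHS]mulrACA mulrnAl -mulrnAr; congr (_ * _).
have ik : (i <= k)%N by rewrite -ltnS.
apply: (mulIf (factE_neq0 k)); rewrite -mulr_natl -mulrA mulVf ?factE_neq0 //.
rewrite -(bin_fact ik) !natrM mulr1 -invfM [RHS]mulrC mulfK //.
by rewrite mulf_neq0 ?factE_neq0.
Qed.

Lemma sympDer s a : (symp s a)^`() = symp (s + e) (D a).
Proof.
apply/polyP => k; rewrite coef_deriv !coef_symp -iterSr -addrA -mulrS.
rewrite factS natrM -mulrnAr; congr (_ * _).
by rewrite -mulr_natl invfM mulrA mulfV ?mul1r.
Qed.

Lemma coef0_symp s a : (symp s a)`_0 = sym s a.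
Proof. by rewrite coef_symp mulr0n addr0 fact0 divr1. Qed.

Lemma symp_eq0 s a : fil s a -> sym s a = 0 -> symp s a = 0.
Proof. by move=> sa s0; apply/polyP => k; rewrite coef_symp sym_iter ?mul0r ?coef0. Qed.

Lemma symp_ker s a : D a = 0 -> symp s a = (sym s a)%:P.
Proof.
move=> a0; apply/polyP => -[|k]; rewrite coefC ?coef0_symp //= coef_symp.
by rewrite iterSr a0 iter_der0 // sym0 mul0r.
Qed.

End SymbolPolynomial.

(** * Weighted degree of polynomials in two variables *)

Section BivariateEvaluation.
Variables (K : comNzRingType) (B : comNzRingType).

Definition eval2 (g : K -> B) (bx bz : B) (p : {poly {poly K}}) : B :=
  (map_poly (fun q => (map_poly g q).[bx]) p).[bz].

Variables (g : {rmorphism K -> B}) (bx bz : B).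

Let inner := horner_eval bx \o map_poly g.
Lemma eval2_is_zmod_morphism : zmod_morphism (eval2 g bx bz).
Proof. exact: (rmorphB (horner_eval bz \o map_poly inner)). Qed.
Lemma eval2_is_monoid_morphism : monoid_morphism (eval2 g bx bz).
Proof.
by split; [exact: (rmorph1 (horner_eval bz \o map_poly inner))
         | exact: (rmorphM (horner_eval bz \o map_poly inner))].
Qed.
HB.instance Definition _ :=
  GRing.isZmodMorphism.Build {poly {poly K}} B (eval2 g bx bz) eval2_is_zmod_morphism.
HB.instance Definition _ :=
  GRing.isMonoidMorphism.Build {poly {poly K}} B (eval2 g bx bz) eval2_is_monoid_morphism.

Lemma eval2X : eval2 g bx bz 'X%:P = bx.
Proof.
by rewrite /eval2 (map_polyC inner) hornerC /inner /= map_polyX /horner_eval hornerX.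
Qed.

Lemma eval2Y : eval2 g bx bz 'X = bz.
Proof. by rewrite /eval2 (map_polyX inner) hornerX. Qed.

Lemma eval2C c : eval2 g bx bz c%:P%:P = g c.
Proof.
by rewrite /eval2 (map_polyC inner) hornerC /inner /= map_polyC /horner_eval hornerC.
Qed.

Lemma poly2E (p : {poly {poly K}}) :
  p = \sum_(q < size p) \sum_(i < size p`_q) ((p`_q)`_i)%:P%:P * 'X%:P ^+ i * 'X ^+ q.
Proof.
rewrite -[LHS]coefK poly_def; apply: eq_bigr => q _.
rewrite -mul_polyC -mulr_suml; congr (_ * _).
rewrite -[p`_q in LHS]coefK poly_def rmorph_sum /=; apply: eq_bigr => i _.
by rewrite -mul_polyC rmorphM rmorphXn.
Qed.

Lemma eval2E p : eval2 g bx bz p =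
  \sum_(q < size p) \sum_(i < size p`_q) g (p`_q)`_i * bx ^+ i * bz ^+ q.
Proof.
rewrite {1}[p]poly2E rmorph_sum; apply: eq_bigr => q _.
rewrite rmorph_sum; apply: eq_bigr => i _.
by rewrite !(rmorphM, rmorphXn) /= eval2X eval2Y eval2C.
Qed.

End BivariateEvaluation.

Lemma rmorph2_ext (K B : comNzRingType) (h h' : {rmorphism {poly {poly K}} -> B}) :
  (forall c, h c%:P%:P = h' c%:P%:P) -> h 'X%:P = h' 'X%:P -> h 'X = h' 'X -> h =1 h'.
Proof.
move=> hc hx hz p; rewrite [p]poly2E !rmorph_sum; apply: eq_bigr => q _.
by rewrite !rmorph_sum; apply: eq_bigr => i _; rewrite !(rmorphM, rmorphXn) hc hx hz.
Qed.

Section WeightedDegree.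
Variables (K : closedFieldType) (d a2 : nat).
Hypotheses (d0 : (0 < d)%N) (cop : coprime a2 d).
Local Notation S := {poly {poly K}}.

Let cc : {rmorphism K -> {poly {poly K}}} := polyC \o polyC.

(** A monomial x^i z^q goes to v^i tau^(a2 i + d q): the tau-degree is the
    weighted degree, and the leading coefficient is the leading form
    dehomogenized. *)
Definition wsubst : S -> {poly {poly K}} :=
  eval2 cc ('X%:P * 'X ^+ a2) ('X ^+ d).
Lemma wsubst_is_zmod_morphism : zmod_morphism wsubst.
Proof. exact: eval2_is_zmod_morphism. Qed.
Lemma wsubst_is_monoid_morphism : monoid_morphism wsubst.
Proof. exact: eval2_is_monoid_morphism. Qed.
HB.instance Definition _ :=
  GRing.isZmodMorphism.Build {poly {poly K}} {poly {poly K}} wsubst wsubst_is_zmod_morphism.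
HB.instance Definition _ :=
  GRing.isMonoidMorphism.Build {poly {poly K}} {poly {poly K}} wsubst wsubst_is_monoid_morphism.

Lemma wsubstN p : wsubst (- p) = - wsubst p.
Proof. by apply/eqP; rewrite -addr_eq0 -rmorphD addNr rmorph0. Qed.

Lemma wsubst_x : wsubst 'X%:P = 'X%:P * 'X^a2. Proof. exact: eval2X. Qed.
Lemma wsubst_z : wsubst 'X = 'X^d. Proof. exact: eval2Y. Qed.
Lemma wsubst_c c : wsubst c%:P%:P = c%:P%:P. Proof. exact: eval2C. Qed.

(** The monomial x^i z^q contributes to the coefficient (m, i) exactly when
    m = a2 i + d q, and this determines q. *)
Lemma coef_wsubst (p : S) m i :
  ((wsubst p)`_m)`_i =
  if (a2 * i <= m)%N && (d %| m - a2 * i)%N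
  then (p`_((m - a2 * i) %/ d))`_i else 0.
Proof.
rewrite /wsubst eval2E.
transitivity (\sum_(q < size p) \sum_(j < size p`_q)
    (if (i == j) && (m == a2 * j + d * q)%N then (p`_q)`_j else 0)).
  rewrite !coef_sum; apply: eq_bigr => q _; rewrite !coef_sum; apply: eq_bigr => j _.
  have -> : cc (p`_q)`_j * ('X%:P * 'X^a2) ^+ j * 'X^d ^+ q
      = ((p`_q)`_j *: 'X^j)%:P * 'X^(a2 * j + d * q).
    by rewrite exprMn -!exprM -!mulrA -exprD mulrA /= -mul_polyC rmorphM rmorphXn.
  rewrite coefCM coefXn mulr_natr coefMn coefZ coefXn.
  by case: (i == j); case: (m == _); rewrite /= ?mulr1 ?mulr0 ?mulr1n ?mulr0n ?mul0rn.
case: ifP => [/andP[le dv]|ndv]; last first.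
  apply: big1 => q _; apply: big1 => j _; case: ifP => // /andP[/eqP ij /eqP mE].
  by move: ndv; rewrite ij mE leq_addr addKn dvdn_mulr.
set q0 := ((m - a2 * i) %/ d)%N.
have mE : m = (a2 * i + d * q0)%N by rewrite /q0 [(d * _)%N]mulnC divnK // subnKC.
have [q0s|q0s] := ltnP q0 (size p); last first.
  rewrite [p`_q0]nth_default // coef0; apply: big1 => q _; apply: big1 => j _.
  case: ifP => // /andP[/eqP ij]; rewrite mE -ij eqn_add2l eqn_mul2l.
  by rewrite gtn_eqF //= => /eqP qE; move: (ltn_ord q); rewrite -qE ltnNge q0s.
rewrite (bigD1 (Ordinal q0s)) //= [X in _ + X]big1 ?addr0; last first.
  move=> q qn; apply: big1 => j _; case: ifP => // /andP[/eqP ij].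
  rewrite mE -ij eqn_add2l eqn_mul2l gtn_eqF //= => /eqP qE.
  by case/eqP: qn; apply: val_inj.
have [is_|is_] := ltnP i (size p`_q0); last first.
  rewrite [RHS]nth_default //; apply: big1 => j _; case: ifP => // /andP[/eqP ij _].
  by move: (ltn_ord j); rewrite -ij ltnNge is_.
rewrite (bigD1 (Ordinal is_)) //= eqxx -mE eqxx [X in _ + X]big1 ?addr0 // => j jn.
case: ifP => // /andP[/eqP ij _].
by case/eqP: jn; apply: val_inj.
Qed.

Lemma coef_wsubst_mono (p : S) i q : ((wsubst p)`_(a2 * i + d * q))`_i = (p`_q)`_i.
Proof. by rewrite coef_wsubst leq_addr addKn dvdn_mulr // mulKn. Qed.

Lemma wsubst_inj : injective wsubst.
Proof.
move=> p p' pE; apply/polyP => q; apply/polyP => i.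
by rewrite -[LHS]coef_wsubst_mono pE coef_wsubst_mono.
Qed.

Lemma wsubst_eq0 p : (wsubst p == 0) = (p == 0).
Proof. by rewrite -[RHS](inj_eq wsubst_inj) rmorph0. Qed.

Lemma coef_wsubst_neq0 (p : S) m i :
  ((wsubst p)`_m)`_i != 0 -> exists2 q, m = (a2 * i + d * q)%N & (p`_q)`_i != 0.
Proof.
rewrite coef_wsubst; case: ifP => [/andP[le dv] pn|]; last by rewrite eqxx.
exists ((m - a2 * i) %/ d)%N => //.
by rewrite [(d * _)%N]mulnC divnK // subnKC.
Qed.

Definition weight (p : S) : nat := (size (wsubst p)).-1.

Lemma wtN p : weight (- p) = weight p.
Proof. by rewrite /weight wsubstN size_polyN. Qed.

Lemma wt1 : weight 1 = 0%N.
Proof. by rewrite /weight rmorph1 size_poly1. Qed.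

Lemma wt_leP (p : S) m :
  reflect (forall q i, (p`_q)`_i != 0 -> (a2 * i + d * q <= m)%N)
          (size (wsubst p) <= m.+1)%N.
Proof.
apply: (iffP idP) => [sm q i pn|H].
  rewrite leqNgt; apply: contra pn => lt.
  by rewrite -coef_wsubst_mono (nth_default 0 (leq_trans sm lt)) coef0.
apply/leq_sizeP => j mj; apply/polyP => i; rewrite coef0.
apply/eqP; case: eqP => // /eqP /coef_wsubst_neq0[q jE /H].
by rewrite -jE => /(leq_trans mj); rewrite ltnn.
Qed.

(** After removing a power of 'X, a polynomial whose exponents are congruent
    mod d is a polynomial in 'X^d, and this one splits over K. *)
Lemma sparse_poly_factor (h : {poly K}) : h != 0 ->
  (forall i j, h`_i != 0 -> h`_j != 0 -> i = j %[mod d]) ->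
  exists k i cs, [/\ k != 0, all (fun c => c != 0) cs &
    h = k *: 'X^i * \prod_(c <- cs) ('X^d - c%:P)].
Proof.
move=> hn sup.
have exi : exists i, h`_i != 0.
  by exists (size h).-1; rewrite -lead_coefE lead_coef_eq0.
have [i hi imin] := ex_minnP exi.
pose g := \poly_(k < size h) h`_(i + d * k).
have gE k : g`_k = h`_(i + d * k).
  rewrite coef_poly; case: ltnP => // sk; rewrite nth_default //.
  by rewrite (leq_trans sk) // (leq_trans _ (leq_addl _ _)) // leq_pmull.
have hE : h = 'X^i * (g \Po 'X^d).
  apply/polyP => j; rewrite coefXnM; case: ltnP => ji.
    by apply/eqP; case: eqP => // /eqP /imin; rewrite leqNgt ji.
  rewrite coef_comp_poly_Xn // gE; case: ifP => dv.
    by congr (h`__); rewrite mulnC divnK // subnKC.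
  apply/eqP; case: eqP => // /eqP hj.
  by move: (sup _ _ hj hi) dv => /eqP; rewrite eqn_mod_dvd // => ->.
have [r gr] := closed_field_poly_normal g.
have g0 : g != 0 by apply: contraNneq hn => g0; rewrite hE g0 comp_poly0 mulr0.
exists (lead_coef g), i, r; split; first by rewrite lead_coef_eq0.
  apply/allP => c cr; apply: contraNneq hi => c0.
  rewrite -(addn0 i) -(muln0 d) -gE -horner_coef0 gr hornerZ horner_prod.
  by rewrite (big_rem _ cr) /= hornerXsubC c0 subrr mul0r mulr0.
rewrite {1}hE {1}gr comp_polyZ -scalerAr scalerAl; congr (_ * _).
rewrite rmorph_prod; apply: eq_bigr => c _.
by rewrite rmorphB /= comp_polyX comp_polyC.
Qed.

Definition leading_monomial k i q cs : S :=
  k%:P%:P * 'X%:P ^+ i * 'X ^+ q * \prod_(c <- cs) ('X%:P ^+ d - c%:P%:P * 'X ^+ a2).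

Lemma wsubst_leading_monomial k i q cs :
  wsubst (leading_monomial k i q cs) =
  (k *: 'X^i * \prod_(c <- cs) ('X^d - c%:P))%:P
   * 'X^(a2 * i + d * q + a2 * d * size cs).
Proof.
rewrite /leading_monomial !(rmorphM, rmorphXn) /= wsubst_x wsubst_z wsubst_c rmorph_prod.
have -> : \prod_(c <- cs) wsubst ('X%:P ^+ d - c%:P%:P * 'X ^+ a2)
   = (\prod_(c <- cs) ('X^d - c%:P))%:P * 'X^(a2 * d * size cs).
  elim: cs => [|c cs IH]; first by rewrite !big_nil /= muln0 expr0 mulr1.
  rewrite !big_cons IH rmorphB rmorphM !rmorphXn /= wsubst_x wsubst_z wsubst_c.
  rewrite exprMn -!exprM [(d * a2)%N]mulnC mulnS exprD rmorphM rmorphB rmorphXn /=.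
  by ring.
rewrite -mul_polyC !rmorphM rmorphXn /= exprMn -!exprM !exprD.
by ring.
Qed.

(** The leading form of p is weighted-homogeneous.  As a2 and d are coprime,
    the exponents of x in it are congruent mod d, so it splits into factors x,
    z and x^d - c z^a2 with c <> 0. *)
Lemma leading_form_factor (p : S) : p != 0 -> exists k i q cs,
  [/\ k != 0, all (fun c => c != 0) cs,
     weight p = (a2 * i + d * q + a2 * d * size cs)%N &
     lead_coef (wsubst p) = k *: 'X^i * \prod_(c <- cs) ('X^d - c%:P)].
Proof.
move=> p0; set h := lead_coef _.
have h0 : h != 0 by rewrite lead_coef_eq0 wsubst_eq0.
have hsup i : h`_i != 0 -> exists q, weight p = (a2 * i + d * q)%N.
  by move=> /coef_wsubst_neq0[q E _]; exists q.
have [|k [i [cs [k0 cs0 hE]]]] := sparse_poly_factor h0.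
  move=> i j /hsup[q E] /hsup[q' E'].
  have : (a2 * i + d * q = a2 * j + d * q' %[mod d])%N by rewrite -E -E'.
  rewrite ![(_ + d * _)%N]addnC ![(d * _)%N]mulnC !modnMDl => /eqP.
  wlog ij : i j {E E' hsup} / (j <= i)%N.
    move=> W; case: (leqP j i) => [ji /(W _ _ ji)//|/ltnW ij].
    by rewrite eq_sym => /(W _ _ ij).
  rewrite eqn_mod_dvd; last by rewrite leq_mul2l ij orbT.
  rewrite -mulnBr Gauss_dvdr; last by rewrite coprime_sym.
  by rewrite -eqn_mod_dvd // => /eqP.
have sE : size h = (i + d * size cs).+1.
  rewrite hE -scalerAl size_scale // size_Mmonic ?monic_neq0 ?monicXn //; last first.
    by apply: monic_prod => c _; rewrite monicXnsubC.
  rewrite size_polyXn addSn /=.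
  suff -> : size (\prod_(c <- cs) ('X^d - c%:P)) = (d * size cs).+1 by rewrite addnS.
  elim: cs {cs0 hE} => [|c cs IH]; first by rewrite big_nil size_poly1 muln0.
  rewrite big_cons size_Mmonic ?IH ?monic_neq0 ?monicXnsubC //; last first.
    by apply: monic_prod => c' _; rewrite monicXnsubC.
  by rewrite size_XnsubC // addSn /= mulnS addnS.
have : h`_(i + d * size cs) != 0.
  by rewrite -[(i + _)%N]/(i + d * size cs).+1.-1 -sE -lead_coefE lead_coef_eq0.
move=> /hsup[q wE]; exists k, i, q, cs; split=> //.
by rewrite wE mulnDr mulnA -!addnA [(d * q + _)%N]addnC.
Qed.

End WeightedDegree.

(** * A dependence criterion and a binomial equation *)

(** Each level adds at most one dimension: a vector that is not in the lower
    level eliminates the others into it. *)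
Lemma filtered_dependent (K : fieldType) (V : lmodType K) (lev : nat -> V -> Prop) :
  (forall v, lev 0%N v -> v = 0) ->
  (forall Q a b, lev Q.+1 a -> lev Q.+1 b -> ~ lev Q b ->
     exists c : K, lev Q (a - c *: b)) ->
  forall Q (v : 'I_Q.+1 -> V), (forall i, lev Q (v i)) ->
  exists2 al : 'I_Q.+1 -> K, exists i, al i != 0 & \sum_i al i *: v i = 0.
Proof.
move=> lev0 levS; elim=> [|Q IH] v vlev.
  exists (fun=> 1); first by exists ord0; rewrite oner_eq0.
  by rewrite big1 // => i _; rewrite (lev0 _ (vlev i)) scaler0.
have [[k vk]|nk] := pselect (exists k, ~ lev Q (v k)); last first.
  have [i|al [i ali] als] := IH (fun i => v (lift ord0 i)).
    by case: (pselect (lev Q (v (lift ord0 i)))) => // H; case: nk; exists (lift ord0 i).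
  exists (fun j => if unlift ord0 j is Some j' then al j' else 0).
    by exists (lift ord0 i); rewrite /= liftK.
  rewrite big_ord_recl unlift_none scale0r add0r -[RHS]als.
  by apply: eq_bigr => j _; rewrite liftK.
have ex i : {c : K | lev Q (v (lift k i) - c *: v k)}.
  by apply: cid; apply: levS.
have [i|al [i ali] als] := IH (fun i => v (lift k i) - sval (ex i) *: v k).
  exact: (svalP (ex i)).
exists (fun j => if unlift k j is Some j' then al j' else - \sum_j' al j' * sval (ex j')).
  by exists (lift k i); rewrite /= liftK.
rewrite (bigD1_ord k) //= unlift_none.
rewrite (eq_bigr (fun j => al j *: v (lift k j))) => [|j _]; last by rewrite liftK.
rewrite scaleNr scaler_suml addrC -sumrB -[RHS]als; apply: eq_bigr => j _.
by rewrite scalerBr scalerA.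
Qed.

Section BinomialConstant.
Variable E : fieldType.
Hypothesis char0 : forall n, n.+1%:R != 0 :> E.

Lemma deriv_neq0 (p : {poly E}) : (1 < size p)%N -> p^`() != 0.
Proof.
move=> p1; apply/eqP => p0; have := congr1 (fun q : {poly E} => q`_(size p).-2) p0.
rewrite coef_deriv coef0 prednK; last by slia.
move=> /eqP; rewrite -mulr_natr mulf_eq0 -lead_coefE lead_coef_eq0 => /orP[/eqP pz|].
  by rewrite pz size_poly0 in p1.
by case: (size p) p1 => [|[|n]] // _; rewrite (negPf (char0 n)).
Qed.

Lemma size1_deriv (p : {poly E}) : (size p <= 1)%N -> p^`() = 0.
Proof. by move=> /size1_polyC ->; rewrite derivC. Qed.

Lemma size_exp_le1 (p : {poly E}) n : (0 < n)%N -> (size (p ^+ n) <= 1)%N = (size p <= 1)%N.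
Proof.
move=> n0; have [->|p0] := eqVneq p 0; first by rewrite expr0n gtn_eqF // size_poly0.
have := size_exp p n; move: n0.
have pn0 := expf_neq0 n p0; move: p0 pn0; rewrite -!size_poly_gt0.
case: (size p) => [|[|u]] //; case: (size (p ^+ n)) => [|[|w]] //= _ _; case: n => //= n _; lia.
Qed.

Lemma size_M_le1 (p q : {poly E}) : p * q != 0 ->
  (size (p * q)%R <= 1)%N = (size p <= 1)%N && (size q <= 1)%N.
Proof.
rewrite mulf_eq0 negb_or => /andP[p0 q0]; rewrite size_mul //.
move: p0 q0; rewrite -!size_poly_gt0.
by case: (size p) => [|u] //; case: (size q) => [|w] // _ _; lia.
Qed.

(** P and Q are coprime because r is a nonzero constant.  Differentiation then
    gives Q^(n-1) | P' and P^(m-1) | Q', and for nonconstant P and Q this would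
    force deg Q < deg P < deg Q. *)
Lemma binomial_constant (P Q : {poly E}) (m n : nat) (c r : E) :
  (2 <= m)%N -> (2 <= n)%N -> c != 0 -> r != 0 ->
  P ^+ m - c *: Q ^+ n = r%:P -> (size P <= 1)%N && (size Q <= 1)%N.
Proof.
move=> m2 n2 c0 r0 eqr.
have m0 : (0 < m)%N by lia.
have n0 : (0 < n)%N by lia.
have iff : (size P <= 1)%N = (size Q <= 1)%N.
  rewrite -(size_exp_le1 P m0) -(size_exp_le1 Q n0) -(size_scale (Q ^+ n) c0).
  have E1 : P ^+ m = c *: Q ^+ n + r%:P by rewrite -eqr addrC subrK.
  have E2 : c *: Q ^+ n = P ^+ m - r%:P by rewrite -eqr opprB addrC subrK.
  apply/idP/idP => [H|H]; first rewrite E2; last rewrite E1.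
    by rewrite (leq_trans (size_polyD _ _)) // geq_max H size_polyN size_polyC_leq1.
  by rewrite (leq_trans (size_polyD _ _)) // geq_max H size_polyC_leq1.
rewrite -iff andbb leqNgt; apply/negP => P1.
have Q1 : (1 < size Q)%N by rewrite ltnNge -iff -ltnNge.
have cop : coprimep P Q.
  apply/Bezout_coprimepP; exists (r^-1 *: P ^+ m.-1, - (r^-1 * c) *: Q ^+ n.-1).
  rewrite /= -!scalerAl -!exprSr !prednK // scaleNr -scalerA -scalerBr eqr.
  by rewrite -mul_polyC -polyCM mulVf // eqpxx.
have deq : P ^+ m.-1 * P^`() *+ m = c *: (Q ^+ n.-1 * Q^`()) *+ n.
  have := congr1 (@deriv _) eqr; rewrite derivC derivB derivZ !deriv_exp.
  by move=> /eqP; rewrite subr_eq0 => /eqP H; move: H; rewrite -scalerMnr ![_ * _^`()]mulrC.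
have mE : m%:R != 0 :> E by rewrite -(prednK m0) char0.
have nE : n%:R != 0 :> E by rewrite -(prednK n0) char0.
have nat_scale k (p : {poly E}) : p *+ k = k%:R *: p by rewrite scaler_nat.
have dP : Q ^+ n.-1 %| P^`().
  have : Q ^+ n.-1 %| P ^+ m.-1 * P^`() *+ m.
    by rewrite deq nat_scale !dvdpZr // dvdp_mulr.
  rewrite nat_scale dvdpZr // mulrC Gauss_dvdpl // coprimep_expl // coprimep_expr //.
  by rewrite coprimep_sym.
have dQ : P ^+ m.-1 %| Q^`().
  have : P ^+ m.-1 %| c *: (Q ^+ n.-1 * Q^`()) *+ n.
    by rewrite -deq nat_scale dvdpZr // dvdp_mulr.
  rewrite nat_scale !dvdpZr // mulrC Gauss_dvdpl // coprimep_expl // coprimep_expr //.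
have Pn0 : P != 0 by rewrite -size_poly_gt0 (ltnW P1).
have Qn0 : Q != 0 by rewrite -size_poly_gt0 (ltnW Q1).
have b1 := dvdp_leq (deriv_neq0 P1) dP; have b2 := dvdp_leq (deriv_neq0 Q1) dQ.
have b3 := lt_size_deriv Pn0; have b4 := lt_size_deriv Qn0.
have lowexp (p : {poly E}) k : (1 < size p)%N -> (0 < k)%N -> (size p <= size (p ^+ k))%N.
  move=> p1 k0; have pn : p != 0 by rewrite -size_poly_gt0 (ltnW p1).
  by apply: dvdp_leq; rewrite ?expf_neq0 // -(prednK k0) exprS dvdp_mulIl.
have b5 : (size Q <= size (Q ^+ n.-1))%N by apply: lowexp => //; rewrite -subn1 subn_gt0.
have b6 : (size P <= size (P ^+ m.-1))%N by apply: lowexp => //; rewrite -subn1 subn_gt0.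
have b7 := leq_ltn_trans (leq_trans b5 b1) b3.
have b8 := leq_ltn_trans (leq_trans b6 b2) b4.
by have := ltn_trans b7 b8; rewrite ltnn.
Qed.

End BinomialConstant.

(** * Partial derivatives in the plane *)

Lemma poly2_ind (K : comNzRingType) (Pr : {poly {poly K}} -> Prop) :
  (forall c, Pr c%:P%:P) -> Pr 'X%:P -> Pr 'X ->
  (forall p q, Pr p -> Pr q -> Pr (p + q)) ->
  (forall p q, Pr p -> Pr q -> Pr (p * q)) -> forall p, Pr p.
Proof.
move=> Pc Px Pz PD PM p.
have PX q n : Pr q -> Pr (q ^+ n).
  by move=> Pq; elim: n => [|n IH]; rewrite ?exprS ?expr0; [apply: (Pc 1) | apply: PM].
rewrite [p]poly2E; apply: (big_ind Pr) => // [|q _]; first exact: (Pc 0).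
apply: (big_ind Pr) => // [|i _]; first exact: (Pc 0).
by apply: (PM) (PX _ _ Pz); apply: (PM) (PX _ _ Px).
Qed.

Lemma coef_lin_exp (R : comNzRingType) (c0 c1 : R) n i :
  ((c0%:P + c1%:P * 'X) ^+ n)`_i = c0 ^+ (n - i) * c1 ^+ i *+ 'C(n, i).
Proof.
rewrite exprDn coef_sum.
have E1 (j : 'I_n.+1) : (c0%:P ^+ (n - j) * (c1%:P * 'X) ^+ j *+ 'C(n, j))`_i
    = (c0 ^+ (n - j) * c1 ^+ j *+ 'C(n, j)) *+ (i == j).
  rewrite exprMn -!rmorphXn mulrA -rmorphM coefMn coefCM coefXn /= mulr_natr.
  by rewrite mulrnAC.
rewrite (eq_bigr _ (fun j _ => E1 j)); have [il|il] := ltnP i n.+1; last first.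
  rewrite bin_small // mulr0n big1 // => j _.
  by rewrite gtn_eqF ?mulr0n // (leq_trans (ltn_ord j)).
rewrite (bigD1 (Ordinal il)) //= eqxx mulr1n big1 ?addr0 // => j ji.
case: eqP => [ij|]; last by rewrite mulr0n.
by case/eqP: ji; apply: val_inj.
Qed.

(** From d u = a v, multiplying the second inequality by a turns it into
    u c <= a c with c = a d - a - d, and c is positive because a and d are
    coprime and at least 2. *)
Lemma weight_arith (d a u v : nat) : (2 <= d)%N -> (2 <= a)%N -> coprime a d ->
  (d * u = a * v)%N -> ((a - 1) * v + (a + d) <= u + a * d)%N -> (u <= a)%N.
Proof.
move=> d2 a2 cop uv H; have big : (a + d < a * d)%N.
  have [e|/eqP ne] := eqVneq a d.
    by move: cop; rewrite e /coprime gcdnn => /eqP d1; rewrite d1 in d2.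
  have [a' aE] : exists a', a = a'.+2 by exists a.-2; lia.
  have [d' dE] : exists d', d = d'.+2 by exists d.-2; lia.
  move: ne; rewrite aE dE; case: (a') => [|a'']; case: (d') => [|d''] //; rewrite !(mulSn, mulnS); lia.
have [c [c0 cE]] : exists c, (0 < c)%N /\ (a * d = c + (a + d))%N.
  by exists (a * d - (a + d))%N; lia.
have H2 : (a * ((a - 1) * v + (a + d)) <= a * (u + a * d))%N by rewrite leq_mul2l H orbT.
suff : (u * c <= a * c)%N by rewrite leq_mul2r; case: (c) c0.
have e1 : (a * ((a - 1) * v + (a + d)) = u * c + u * a + a * (a + d))%N.
  rewrite mulnDr; congr (_ + _)%N; rewrite mulnCA -uv mulnBl mul1n mulnA cE.
  by rewrite !mulnDl [(u * c)%N]mulnC [(u * a)%N]mulnC; lia.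
have e2 : (a * (u + a * d) = u * a + a * c + a * (a + d))%N.
  by rewrite cE !mulnDr [(a * u)%N]mulnC !addnA.
by move: H2; rewrite e1 e2; lia.
Qed.

Section Plane.
Variables (K : closedFieldType) (d a2 : nat).
Hypothesis char0 : forall n, n.+1%:R != 0 :> K.
Hypotheses (d2 : (2 <= d)%N) (a22 : (2 <= a2)%N) (cop : coprime a2 d).
Local Notation S := {poly {poly K}}.
Local Notation sx := ('X%:P : S).
Local Notation sz := ('X : S).
Local Notation sf := (sx ^+ d + sz ^+ a2 : S).
Local Notation wt := (@weight K d a2).
Let d0 : (0 < d)%N := ltnW d2.
Let a20 : (0 < a2)%N := ltnW a22.

Definition dx : S -> S := map_poly (@deriv K).
Definition dz : S -> S := @deriv {poly K}.

Lemma coef_dx p q i : ((dx p)`_q)`_i = (p`_q)`_i.+1 *+ i.+1.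
Proof. by rewrite coef_map /= coef_deriv. Qed.

Lemma coef_dz p q i : ((dz p)`_q)`_i = (p`_q.+1)`_i *+ q.+1.
Proof. by rewrite coef_deriv coefMn. Qed.

Lemma dxD : {morph dx : p q / p + q}.
Proof. exact: (raddfD (map_poly (@deriv K))). Qed.

Lemma dxM p q : dx (p * q) = dx p * q + p * dx q.
Proof.
apply/polyP => n; rewrite coefD !coefM coef_map /= coefM raddf_sum -big_split /=.
by apply: eq_bigr => i _; rewrite derivM !coef_map.
Qed.

Lemma dzD : {morph dz : p q / p + q}. Proof. exact: derivD. Qed.
Lemma dzM p q : dz (p * q) = dz p * q + p * dz q. Proof. exact: derivM. Qed.

Lemma partials_x : dx sx = 1 /\ dz sx = 0.
Proof. by rewrite /dx /dz map_polyC /= derivX derivC. Qed.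

Lemma partials_z : dx sz = 0 /\ dz sz = 1.
Proof.
split; last exact: derivX.
apply/polyP => i; apply/polyP => j; rewrite coef_dx coefX !coef0.
by case: (i == 1%N); rewrite ?coef0 ?coef1 mul0rn.
Qed.

Definition jac p q : S := dx p * dz q - dz p * dx q.

Lemma jacD p : {morph jac p : q r / q + r}.
Proof. by move=> q r; rewrite /jac dxD dzD; ring. Qed.

Lemma jacM p q r : jac p (q * r) = jac p q * r + q * jac p r.
Proof. by rewrite /jac dxM dzM; ring. Qed.

Lemma jacpp p : jac p p = 0.
Proof. by rewrite /jac mulrC subrr. Qed.

Lemma jac_c p c : jac p c%:P%:P = 0.
Proof. by rewrite /jac /dx /dz map_polyC /= !derivC !mulr0 subrr. Qed.

Lemma jacX p q n : jac p (q ^+ n) = q ^+ n.-1 * jac p q *+ n.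
Proof. exact: (derX (jacM p)). Qed.

Lemma dx0_dz0 p : dx p = 0 -> dz p = 0 -> exists c, p = c%:P%:P.
Proof.
move=> px pz; exists (p`_0)`_0; apply/polyP => q; apply/polyP => i.
rewrite coefC; case: q => [|q] /=; last first.
  have := congr1 (fun r : S => (r`_q)`_i) pz; rewrite coef_dz !coef0 -mulr_natr.
  by move=> /eqP; rewrite mulf_eq0 (negPf (char0 _)) orbF => /eqP.
rewrite coefC; case: i => [|i] //=.
have := congr1 (fun r : S => (r`_0)`_i) px; rewrite coef_dx !coef0 -mulr_natr.
by move=> /eqP; rewrite mulf_eq0 (negPf (char0 _)) orbF => /eqP.
Qed.

Lemma wtM p q : p != 0 -> q != 0 -> wt (p * q) = (wt p + wt q)%N.
Proof.
move=> p0 q0; rewrite /weight rmorphM /= size_mul ?wsubst_eq0 //.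
have h1 : (0 < size (wsubst d a2 p))%N by rewrite size_poly_gt0 wsubst_eq0.
have h2 : (0 < size (wsubst d a2 q))%N by rewrite size_poly_gt0 wsubst_eq0.
by rewrite -(prednK h1) -(prednK h2) addSn addnS.
Qed.

Lemma wtX p n : p != 0 -> wt (p ^+ n) = (n * wt p)%N.
Proof.
move=> p0; elim: n => [|n IH]; first by rewrite expr0 wt1.
by rewrite exprS wtM ?expf_neq0 // IH mulSn.
Qed.

Lemma wtDl p q : q != 0 -> (wt p < wt q)%N -> wt (p + q) = wt q.
Proof.
move=> q0 pq; rewrite /weight addrC rmorphD /= size_polyDl //.
have h2 : (0 < size (wsubst d a2 q))%N by rewrite size_poly_gt0 wsubst_eq0.
rewrite -(prednK h2) ltnS; apply: leq_trans pq.
by rewrite /weight; case: (size _).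
Qed.

Lemma wtZ c p : c != 0 -> wt (c%:P%:P * p) = wt p.
Proof.
move=> c0; rewrite /weight rmorphM /= wsubst_c mul_polyC size_scale //.
by rewrite polyC_eq0.
Qed.

Lemma wt_cusp : wt sf = (a2 * d)%N.
Proof.
rewrite /weight rmorphD !rmorphXn /= wsubst_x wsubst_z exprMn -!exprM [(d * a2)%N]mulnC.
rewrite -rmorphXn /= -[X in _ + X]mul1r -polyC1 -mulrDl -rmorphD mul_polyC size_scale ?size_polyXn //.
by rewrite -polyC1 monic_neq0 // monicXnaddC.
Qed.

Lemma wt_sx : wt sx = a2.
Proof.
by rewrite /weight wsubst_x mul_polyC size_scale ?polyX_eq0 // size_polyXn.
Qed.

(** Weighted degree at most m - u, with the subtraction avoided. *)
Definition wbound (u : nat) (p : S) (m : nat) := forall q i, (p`_q)`_i != 0 -> (a2 * i + d * q + u <= m)%N.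

Lemma wbound_wt p : wbound 0 p (wt p).
Proof.
move=> q i pn; rewrite addn0.
have /wt_leP : (size (wsubst d a2 p) <= (wt p).+1)%N by rewrite leqSpred.
by apply.
Qed.

Lemma wt_wbound u p m : p != 0 -> wbound u p m -> (wt p + u <= m)%N.
Proof.
move=> p0 H; have h0 : lead_coef (wsubst d a2 p) != 0 by rewrite lead_coef_eq0 wsubst_eq0.
have [i hi] : exists i, (lead_coef (wsubst d a2 p))`_i != 0.
  by exists (size (lead_coef (wsubst d a2 p))).-1; rewrite -lead_coefE lead_coef_eq0.
move: hi; rewrite lead_coefE => /(coef_wsubst_neq0 d0)[q wE /H].
by rewrite -wE.
Qed.

Lemma wboundD u p q m : wbound u p m -> wbound u q m -> wbound u (p + q) m.
Proof.
move=> Hp Hq j i; rewrite !coefD => pq.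
have [p0|/Hp//] := eqVneq (p`_j)`_i 0.
by apply: Hq; move: pq; rewrite p0 add0r.
Qed.

Lemma wboundN u p m : wbound u p m -> wbound u (- p) m.
Proof. by move=> H j i; rewrite !coefN oppr_eq0 => /H. Qed.

Lemma wboundM u u' p q m m' : wbound u p m -> wbound u' q m' ->
  wbound (u + u') (p * q) (m + m').
Proof.
move=> Hp Hq j i pq.
have [j1 [j2 [i1 [i2 [jE iE p1 q1]]]]] : exists j1 j2 i1 i2,
   [/\ (j = j1 + j2)%N, (i = i1 + i2)%N, (p`_j1)`_i1 != 0 & (q`_j2)`_i2 != 0].
  apply: contrapT => nH; move: pq; rewrite coefM coef_sum big1 ?eqxx // => j1 _.
  rewrite coefM big1 // => i1 _; apply/eqP; apply: contrapT => /negP.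
  rewrite mulf_eq0 negb_or => /andP[p1 q1]; apply: nH.
  exists (nat_of_ord j1), (j - j1)%N, (nat_of_ord i1), (i - i1)%N.
  by rewrite !subnKC // -ltnS.
have := Hp _ _ p1; have := Hq _ _ q1; rewrite jE iE !mulnDr.
by lia.
Qed.

Lemma wbound_dx u p m : wbound u p m -> wbound (u + a2) (dx p) m.
Proof.
move=> H q i; rewrite coef_dx -mulr_natr mulf_eq0 negb_or => /andP[/H + _].
by rewrite mulnS; lia.
Qed.

Lemma wbound_dz u p m : wbound u p m -> wbound (u + d) (dz p) m.
Proof.
move=> H q i; rewrite coef_dz -mulr_natr mulf_eq0 negb_or => /andP[/H + _].
by rewrite mulnS; lia.
Qed.

Lemma wbound_jac p q : wbound (a2 + d) (jac p q) (wt p + wt q).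
Proof.
have [bp bq] := (@wbound_wt p, @wbound_wt q).
apply: wboundD; first by have := wboundM (wbound_dx bp) (wbound_dz bq); rewrite !add0n.
apply: wboundN; have := wboundM (wbound_dz bp) (wbound_dx bq).
by rewrite !add0n [(d + a2)%N]addnC.
Qed.

(** If X^d and Z^a2 have different weights, the larger one is the weight a2 d of
    mu f.  If they have the same weight, their leading forms may cancel; then
    mu J(X, f) = a2 Z^(a2-1) J(X, Z), and since the Jacobian of p and q has
    weight at most wt p + wt q - a2 - d, the case is settled by
    [weight_arith]. *)
Lemma plane_weight X Z mu : X != 0 -> Z != 0 -> jac X Z != 0 -> mu != 0 ->
  X ^+ d + Z ^+ a2 = mu%:P%:P * sf -> (wt X <= a2)%N /\ (wt Z <= d)%N.
Proof.
move=> X0 Z0 J0 mu0 eqf.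
have wf : wt (mu%:P%:P * sf) = (a2 * d)%N.
  by rewrite wtZ // wt_cusp.
have [wX wZ] := (wtX d X0, wtX a2 Z0).
have Xd0 := expf_neq0 d X0; have Za0 := expf_neq0 a2 Z0.
suff H : (d * wt X <= a2 * d)%N /\ (a2 * wt Z <= a2 * d)%N.
  case: H; rewrite [X in (_ <= X)%N -> _]mulnC !leq_mul2l.
  by rewrite !(gtn_eqF _) //= => -> ->.
have [lt|gt|e] := ltngtP (d * wt X) (a2 * wt Z).
- have := @wtDl (X ^+ d) _ Za0; rewrite eqf wf wX wZ => /(_ lt) ->.
  by rewrite leqnn (ltnW lt).
- have := @wtDl (Z ^+ a2) _ Xd0; rewrite addrC eqf wf wX wZ => /(_ gt) ->.
  by rewrite leqnn (ltnW gt).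
suff u2 : (wt X <= a2)%N.
  by rewrite -e mulnC leq_mul2r u2 orbT.
apply: (weight_arith d2 a22 cop e).
have mE : a2%:R%:P%:P * (Z ^+ a2.-1 * jac X Z) = mu%:P%:P * jac X sf.
  transitivity (jac X (mu%:P%:P * sf)); last by rewrite jacM jac_c mul0r add0r.
  rewrite -eqf jacD !jacX jacpp mulr0 mul0rn add0r.
  by rewrite !rmorph_nat mulr_natl.
have jf0 : mu%:P%:P * jac X sf != 0.
  rewrite -mE !mulf_neq0 ?expf_neq0 ?polyC_eq0 //.
  by rewrite -(prednK a20) char0.
have jf0' : jac X sf != 0 by apply: contraNneq jf0 => ->; rewrite mulr0.
have := wt_wbound jf0' (@wbound_jac X sf).
have <- : wt (mu%:P%:P * jac X sf) = wt (jac X sf) by rewrite wtZ.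
rewrite -mE wtZ; last by rewrite -(prednK a20) char0.
rewrite wtM ?expf_neq0 // wtX // -(wtZ sf mu0) wf subn1; lia.
Qed.

Lemma wt_le_z p : (wt p <= d)%N -> exists q g, p = q%:P + g%:P%:P * sz.
Proof.
move=> pd; exists p`_0, (p`_1)`_0.
have H q i : (p`_q)`_i != 0 -> (a2 * i + d * q <= d)%N.
  by move=> /wbound_wt; rewrite addn0 => /leq_trans; apply.
apply/polyP => q; rewrite coefD coefC coefCM coefX.
case: q => [|[|q]] /=; first by rewrite mulr0 addr0.
  rewrite add0r mulr1; apply/polyP => i; rewrite coefC; case: i => [//|i] /=.
  by apply/eqP; apply: contrapT => /negP /H; rewrite muln1; lia.
rewrite add0r mulr0; apply/polyP => i; rewrite coef0.
by apply/eqP; apply: contrapT => /negP /H; rewrite !mulnS; lia.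
Qed.

(** The coefficient of z^(a2-1) on the left is a2 q g^(a2-1), and it vanishes on
    the right. *)
Lemma plane_linear (al g mu : K) (q : {poly K}) : mu != 0 ->
  (al%:P%:P * sx) ^+ d + (q%:P + g%:P%:P * sz) ^+ a2 = mu%:P%:P * sf ->
  [/\ q = 0, g ^+ a2 = mu & al ^+ d = mu].
Proof.
move=> mu0 H.
have co n := congr1 (fun p : S => p`_n) H.
have E1 n : (al%:P ^+ d * 'X^d) *+ (n == 0%N) + q ^+ (a2 - n) * g%:P ^+ n *+ 'C(a2, n)
    = mu%:P * ('X^d *+ (n == 0%N) + (n == a2)%:R).
  have := co n; rewrite coefD coef_lin_exp coefCM coefD coefXn.
  have -> : (al%:P%:P * sx) ^+ d = (al%:P ^+ d * 'X^d)%:P.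
    by rewrite exprMn rmorphM !rmorphXn.
  have -> : sx ^+ d = ('X^d)%:P by rewrite rmorphXn.
  by rewrite !coefC; case: (n == 0%N).
have g_mu : g ^+ a2 = mu.
  apply: polyC_inj; have := E1 a2; rewrite (gtn_eqF a20) eqxx subnn binn !mulr0n !add0r mulr1 expr0 mul1r.
  by rewrite rmorphXn.
have g0 : g != 0.
  by apply: contraNneq mu0 => g0; rewrite -g_mu g0 expr0n (gtn_eqF a20).
have q0 : q = 0.
  have a31 : (a2.-1 == 0)%N = false by case: (a2) a22 => [|[|n]].
  have a33 : (a2.-1 == a2) = false by case: (a2) a20 => // n _; rewrite /= ltn_eqF.
  have a34 : (a2 - a2.-1)%N = 1%N by case: (a2) a20 => // n _; rewrite /= subSnn.
  have a35 : 'C(a2, a2.-1) = a2 by rewrite -[X in 'C(X, _)](prednK a20) binSn prednK.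
  have := E1 a2.-1; rewrite a31 a33 a34 a35 !mulr0n !add0r mulr0 expr1 -mulr_natr.
  move=> /eqP; rewrite !mulf_eq0 expf_eq0 polyC_eq0 (negPf g0) andbF orbF.
  rewrite -[X in X%:R](prednK a20) -(rmorph_nat (@polyC K)) polyC_eq0.
  by rewrite (negPf (char0 _)) orbF => /eqP.
split=> //; have := E1 0%N; rewrite eqxx !mulr1n subn0 bin0 expr0 mulr1 q0 expr0n.
rewrite (gtn_eqF a20) addr0 (ltn_eqF a20) addr0.
have Xd0 : 'X^d != 0 :> {poly K} by rewrite monic_neq0 ?monicXn.
by move=> /(mulIf Xd0); rewrite -rmorphXn => /polyC_inj.
Qed.

End Plane.

(** * The lexicographic order on degrees *)

Definition lexle (s s' : int * int) := (s.1 < s'.1) || ((s.1 == s'.1) && (s.2 <= s'.2)).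
Definition lexlt (s s' : int * int) := (s.1 < s'.1) || ((s.1 == s'.1) && (s.2 < s'.2)).
Lemma intmulE (m : int) n : m *+ n = m * n%:Z.
Proof. by rewrite -mulr_natr natz. Qed.
Lemma pairD (u u' w w' : int) : (u, w) + (u', w') = (u + u', w + w').
Proof. by []. Qed.

Lemma pairMn (u w : int) n : (u, w) *+ n = (u *+ n, w *+ n).
Proof. by elim: n => // n IH; rewrite !mulrS IH. Qed.

Lemma lexleD2r s s' e : lexle (s + e) (s' + e) = lexle s s'.
Proof. by case: s s' e => [u u'] [v v'] [w w']; rewrite /lexle !pairD /=; lia. Qed.

Lemma lexltD2r s s' e : lexlt (s + e) (s' + e) = lexlt s s'.
Proof. by case: s s' e => [u u'] [v v'] [w w']; rewrite /lexlt !pairD /=; lia. Qed.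

Lemma lexle_total s s' : lexle s s' \/ lexle s' s.
Proof. by rewrite /lexle; lia. Qed.

Lemma lexle_anti s s' : lexle s s' -> lexle s' s -> s = s'.
Proof.
by case: s s' => [u u'] [v v']; rewrite /lexle /= => H1 H2; congr pair; lia.
Qed.

Lemma lexle_gt s s' : lexle s s' -> lexlt s' s -> False.
Proof. by rewrite /lexle /lexlt; lia. Qed.

Lemma lexlt_muln g m n : lexlt 0 g -> lexle (g *+ m) (g *+ n) -> (m <= n)%N.
Proof.
move=> g0; rewrite leqNgt => le; apply/negP => nm.
have pos k : lexlt 0 (g *+ k.+1).
  elim: k => [|k IH]; first by rewrite mulr1n.
  rewrite mulrS; move: g0 IH; rewrite -[g *+ _]/(g *+ k.+1); case: g {le} => u w.
  by rewrite pairMn pairD /lexlt /=; lia.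
move: le; rewrite -(subnKC nm) addSnnS mulrnDr -[X in lexle _ X]addr0.
rewrite addrC [X in lexle _ X]addrC lexleD2r => le.
exact: lexle_gt le (pos _).
Qed.

Lemma level_bound mx mz p q : (p < (mx + mz).+2)%N -> (q < (mx + mz).+2)%N ->
  (mx * p + mz * q < ((mx + mz).+2 * (mx + mz).+2).-1)%N.
Proof.
move=> pn qn; have H : (mx * p + mz * q <= (mx + mz) * (mx + mz).+1)%N.
  by rewrite mulnDl leq_add // leq_mul2l -ltnS ?pn ?qn orbT.
by apply: (leq_ltn_trans H); rewrite mulSn mulnS; lia.
Qed.

(** * Normal form and embedding of the hypersurface ring *)

Section Model.
Variables (K : closedFieldType) (d a2 a3 l : nat).
Hypothesis char0 : forall n, n.+1%:R != 0 :> K.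
Hypotheses (d2 : (2 <= d)%N) (a22 : (2 <= a2)%N) (a32 : (2 <= a3)%N) (l1 : (1 <= l)%N).
Hypothesis cop : coprime a2 d.
Local Notation S := {poly {poly K}}.
Local Notation sx := ('X%:P : S).
Local Notation sz := ('X : S).
Local Notation sf := (sx ^+ d + sz ^+ a2 : S).

Let d0 : (0 < d)%N := ltnW d2.
Let a20 : (0 < a2)%N := ltnW a22.
Let a30 : (0 < a3)%N := ltnW a32.

Variables (F : fieldType) (toF : {rmorphism S -> F}).
Hypothesis toF_inj : injective toF.

Lemma toF_eq0 p : (toF p == 0) = (p == 0).
Proof. by rewrite -[RHS](inj_eq toF_inj) rmorph0. Qed.

Lemma sf_neq0 : sf != 0.
Proof.
rewrite -size_poly_gt0 addrC size_polyDl ?size_polyXn //.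
by rewrite -rmorphXn /= (leq_ltn_trans (size_polyC_leq1 _)).
Qed.

Variables (A : comAlgType K) (x y z t : A).
Hypothesis rel : x + y * (x ^+ d + z ^+ a2) ^+ l + t ^+ a3 = 0.
Hypothesis gen : forall Pr : A -> Prop,
  (forall c, Pr c%:A) -> (forall a b, Pr a -> Pr b -> Pr (a + b)) ->
  (forall a b, Pr a -> Pr b -> Pr (a * b)) ->
  Pr x -> Pr y -> Pr z -> Pr t -> forall a, Pr a.
Variable iota : {rmorphism A -> {poly F}}.
Let theta : F := - (toF sf)^-1 ^+ l.
Hypothesis iota_c : forall c, iota c%:A = (toF c%:P%:P)%:P.
Hypothesis iota_x : iota x = (toF sx)%:P.
Hypothesis iota_z : iota z = (toF sz)%:P.
Hypothesis iota_t : iota t = 'X.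
Hypothesis iota_y : iota y = theta%:P * ('X ^+ a3 + (toF sx)%:P).

Lemma theta_neq0 : theta != 0.
Proof. by rewrite oppr_eq0 expf_neq0 // invr_eq0 toF_eq0 sf_neq0. Qed.

Lemma theta_mul : theta * toF sf ^+ l = -1.
Proof. by rewrite mulNr -exprMn mulVf ?expr1n // toF_eq0 sf_neq0. Qed.

Definition emb : S -> A := eval2 (in_alg A) x z.
Lemma emb_is_zmod_morphism : zmod_morphism emb.
Proof. exact: eval2_is_zmod_morphism. Qed.
Lemma emb_is_monoid_morphism : monoid_morphism emb.
Proof. exact: eval2_is_monoid_morphism. Qed.
HB.instance Definition _ :=
  GRing.isZmodMorphism.Build {poly {poly K}} A emb emb_is_zmod_morphism.
HB.instance Definition _ :=
  GRing.isMonoidMorphism.Build {poly {poly K}} A emb emb_is_monoid_morphism.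

Lemma emb_x : emb sx = x. Proof. exact: eval2X. Qed.
Lemma emb_z : emb sz = z. Proof. exact: eval2Y. Qed.
Lemma emb_c c : emb c%:P%:P = c%:A. Proof. exact: eval2C. Qed.
Lemma emb_f : emb sf = x ^+ d + z ^+ a2.
Proof. by rewrite rmorphD !rmorphXn /= emb_x emb_z. Qed.

Lemma iota_emb p : iota (emb p) = (toF p)%:P.
Proof.
have := @rmorph2_ext _ _ (iota \o emb) (polyC \o toF); apply=> [c||] /=.
- by rewrite emb_c iota_c.
- by rewrite emb_x iota_x.
- by rewrite emb_z iota_z.
Qed.

Lemma emb_inj : injective emb.
Proof.
move=> p p' /(congr1 iota); rewrite !iota_emb => /polyC_inj; exact: toF_inj.
Qed.

Lemma gen_left (Pr : A -> Prop) : Pr 1 ->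
  (forall a b, Pr a -> Pr b -> Pr (a + b)) ->
  (forall c a, Pr a -> Pr (c%:A * a)) ->
  (forall a, Pr a -> [/\ Pr (x * a), Pr (y * a), Pr (z * a) & Pr (t * a)]) ->
  forall a, Pr a.
Proof.
move=> P1 PD PZ PM a.
suff H : forall b, Pr b -> Pr (a * b) by rewrite -[a]mulr1; apply: H.
move: a; apply: gen => [c|a b Ha Hb|a b Ha Hb||||] u Pu;
  rewrite ?mulrDl -?mulrA; try by case: (PM _ Pu).
- exact: PZ.
- by apply: PD; [apply: Ha | apply: Hb].
- by apply/Ha/Hb.
Qed.

(** With x + y f^l + t^a3 = 0 every power of t from the a3-th on is reduced, at
    the cost of y, so A is spanned over K[x,z] by the monomials t^i y^j with
    i < a3.  One index n = i + a3 j lists them by their degree in t after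
    y is eliminated. *)
Definition umon n : A := t ^+ (n %% a3) * y ^+ (n %/ a3).

Definition of_nf (c : {poly S}) : A := \sum_(n < size c) emb c`_n * umon n.

Lemma of_nfE (c : {poly S}) m : (size c <= m)%N ->
  of_nf c = \sum_(n < m) emb c`_n * umon n.
Proof.
move=> cm; rewrite /of_nf (big_ord_widen m (fun n => emb c`_n * umon n) cm).
rewrite big_mkcond /=; apply: eq_bigr => n _; case: ltnP => // sn.
by rewrite nth_default // rmorph0 mul0r.
Qed.

Lemma of_nfD : {morph of_nf : c c' / c + c'}.
Proof.
move=> c c'; set m := maxn (size c) (size c').
rewrite !(@of_nfE _ m) ?leq_maxl ?leq_maxr ?size_polyD // -big_split /=.
by apply: eq_bigr => n _; rewrite coefD rmorphD mulrDl.
Qed.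

Lemma of_nf0 : of_nf 0 = 0.
Proof. by rewrite /of_nf size_poly0 big_ord0. Qed.

Lemma of_nf_mono p n : of_nf (p *: 'X^n) = emb p * umon n.
Proof.
rewrite (@of_nfE _ n.+1); last first.
  by apply/leq_sizeP => j nj; rewrite coefZ coefXn gtn_eqF ?mulr0.
rewrite big_ord_recr /= coefZ coefXn eqxx mulr1 big1 ?add0r // => i _.
by rewrite coefZ coefXn ltn_eqF ?ltn_ord // mulr0 rmorph0 mul0r.
Qed.

(** When t^(r+1) reaches t^a3, the equation replaces it by - x - y f^l. *)
Lemma umonS n : t * umon n =
  if (n.+1 %% a3 == 0)%N then emb (- sx) * umon (n.+1 - a3) + emb (- sf ^+ l) * umon n.+1
  else umon n.+1.
Proof.
rewrite /umon mulrA -exprS.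
have nE := divn_eq n a3; have nl := ltn_pmod n a30.
set q := (n %/ a3)%N in nE *; set r := (n %% a3)%N in nE nl *.
have [rE|rn] := eqVneq r.+1 a3; last first.
  have r1 : (r.+1 < a3)%N by rewrite ltn_neqAle rn.
  have n1E : n.+1 = (q * a3 + r.+1)%N by rewrite addnS -nE.
  by rewrite n1E modnMDl divnMDl // (modn_small r1) (divn_small r1) addn0.
have n1E : n.+1 = (q.+1 * a3)%N by rewrite nE -addnS rE mulSn addnC.
have m1E : (n.+1 - a3)%N = (q * a3)%N by rewrite n1E mulSn addKn.
rewrite m1E n1E !modnMl eqxx !mulnK // rE expr0 !mul1r !(rmorphN, rmorphXn) /= emb_x emb_f.
have tE : t ^+ a3 = - x - y * (x ^+ d + z ^+ a2) ^+ l.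
  by apply/eqP; rewrite -subr_eq0 -rel; apply/eqP; ring.
by rewrite tE exprS; ring.
Qed.

Lemma umonDy n : y * umon n = umon (n + a3).
Proof.
rewrite /umon mulrCA -exprS; congr (_ ^+ _ * _ ^+ _); first by rewrite modnDr.
by rewrite divnDr // divnn a30 addn1.
Qed.

Lemma nf_exists a : exists c, a = of_nf c.
Proof.
have ex_sum m (g : 'I_m -> A) : (forall i, exists c, g i = of_nf c) ->
    exists c, \sum_(i < m) g i = of_nf c.
  move=> H; apply: (big_ind (fun b => exists c, b = of_nf c)).
    + by exists 0; rewrite of_nf0.
    + by move=> u v [c ->] [c' ->]; exists (c + c'); rewrite of_nfD.
  by move=> i _; apply: H.
have exS p b : (exists c, b = of_nf c) -> exists c, emb p * b = of_nf c.
  move=> [c ->]; rewrite mulr_sumr; apply: ex_sum => i.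
  by exists ((p * c`_i) *: 'X^i); rewrite of_nf_mono rmorphM mulrA.
move: a; apply: gen_left => [|a b [c ->] [c' ->]|k a|a Ha].
- by exists (1 *: 'X^0); rewrite of_nf_mono rmorph1 mul1r /umon mod0n div0n !expr0 mulr1.
- by exists (c + c'); rewrite of_nfD.
- by rewrite -emb_c; apply: exS.
split.
- by rewrite -emb_x; apply: exS.
- case: Ha => c ->; rewrite mulr_sumr; apply: ex_sum => i.
  by exists (c`_i *: 'X^(i + a3)); rewrite of_nf_mono mulrCA umonDy.
- by rewrite -emb_z; apply: exS.
- case: Ha => c ->; rewrite mulr_sumr; apply: ex_sum => i.
  rewrite mulrCA; apply: exS; rewrite umonS; case: ifP => _; last first.
    by exists (1 *: 'X^(i.+1)); rewrite of_nf_mono rmorph1 mul1r.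
  by exists ((- sx) *: 'X^(i.+1 - a3) + (- sf ^+ l) *: 'X^(i.+1)); rewrite of_nfD !of_nf_mono.
Qed.

Definition wmon n : {poly F} := 'X^(n %% a3) * ('X^a3 + (toF sx)%:P) ^+ (n %/ a3).

Lemma iota_umon n : iota (umon n) = theta ^+ (n %/ a3) *: wmon n.
Proof.
rewrite rmorphM !rmorphXn /= iota_t iota_y exprMn -rmorphXn /= mulrCA.
by rewrite mul_polyC.
Qed.

Let XaddCE c : 'X^a3 + c%:P = 'X^a3 - (- c)%:P :> {poly F}.
Proof. by rewrite polyCN opprK. Qed.

Lemma wmon_monic n : wmon n \is monic.
Proof. by rewrite /wmon XaddCE rpredM // rpredX ?monicX // monicXnsubC. Qed.

Lemma size_wmon n : size (wmon n) = n.+1.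
Proof.
rewrite /wmon XaddCE; set w := 'X^a3 - _.
have wm : w \is monic by rewrite monicXnsubC.
rewrite size_Mmonic ?monic_neq0 ?monicXn ?rpredX // size_polyXn addSn /=.
have -> m : size (w ^+ m) = (a3 * m).+1.
  have := size_exp w m; rewrite [size w]size_XnsubC //= => <-.
  by rewrite prednK // lt0n size_poly_eq0 expf_neq0 // monic_neq0.
by rewrite addnS [in RHS](divn_eq n a3) addnC mulnC.
Qed.

Lemma iota_of_nf (c : {poly S}) m : size c = m.+1 ->
  exists2 r : {poly F}, (size r <= m)%N &
    iota (of_nf c) = r + (toF c`_m * theta ^+ (m %/ a3)) *: wmon m.
Proof.
move=> cm; rewrite /of_nf cm big_ord_recr rmorphD rmorphM /= iota_emb iota_umon.
rewrite mul_polyC scalerA; exists (iota (\sum_(i < m) emb c`_i * umon i)) => //.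
rewrite rmorph_sum /= (leq_trans (size_sum _ _ _)) //; apply/bigmax_leqP => i _.
rewrite rmorphM /= iota_emb iota_umon mul_polyC scalerA.
by rewrite (leq_trans (size_scale_leq _ _)) // size_wmon.
Qed.

Lemma size_iota_nf (c : {poly S}) : size (iota (of_nf c)) = size c.
Proof.
case cm : (size c) => [|m].
  by move/eqP: cm; rewrite size_poly_eq0 => /eqP ->; rewrite of_nf0 rmorph0 size_poly0.
have [r rm ->] := iota_of_nf cm.
have cn : toF c`_m * theta ^+ (m %/ a3) != 0.
  rewrite mulf_neq0 ?expf_neq0 ?theta_neq0 // toF_eq0.
  by rewrite -[m]/m.+1.-1 -cm -lead_coefE lead_coef_eq0 -size_poly_eq0 cm.
by rewrite addrC size_polyDl size_scale // size_wmon.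
Qed.

Lemma coef_iota_nf (c : {poly S}) m : (size c <= m.+1)%N ->
  (iota (of_nf c))`_m = toF c`_m * theta ^+ (m %/ a3).
Proof.
rewrite leq_eqVlt ltnS => /orP[/eqP cm|cm]; last first.
  by rewrite !nth_default ?size_iota_nf // rmorph0 mul0r.
have [r rm ->] := iota_of_nf cm.
rewrite coefD nth_default // add0r coefZ.
by have /monicP := wmon_monic m; rewrite lead_coefE size_wmon /= => ->; rewrite mulr1.
Qed.

(** The images of the monomials [umon n] have degree n in t, so the size of the
    image of a normal form is the size of the normal form. *)
Lemma iota_inj : injective iota.
Proof.
apply: raddf_inj => a; have [c ->] := nf_exists a.
move=> /eqP; rewrite -size_poly_eq0 size_iota_nf size_poly_eq0 => /eqP ->.
exact: of_nf0.
Qed.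

Lemma mulA_eq0 (a b : A) : (a * b == 0) = (a == 0) || (b == 0).
Proof. by rewrite -!(inj_eq iota_inj) rmorphM rmorph0 mulf_eq0. Qed.

Lemma size_iota_le1 a : (size (iota a) <= 1)%N -> exists p, a = emb p.
Proof.
have [c ->] := nf_exists a; rewrite size_iota_nf => /size1_polyC ->.
exists c`_0; rewrite -alg_polyC -(expr0 'X) of_nf_mono.
by rewrite /umon mod0n div0n !expr0 !mulr1.
Qed.

(** * The lexicographic degree *)

Variables (E : fieldType) (lead : {rmorphism {poly K} -> E}).
Hypothesis lead_inj : injective lead.
Variable V : degree_valuation F E.
Hypothesis vle_toF : forall (p : S) m, p != 0 -> (vle V m (toF p) <-> (weight d a2 p)%:Z <= m).
Hypothesis vcoef_toF : forall p : S, p != 0 ->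
  vcoef V (weight d a2 p) (toF p) = lead (lead_coef (wsubst d a2 p)).

(** The degree of an element of F[t] is the pair of its degree in t and the
    degree of its leading coefficient, in lexicographic order; [sym] is the
    corresponding leading coefficient in E. *)
Definition fil (s : int * int) (a : A) : Prop :=
  forall n, (iota a)`_n != 0 -> n%:Z < s.1 \/ (n%:Z = s.1 /\ vle V s.2 (iota a)`_n).

Definition sym (s : int * int) (a : A) : E :=
  if s.1 is Posz n then vcoef V s.2 (iota a)`_n else 0.

Lemma fil0 s : fil s 0.
Proof. by move=> n; rewrite rmorph0 coef0 eqxx. Qed.

Lemma fil_gt s a n : fil s a -> s.1 < n%:Z -> (iota a)`_n = 0.
Proof.
move=> sa sn; apply/eqP; case: eqP => // /eqP /sa[|[]]; first by lia.
by move=> E'; move: sn; rewrite E' ltxx.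
Qed.

Lemma fil_eq s a n : fil s a -> s.1 = n%:Z -> vle V s.2 (iota a)`_n.
Proof.
move=> sa sn; have [->|/sa[|[]//]] := eqVneq (iota a)`_n 0; first exact: vle0.
by rewrite sn ltxx.
Qed.

Lemma filD s a b : fil s a -> fil s b -> fil s (a + b).
Proof.
move=> sa sb n; rewrite rmorphD coefD => abn.
have [ns|sn|nE] := ltgtP n%:Z s.1; first by left.
  by move: abn; rewrite !(fil_gt _ sn) // addr0 eqxx.
by right; split=> //; apply: vleD; apply: fil_eq.
Qed.

Lemma symD s a b : fil s a -> fil s b -> sym s (a + b) = sym s a + sym s b.
Proof.
rewrite /sym => sa sb; case sE : s.1 => [n|n]; last by rewrite addr0.
by rewrite rmorphD coefD vcoefD //; apply: fil_eq.
Qed.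

(** In the product of two elements of t-degree at most s.1 and s'.1, the
    coefficient at s.1 + s'.1 comes from the two top coefficients alone. *)
Lemma coef_filM s s' a b n : fil s a -> fil s' b -> s.1 + s'.1 <= n%:Z ->
  (iota (a * b))`_n =
  if (s, s', n%:Z == s.1 + s'.1) is ((Posz i, _), (Posz j, _), true)
  then (iota a)`_i * (iota b)`_j else 0.
Proof.
move=> sa sb sn; rewrite rmorphM coefM.
have zero (i : 'I_n.+1) : i%:Z != s.1 \/ (n%:Z != s.1 + s'.1) ->
    (iota a)`_i * (iota b)`_(n - i) = 0.
  move=> H; have [lt|ge] := ltP s.1 i%:Z; first by rewrite (fil_gt sa lt) mul0r.
  rewrite [(iota b)`__](fil_gt sb) ?mulr0 //.
  have := ltn_ord i; case: H => /eqP H; lia.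
have [nE|nn] := eqVneq n%:Z (s.1 + s'.1); last first.
  rewrite big1 => [|i _]; last by apply: zero; right.
  by case: s {sa sn zero nn} => [[i|i] ?]; case: s' {sb} => [[j|j] ?].
case: s sa sn zero nE => [[i|i] s2] sa sn zero /= nE; last first.
  by apply: big1 => j _; apply: zero; left.
case: s' sb sn zero nE => [[j|j] s2'] sb sn zero /= nE; last first.
  rewrite big1 // => k _; have [kE|kn] := eqVneq k%:Z i%:Z; last by apply: zero; left.
  have := ltn_ord k; lia.
have il : (i < n.+1)%N by lia.
rewrite (bigD1 (Ordinal il)) //= big1 ?addr0; last first.
  move=> k kn; apply: zero; left; apply: contra kn => /eqP kE.
  by apply/eqP/val_inj; case: kE.
by congr (_ * _`__); lia.
Qed.

Lemma filM s s' a b : fil s a -> fil s' b -> fil (s + s') (a * b).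
Proof.
move=> sa sb n; have [lt _|ge] := ltP n%:Z (s.1 + s'.1); first by left.
rewrite (coef_filM sa sb ge); have [nE|nn] := eqVneq n%:Z (s.1 + s'.1); last first.
  by case: s {sa ge nn} => [[i|i] ?]; case: s' {sb} => [[j|j] ?]; rewrite /= eqxx.
move=> ab; right; split=> //; move: sa sb ab {ge nE}.
case: s => [[i|i] s2]; case: s' => [[j|j] s2'] sa sb /=; rewrite ?eqxx // => _.
by apply: vleM; [apply: (fil_eq sa) | apply: (fil_eq sb)].
Qed.

Lemma symM s s' a b : fil s a -> fil s' b ->
  sym (s + s') (a * b) = sym s a * sym s' b.
Proof.
move=> sa sb; rewrite {1}/sym; case sE : (s + s').1 => [n|n]; last first.
  case: s sa sE => [[i|i] s2] sa; case: s' sb => [[j|j] s2'] sb //= sE;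
    rewrite /sym /= ?mul0r ?mulr0 //.
have ge : s.1 + s'.1 <= n%:Z by rewrite -sE.
rewrite (coef_filM sa sb ge) -sE eqxx.
case: s sa sE ge => [[i|i] s2] sa; case: s' sb => [[j|j] s2'] sb //= sE ge;
  rewrite /sym /= ?mul0r ?mulr0 ?vcoef0 //.
by rewrite vcoefM //; [apply: (fil_eq sa) | apply: (fil_eq sb)].
Qed.

Lemma fil_trans s s' a : lexle s s' -> fil s a -> fil s' a.
Proof.
move=> ss' sa n /sa; rewrite /lexle in ss' => -[ns|[nE v]].
  case/orP: ss' => [ss'|/andP[/eqP sE _]]; left; lia.
case/orP: ss' => [ss'|/andP[/eqP sE le]]; first by left; slia.
by right; rewrite nE sE; split=> //; apply: vle_trans v.
Qed.

Lemma sym_lt s s' a : lexlt s s' -> fil s a -> sym s' a = 0.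
Proof.
rewrite /lexlt /sym => ss' sa; case sE : s'.1 => [n|//].
case/orP: ss' => [ss'|/andP[/eqP ssE lt]].
  by rewrite (fil_gt sa) ?vcoef0 // -sE.
by apply: vcoef_lt lt _; apply: fil_eq sa _; rewrite ssE.
Qed.

Lemma exact_le s s' a : fil s a -> fil s' a -> sym s' a != 0 -> lexle s' s.
Proof.
move=> sa s'a; apply: contraNT => ns; apply/eqP; apply: sym_lt sa.
by move: ns; rewrite /lexle /lexlt; lia.
Qed.

Lemma exact_exists (a : A) : a != 0 -> exists s, fil s a /\ sym s a != 0.
Proof.
move=> a0; have i0 : iota a != 0 by rewrite -(inj_eq iota_inj) rmorph0 in a0.
have [m [vm cm]] : exists m, vle V m (lead_coef (iota a)) /\ vcoef V m (lead_coef (iota a)) != 0.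
  by apply: vexact; rewrite lead_coef_eq0.
exists (((size (iota a)).-1)%:Z, m); split=> // n /= an.
have ns : (n < size (iota a))%N by rewrite ltnNge; apply: contra an => ?; rewrite nth_default.
have [->|ne] := eqVneq n (size (iota a)).-1; first by right.
by left; slia.
Qed.

Lemma fil_sym0 s a : fil s a -> sym s a = 0 ->
  a = 0 \/ exists s', lexlt s' s /\ fil s' a.
Proof.
move=> sa s0; have [->|an] := eqVneq a 0; first by left.
have [s' [s'a sn]] := exact_exists an; right; exists s'; split=> //.
have := exact_le sa s'a sn; have [E'|ne] := eqVneq s s'; first by rewrite -E' s0 eqxx in sn.
move: ne; case: s s' {sa s0 s'a sn} => [s1 s2] [s1' s2']; rewrite xpair_eqE /lexle /lexlt /=; lia.
Qed.

Definition deg_x : int * int := (0, a2%:Z).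
Definition deg_z : int * int := (0, d%:Z).
Definition deg_t : int * int := (1, 0).
Definition deg_y : int * int := (a3%:Z, - (a2 * d * l)%N%:Z).

Lemma fil_emb p m : p != 0 -> (weight d a2 p)%:Z <= m -> fil (0, m) (emb p).
Proof.
move=> p0 pm n; rewrite iota_emb coefC; case: n => [|n] /=; last by rewrite eqxx.
by move=> _; right; split=> //; apply/vle_toF.
Qed.

Lemma sym_emb p : p != 0 -> sym (0, (weight d a2 p)%:Z) (emb p) = lead (lead_coef (wsubst d a2 p)).
Proof. by move=> p0; rewrite /sym /= iota_emb coefC eqxx vcoef_toF. Qed.

Lemma fil_c c : fil 0 c%:A.
Proof.
rewrite -emb_c; have [->|c0] := eqVneq c 0; first by rewrite rmorph0; apply: fil0.
apply: fil_emb; first by rewrite !polyC_eq0.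
by rewrite /weight wsubst_c size_polyC polyC_eq0 c0.
Qed.

Lemma sym_c c : sym 0 c%:A = lead c%:P.
Proof.
rewrite -emb_c; have [->|c0] := eqVneq c 0; first by rewrite !rmorph0 /sym /= rmorph0 coef0 vcoef0.
have := @sym_emb c%:P%:P; rewrite /weight wsubst_c size_polyC !polyC_eq0 c0 lead_coefC.
exact.
Qed.

Lemma vle_toF1 : vle V 0 1 /\ vcoef V 0 1 = 1.
Proof.
have w1 : weight d a2 (1 : S) = 0%N by rewrite wt1.
rewrite -(rmorph1 toF); split.
  by apply/vle_toF; rewrite ?oner_neq0 // w1.
by have := vcoef_toF (oner_neq0 _); rewrite w1 => ->; rewrite rmorph1 lead_coef1 rmorph1.
Qed.

Lemma vleX m r n : vle V m r -> vle V (m *+ n) (r ^+ n).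
Proof.
move=> mr; elim: n => [|n IH]; first by rewrite mulr0n expr0; case: vle_toF1.
by rewrite mulrS exprS; apply: vleM.
Qed.

Lemma vcoefX m r n : vle V m r -> vcoef V (m *+ n) (r ^+ n) = vcoef V m r ^+ n.
Proof.
move=> mr; elim: n => [|n IH]; first by rewrite mulr0n !expr0; case: vle_toF1.
by rewrite mulrS !exprS vcoefM ?IH //; apply: vleX.
Qed.

Lemma wt_sf : weight d a2 sf = (a2 * d)%N /\ lead_coef (wsubst d a2 sf) = 'X^d + 1.
Proof.
have E0 : wsubst d a2 sf = ('X^d + 1)%:P * 'X^(a2 * d).
  rewrite rmorphD !rmorphXn /= wsubst_x wsubst_z exprMn -!exprM [(d * a2)%N]mulnC.
  by rewrite rmorphD rmorphXn /= mulrDl mul1r.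
have n0 : 'X^d + 1 != 0 :> {poly K} by rewrite -polyC1 monic_neq0 // monicXnaddC.
split; last by rewrite E0 lead_coefM lead_coefC lead_coefXn mulr1.
by rewrite /weight E0 mul_polyC size_scale // size_polyXn.
Qed.

Let dth : int := - (a2 * d * l)%N%:Z.

Lemma vle_sf : vle V (a2 * d)%N (toF sf) /\ vcoef V (a2 * d)%N (toF sf) != 0.
Proof.
have [w c] := wt_sf; rewrite -w; split; first by apply/vle_toF; rewrite ?sf_neq0.
rewrite vcoef_toF ?sf_neq0 // c -(rmorph0 lead) (inj_eq lead_inj).
by rewrite -polyC1 monic_neq0 // monicXnaddC.
Qed.

Lemma vle_theta : vle V dth theta /\ vcoef V dth theta != 0.
Proof.
have [vf cf] := vle_sf.
have [m [vm cm]] := vexact V theta_neq0.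
have vfl := vleX l vf; have cfl := vcoefX l vf.
have [v1 c1] := vle_toF1.
have v0 : vle V 0 (-1).
  have w : weight d a2 (-1 : S) = 0%N by rewrite wtN wt1.
  have -> : -1 = toF (-1) by rewrite rmorphN rmorph1.
  apply/vle_toF; first by rewrite oppr_eq0 oner_neq0.
  by rewrite w.
have c0 : vcoef V 0 (-1) != 0.
  apply/eqP => c0; have := vcoefD v1 v0; rewrite subrr vcoef0 c0 c1 addr0 => /eqP.
  by rewrite eq_sym oner_eq0.
have vp := vleM vm vfl; have cp := vcoefM vm vfl.
rewrite theta_mul in vp cp.
have : m + (a2 * d)%N%:Z *+ l = 0.
  have [lt|gt|//] := ltgtP (m + (a2 * d)%N%:Z *+ l) 0.
    by move: c0; rewrite (vcoef_lt lt vp) eqxx.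
  move: cp; rewrite (vcoef_lt gt v0) cfl => /esym /eqP.
  by rewrite mulf_eq0 (negPf cm) expf_eq0 (negPf cf) andbF.
have -> : (a2 * d)%N%:Z *+ l = (a2 * d * l)%N%:Z by rewrite intmulE -PoszM.
by move=> /eqP; rewrite addr_eq0 => /eqP mE; rewrite -[dth]mE.
Qed.

Let cth : E := vcoef V dth theta.
Let cth0 : cth != 0. Proof. by case: vle_theta. Qed.

Lemma fil_x : fil deg_x x /\ sym deg_x x = lead 'X.
Proof.
have w : weight d a2 sx = a2.
  by rewrite /weight wsubst_x mul_polyC size_scale ?polyX_eq0 // size_polyXn.
have sx0 : sx != 0 by rewrite polyC_eq0 polyX_eq0.
split; first by rewrite -emb_x; apply: fil_emb; rewrite ?w.
rewrite -emb_x -[deg_x]/(0, a2%:Z) -{1}w sym_emb // wsubst_x lead_coefM.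
by rewrite lead_coefC lead_coefXn mulr1.
Qed.

Lemma fil_z : fil deg_z z /\ sym deg_z z = 1.
Proof.
have w : weight d a2 sz = d by rewrite /weight wsubst_z size_polyXn.
have sz0 : sz != 0 by rewrite polyX_eq0.
split; first by rewrite -emb_z; apply: fil_emb; rewrite ?w.
rewrite -emb_z -[deg_z]/(0, d%:Z) -{1}w sym_emb // wsubst_z.
by rewrite lead_coefXn rmorph1.
Qed.

Lemma fil_t : fil deg_t t /\ sym deg_t t = 1.
Proof.
have [v1 c1] := vle_toF1; rewrite /sym /= iota_t coefX eqxx; split=> //.
move=> n; rewrite iota_t coefX; case: (n =P 1%N) => [->|]; last by rewrite eqxx.
by move=> _; right.
Qed.

Lemma fil_y : fil deg_y y /\ sym deg_y y = cth.
Proof.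
have [vt ct] := vle_theta.
have yE n : (n > 0)%N -> (iota y)`_n = if n == a3 then theta else 0.
  move=> n0; rewrite iota_y coefCM coefD coefXn coefC (gtn_eqF n0) addr0.
  by case: eqP; rewrite ?mulr1 ?mulr0.
split; last by rewrite /sym /= yE // eqxx.
move=> [|n]; first by move=> _; left; rewrite ltz_nat.
rewrite yE //; case: (n.+1 =P a3) => [->|]; last by rewrite eqxx.
by move=> _; right.
Qed.

Lemma fil1 : fil 0 1 /\ sym 0 1 = 1.
Proof. by rewrite -[1](scale1r (1 : A)); split; [apply: fil_c | rewrite sym_c rmorph1]. Qed.

Lemma filX s a n : fil s a -> fil (s *+ n) (a ^+ n).
Proof.
move=> sa; elim: n => [|n IH]; first by rewrite mulr0n expr0; case: fil1.
by rewrite mulrS exprS; apply: filM.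
Qed.

Lemma symX s a n : fil s a -> sym (s *+ n) (a ^+ n) = sym s a ^+ n.
Proof.
move=> sa; elim: n => [|n IH]; first by rewrite mulr0n !expr0; case: fil1.
by rewrite mulrS !exprS symM ?IH //; apply: filX.
Qed.

Definition deg_mono p q i j := deg_x *+ p + deg_z *+ q + deg_t *+ i + deg_y *+ j.

Lemma deg_monoE p q i j :
  deg_mono p q i j = ((i + a3 * j)%N%:Z, (a2 * p + d * q)%N%:Z - (a2 * d * l * j)%N%:Z).
Proof.
rewrite /deg_mono /deg_x /deg_z /deg_t /deg_y !pairMn !pairD !intmulE !PoszD !PoszM.
by congr pair => /=; ring.
Qed.

Lemma vcoef_top (c : {poly S}) m : size c = m.+1 -> forall s, fil s (of_nf c) ->
  m%:Z < s.1 \/ (m%:Z = s.1 /\ (weight d a2 c`_m)%:Z - (a2 * d * l * (m %/ a3))%N%:Z <= s.2).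
Proof.
move=> cm s /(_ m); rewrite coef_iota_nf ?cm // => H.
have cn : c`_m != 0.
  by rewrite -[m]/m.+1.-1 -cm -lead_coefE lead_coef_eq0 -size_poly_eq0 cm.
have : toF c`_m * theta ^+ (m %/ a3) != 0.
  by rewrite mulf_neq0 ?expf_neq0 ?theta_neq0 // toF_eq0.
move=> /H[|[mE v]]; [by left | right; split=> //].
have [vf cf] := vle_sf.
have := vleM v (vleX (m %/ a3) (vleX l vf)).
rewrite -mulrA -exprMn theta_mul.
have -> : toF c`_m * (-1) ^+ (m %/ a3) = toF (c`_m * (-1) ^+ (m %/ a3)).
  by rewrite rmorphM rmorphXn rmorphN rmorph1.
have wE : weight d a2 (c`_m * (-1) ^+ (m %/ a3)) = weight d a2 c`_m.
  by rewrite -signr_odd; case: odd; rewrite ?mulr1 // mulrN1 wtN.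
move/vle_toF; rewrite wE mulf_neq0 ?expf_neq0 ?oppr_eq0 ?oner_neq0 // => /(_ isT).
by rewrite -mulrnA intmulE; lia.
Qed.

(** Leading terms do not cancel in the normal form: its monomials in t and y
    have distinct degrees in t, and the weight of a polynomial in x and z is
    the largest weight of its monomials.  So a bound on the degree of an
    element bounds the monomials that occur in it. *)
Lemma fil_span s (Pr : A -> Prop) : Pr 0 ->
  (forall a b, Pr a -> Pr b -> Pr (a + b)) ->
  (forall k p q i j, lexle (deg_mono p q i j) s ->
     Pr (k%:A * (x ^+ p * z ^+ q * t ^+ i * y ^+ j))) ->
  forall a, fil s a -> Pr a.
Proof.
move=> P0 PD Pm a; have [c ->] := nf_exists a.
case cm : (size c) => [|m].
  by move/eqP: cm; rewrite size_poly_eq0 => /eqP ->; rewrite of_nf0.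
move=> /(vcoef_top cm) H.
have mono_le (n q p : nat) : (n <= m)%N -> ((c`_n)`_q)`_p != 0 ->
    lexle (deg_mono p q (n %% a3) (n %/ a3)) s.
  move=> nm kn; rewrite deg_monoE addnC [(a3 * _)%N]mulnC -divn_eq /lexle /=.
  have ms : m%:Z <= s.1 by case: H => [/ltW//|[->]].
  have [nE|ne] := eqVneq n m; last first.
    apply/orP; left; apply: lt_le_trans ms.
    by rewrite ltz_nat ltn_neqAle ne.
  rewrite nE in kn *; case: H => [-> //|[mE le]].
  rewrite mE eqxx /=; apply/orP; right; apply: le_trans le; rewrite lerB // lez_nat.
  have /wt_leP : (size (wsubst d a2 c`_m) <= (weight d a2 c`_m).+1)%N by rewrite leqSpred.
  exact.
rewrite /of_nf; apply: (big_ind Pr) => // n _; rewrite /emb eval2E mulr_suml.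
apply: (big_ind Pr) => // q _; rewrite mulr_suml; apply: (big_ind Pr) => // p _.
have [->|kn] := eqVneq ((c`_n)`_q)`_p 0; first by rewrite rmorph0 !mul0r.
have nm : (n <= m)%N by rewrite -ltnS -cm.
by have := Pm ((c`_n)`_q)`_p _ _ _ _ (mono_le n q p nm kn); rewrite /umon !mulrA.
Qed.

(** The leading form of a is that of its top term c_m [umon m], and the leading
    form of c_m splits by [leading_form_factor]. *)
Lemma leading_form (a : A) : a != 0 -> exists k p q cs i j,
  [/\ k != 0, all (fun c => c != 0) cs, (i < a3)%N &
   let M := emb (leading_monomial d a2 k p q cs) * (t ^+ i * y ^+ j) in
   let s := deg_mono p q i j + (0, (a2 * d * size cs)%N%:Z) in
   [/\ fil s a, fil s M, sym s M != 0 & sym s a = sym s M]].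
Proof.
have [c ->] := nf_exists a.
case cm : (size c) => [|m].
  by move/eqP: cm; rewrite size_poly_eq0 => /eqP ->; rewrite of_nf0 eqxx.
move=> _; have cn : c`_m != 0.
  by rewrite -[m]/m.+1.-1 -cm -lead_coefE lead_coef_eq0 -size_poly_eq0 cm.
have [k [p [q [cs [k0 cs0 wE lE]]]]] := leading_form_factor d0 cop cn.
exists k, p, q, cs, (m %% a3)%N, (m %/ a3)%N; split=> //; first exact: ltn_pmod.
move=> M s.
set LM := leading_monomial d a2 k p q cs in M *.
have P0 : k *: 'X^p * \prod_(c <- cs) ('X^d - c%:P) != 0 :> {poly K}.
  by rewrite -lE lead_coef_eq0 (wsubst_eq0 _ d0).
have lLM : lead_coef (wsubst d a2 LM) = lead_coef (wsubst d a2 c`_m).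
  by rewrite wsubst_leading_monomial lead_coefM lead_coefXn mulr1 lead_coefC lE.
have wLM : weight d a2 LM = weight d a2 c`_m.
  by rewrite wE /weight wsubst_leading_monomial mul_polyC size_scale // size_polyXn.
have LM0 : LM != 0.
  by apply: contraNneq P0 => LM0; rewrite -lE -lLM LM0 rmorph0 lead_coef0.
have sE : s = (0, (weight d a2 LM)%:Z) + (deg_t *+ (m %% a3) + deg_y *+ (m %/ a3)).
  rewrite /s deg_monoE wLM wE /deg_t /deg_y !pairMn !pairD !intmulE !PoszD !PoszM.
  by congr pair => /=; ring.
have s1E : s.1 = m%:Z.
  rewrite /s deg_monoE /= addr0 addnC [(a3 * _)%N]mulnC -divn_eq //.
have [[ft st] [fy sy]] := (fil_t, fil_y).
have fM : fil s M.
  by rewrite sE; apply: filM; [apply: fil_emb | apply: filM; apply: filX].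
have sM : sym s M = lead (lead_coef (wsubst d a2 c`_m)) * cth ^+ (m %/ a3).
  rewrite sE symM; [|exact: fil_emb|by apply: filM; apply: filX].
  by rewrite sym_emb // lLM symM ?symX ?st ?sy ?expr1n ?mul1r //; apply: filX.
have sM0 : sym s M != 0.
  rewrite sM mulf_neq0 ?expf_neq0 //.
  by rewrite -(rmorph0 lead) (inj_eq lead_inj) lead_coef_eq0 (wsubst_eq0 _ d0).
have s2E : s.2 = (weight d a2 c`_m)%:Z + dth *+ (m %/ a3).
  rewrite /s deg_monoE wE /= intmulE /dth; lia.
have [vt ct] := vle_theta.
have v1 : vle V (weight d a2 c`_m)%:Z (toF c`_m) by apply/vle_toF.
have top : vle V s.2 (iota (of_nf c))`_m.
  by rewrite coef_iota_nf ?cm // s2E; apply: vleM => //; apply: vleX.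
split=> //.
  move=> n an; have nm : (n <= m)%N.
    by rewrite -ltnS -cm -size_iota_nf ltnNge; apply: contra an => ?; rewrite nth_default.
  have [->|ne] := eqVneq n m; first by right.
  by left; rewrite s1E ltz_nat ltn_neqAle ne.
rewrite {1}/sym s1E sM coef_iota_nf ?cm // s2E vcoefM ?vcoefX //; last exact: vleX.
by rewrite vcoef_toF.
Qed.

(** * Kernels of locally nilpotent derivations *)

Section LocallyNilpotent.
Variable D : A -> A.
Hypothesis derD : {morph D : a b / a + b}.
Hypothesis derM : forall a b, D (a * b) = D a * b + a * D b.
Hypothesis derK : forall k : K, D k%:A = 0.
Hypothesis locnil : forall a, exists n, iter n D a = 0.
Hypothesis der_neq0 : exists a, D a != 0.

Definition jump e s a := fil s a /\ fil (s + e) (D a).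

Lemma jumpM e s s' a b : jump e s a -> jump e s' b -> jump e (s + s') (a * b).
Proof.
move=> [sa sda] [sb sdb]; split; first exact: filM.
rewrite derM; apply: filD; first by rewrite addrAC; apply: filM.
by rewrite -addrA; apply: filM.
Qed.

Lemma jumpX e s a n : jump e s a -> jump e (s *+ n) (a ^+ n).
Proof.
move=> sa; elim: n => [|n IH]; last by rewrite mulrS exprS; apply: jumpM.
rewrite mulr0n expr0 -(scale1r (1 : A)); split; first exact: fil_c.
by rewrite derK; apply: fil0.
Qed.

(** The degree of D as a map of filtered spaces: the largest difference
    deg (D g) - deg g over the generators g.  It is attained, so the leading
    part of D is not zero. *)
Lemma max_jump : exists e, [/\ jump e deg_x x, jump e deg_y y, jump e deg_z z, jump e deg_t t &
  exists s g, [/\ jump e s g, (s, g) \in [:: (deg_x, x); (deg_y, y); (deg_z, z); (deg_t, t)] &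
     sym (s + e) (D g) != 0]].
Proof.
have H (r : seq ((int * int) * A)) : (exists2 g, g \in r & D g.2 != 0) ->
    exists e, (forall g, g \in r -> fil (g.1 + e) (D g.2)) /\
      exists2 g, g \in r & sym (g.1 + e) (D g.2) != 0.
  elim: r => [[g]//|[s a] r IH] H.
  have [a0|an] := eqVneq (D a) 0.
    have [|e [He [g gr gs]]] := IH.
      case: H => g; rewrite inE => /predU1P[-> /=|gr gn]; first by rewrite a0 eqxx.
      by exists g.
    exists e; split; last by exists g => //; rewrite inE gr orbT.
    by move=> g'; rewrite inE => /predU1P[-> /=|/He//]; rewrite a0; apply: fil0.
  have [s' [s'a s'n]] := exact_exists an.
  have [[g gr gn]|nr] := pselect (exists2 g, g \in r & D g.2 != 0); last first.
    exists (s' - s); split.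
      move=> g; rewrite inE => /predU1P[-> /=|gr]; first by rewrite addrC subrK.
      have [->|gn] := eqVneq (D g.2) 0; first exact: fil0.
      by case: nr; exists g.
    by exists (s, a); rewrite ?inE ?eqxx //= addrC subrK.
  have [|e [He [g' g'r g's]]] := IH; first by exists g.
  have [le|le] := lexle_total s' (s + e).
    exists e; split; last by exists g' => //; rewrite inE g'r orbT.
    move=> g''; rewrite inE => /predU1P[-> /=|/He//]; exact: fil_trans le s'a.
  exists (s' - s); split; last by exists (s, a); rewrite ?inE ?eqxx //= addrC subrK.
  move=> g''; rewrite inE => /predU1P[-> /=|/He]; first by rewrite addrC subrK.
  apply: fil_trans; rewrite addrC [X in lexle _ X]addrC lexleD2r.
  by rewrite -(lexleD2r _ _ s) subrK addrC.
have [|e [He [[s g] gr gs]]] := H [:: (deg_x, x); (deg_y, y); (deg_z, z); (deg_t, t)].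
  apply: contrapT => nH; have [a] := der_neq0; case/eqP.
  have D0 g : g \in [:: (deg_x, x); (deg_y, y); (deg_z, z); (deg_t, t)] -> D g.2 = 0.
    by move=> gr; apply/eqP; apply: contrapT => /negP gn; case: nH; exists g.
  move: a; apply: gen => [c|a b Ha Hb|a b Ha Hb||||].
  - exact: derK.
  - by rewrite derD Ha Hb addr0.
  - by rewrite derM Ha Hb mul0r mulr0 addr0.
  - by apply: (D0 (deg_x, x)); rewrite !inE eqxx.
  - by apply: (D0 (deg_y, y)); rewrite !inE eqxx ?orbT.
  - by apply: (D0 (deg_z, z)); rewrite !inE eqxx ?orbT.
  - by apply: (D0 (deg_t, t)); rewrite !inE eqxx ?orbT.
have jx : jump e deg_x x.
  by split; [case: fil_x | apply: (He (deg_x, x)); rewrite !inE eqxx].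
have jy : jump e deg_y y.
  by split; [case: fil_y | apply: (He (deg_y, y)); rewrite !inE eqxx ?orbT].
have jz : jump e deg_z z.
  by split; [case: fil_z | apply: (He (deg_z, z)); rewrite !inE eqxx ?orbT].
have jt : jump e deg_t t.
  by split; [case: fil_t | apply: (He (deg_t, t)); rewrite !inE eqxx ?orbT].
exists e; split=> //; exists s, g; split=> //.
by move: gr; rewrite !inE => /or4P[] /eqP[-> ->].
Qed.

Definition jmp : int * int := sval (cid max_jump).
Let jmpP := svalP (cid max_jump).
Let jump_x : jump jmp deg_x x. Proof. by case: jmpP. Qed.
Let jump_y : jump jmp deg_y y. Proof. by case: jmpP. Qed.
Let jump_z : jump jmp deg_z z. Proof. by case: jmpP. Qed.
Let jump_t : jump jmp deg_t t. Proof. by case: jmpP. Qed.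

Lemma filDer s a : fil s a -> fil (s + jmp) (D a).
Proof.
apply: (@fil_span s (fun a => fil (s + jmp) (D a))) => {a} [|a b sa sb|k p q i j le].
- by rewrite -(scale0r (1 : A)) derK; apply: fil0.
- by rewrite derD; apply: filD.
have [j1 j2] : jump jmp (deg_mono p q i j) (k%:A * (x ^+ p * z ^+ q * t ^+ i * y ^+ j)).
  rewrite -[deg_mono _ _ _ _]add0r; apply: jumpM.
    by split; [apply: fil_c | rewrite derK; apply: fil0].
  by do !apply: jumpM; apply: jumpX.
by apply: fil_trans j2; rewrite lexleD2r.
Qed.

Lemma symDer s a : fil s a -> sym s a = 0 -> sym (s + jmp) (D a) = 0.
Proof.
move=> sa /(fil_sym0 sa)[->|[s' [lt s'a]]].
  by rewrite -(scale0r (1 : A)) derK /sym; case: (_ + _).1 => // n; rewrite rmorph0 coef0 vcoef0.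
by apply: sym_lt (filDer s'a); rewrite lexltD2r.
Qed.

Let Echar0 n : n.+1%:R != 0 :> E.
Proof.
rewrite -(rmorph_nat lead) -(rmorph0 lead) (inj_eq lead_inj).
by rewrite -(rmorph_nat (@polyC K)) polyC_eq0.
Qed.

(** The image of the leading form of a under the flow exp(u D) of the leading
    part of D. *)
Definition Phi : int * int -> A -> {poly E} := symp sym jmp locnil.

Lemma PhiD s a b : fil s a -> fil s b -> Phi s (a + b) = Phi s a + Phi s b.
Proof. exact: (sympD symD fil0 derD locnil filDer). Qed.

Lemma PhiM s s' a b : fil s a -> fil s' b -> Phi (s + s') (a * b) = Phi s a * Phi s' b.
Proof. exact: (sympM Echar0 filD filM symD symM fil0 derD derM locnil filDer). Qed.

Lemma PhiDer s a : (Phi s a)^`() = Phi (s + jmp) (D a).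
Proof. exact: (sympDer Echar0 symD fil0 jmp derD locnil). Qed.

Lemma Phi_coef0 s a : (Phi s a)`_0 = sym s a.
Proof. exact: (coef0_symp symD fil0 jmp derD locnil). Qed.

Lemma Phi_lower s a : fil s a -> sym s a = 0 -> Phi s a = 0.
Proof. exact: (symp_eq0 symD fil0 derD locnil filDer symDer). Qed.

Lemma Phi_ker s a : D a = 0 -> Phi s a = (sym s a)%:P.
Proof. exact: (symp_ker symD fil0 jmp derD locnil s). Qed.

Lemma Phi_neq0 s a : sym s a != 0 -> Phi s a != 0.
Proof. by apply: contraNneq => P0; rewrite -Phi_coef0 P0 coef0. Qed.

Lemma PhiC k : Phi 0 k%:A = (lead k%:P)%:P.
Proof. by rewrite Phi_ker ?derK // sym_c. Qed.

Lemma PhiX s a n : fil s a -> Phi (s *+ n) (a ^+ n) = Phi s a ^+ n.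
Proof.
move=> sa; elim: n => [|n IH]; last by rewrite mulrS !exprS PhiM ?IH //; apply: filX.
by rewrite mulr0n !expr0 -(scale1r (1 : A)) PhiC !rmorph1.
Qed.

(** Phi depends on the leading form only, by [Phi_lower]. *)
Lemma Phi_eq s a b : fil s a -> fil s b -> sym s a = sym s b -> Phi s a = Phi s b.
Proof.
move=> sa sb ab; have sNb : fil s (- b).
  rewrite -mulN1r -[s]add0r; apply: filM => //.
  by rewrite -(scale1r (1 : A)) -scaleNr; apply: fil_c.
apply/eqP; rewrite -subr_eq0; apply/eqP.
have E1 : Phi s (- b) = - Phi s b.
  rewrite -mulN1r -[s in LHS]add0r PhiM //; last first.
    by rewrite -(scale1r (1 : A)) -scaleNr; apply: fil_c.
  by rewrite -(scale1r (1 : A)) -scaleNr PhiC !(rmorphN, rmorph1) mulN1r.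
rewrite -E1 -PhiD //; apply: Phi_lower; first exact: filD.
by rewrite symD // ab -Phi_coef0 -Phi_coef0 E1 coefN subrr.
Qed.

Let Xb := Phi deg_x x.
Let Yb := Phi deg_y y.
Let Zb := Phi deg_z z.
Let Tb := Phi deg_t t.

Let Xb0 : Xb != 0.
Proof.
apply: Phi_neq0; case: fil_x => _ ->.
by rewrite -(rmorph0 lead) (inj_eq lead_inj) polyX_eq0.
Qed.
Let Yb0 : Yb != 0. Proof. by apply: Phi_neq0; case: fil_y => _ ->. Qed.
Let Zb0 : Zb != 0. Proof. by apply: Phi_neq0; case: fil_z => _ ->; rewrite oner_neq0. Qed.
Let Tb0 : Tb != 0. Proof. by apply: Phi_neq0; case: fil_t => _ ->; rewrite oner_neq0. Qed.

Let deg_f : int * int := (0, (a2 * d)%N%:Z).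
Let deg_fx : deg_x *+ d = deg_f.
Proof. by rewrite /deg_x pairMn mul0rn intmulE -PoszM. Qed.
Let deg_fz : deg_z *+ a2 = deg_f.
Proof. by rewrite /deg_z pairMn mul0rn intmulE -PoszM mulnC. Qed.
Let fil_xd : fil deg_f (x ^+ d).
Proof. by rewrite -deg_fx; apply: filX; case: fil_x. Qed.
Let fil_za : fil deg_f (z ^+ a2).
Proof. by rewrite -deg_fz; apply: filX; case: fil_z. Qed.
Let Phi_xd : Phi deg_f (x ^+ d) = Xb ^+ d.
Proof. by rewrite -deg_fx PhiX //; case: fil_x. Qed.
Let Phi_za : Phi deg_f (z ^+ a2) = Zb ^+ a2.
Proof. by rewrite -deg_fz PhiX //; case: fil_z. Qed.

Let filCz c : fil deg_f (c%:A * z ^+ a2).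
Proof. by rewrite -[deg_f]add0r; apply: filM => //; apply: fil_c. Qed.

Let fc c : A := x ^+ d + (- c)%:A * z ^+ a2.
Let Fb c : {poly E} := Xb ^+ d - (lead c%:P) *: Zb ^+ a2.

Let fil_fc c : fil deg_f (fc c). Proof. by apply: filD. Qed.

Lemma Phi_fc c : Phi deg_f (fc c) = Fb c.
Proof.
rewrite PhiD // Phi_xd -[deg_f in X in _ + X]add0r PhiM ?Phi_za ?PhiC //; last exact: fil_c.
by rewrite mul_polyC !rmorphN scaleNr.
Qed.

Lemma Fb_coef0 c : (Fb c)`_0 != 0.
Proof.
have E0 : (Fb c)`_0 = lead ('X^d - c%:P).
  rewrite coefB coefZ -!horner_coef0 !horner_exp !horner_coef0 !Phi_coef0.
  have [[_ ->] [_ ->]] := (fil_x, fil_z).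
  by rewrite expr1n mulr1 rmorphB rmorphXn.
by rewrite E0 -(rmorph0 lead) (inj_eq lead_inj) monic_neq0 // monicXnsubC.
Qed.

Let Fb0 c : Fb c != 0.
Proof. by apply: contraNneq (Fb_coef0 c) => ->; rewrite coef0. Qed.

Lemma Fb_const c : c != 0 -> (size (Fb c) <= 1)%N -> (size Xb <= 1)%N && (size Zb <= 1)%N.
Proof.
move=> c0 /size1_polyC FE; apply: (binomial_constant Echar0 d2 a22 _ (Fb_coef0 c) FE).
by rewrite -(rmorph0 lead) (inj_eq lead_inj) polyC_eq0.
Qed.

(** The leading form of the equation is y f^l + t^a3, as x has smaller degree. *)
Lemma Phi_relation : Yb * Fb (-1) ^+ l = - Tb ^+ a3.
Proof.
have [[fx _] [fy _] [ft _]] := And3 fil_x fil_y fil_t.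
have fE : x ^+ d + z ^+ a2 = fc (-1) by rewrite /fc opprK scale1r mul1r.
have sE : deg_y + deg_f *+ l = deg_t *+ a3.
  rewrite /deg_y /deg_f /deg_t !pairMn pairD !intmulE /= -PoszM addNr.
  by congr pair; ring.
have fyf : fil (deg_t *+ a3) (y * fc (-1) ^+ l).
  by rewrite -sE; apply: filM => //; apply: filX.
have fta : fil (deg_t *+ a3) (t ^+ a3) by apply: filX.
apply/eqP; rewrite -addr_eq0 -PhiX // -(Phi_fc (-1)) -PhiX // -PhiM //; last exact: filX.
rewrite sE -PhiD //; apply/eqP; apply: Phi_lower; first exact: filD.
have -> : y * fc (-1) ^+ l + t ^+ a3 = (- 1)%:A * x.
  apply/eqP; rewrite -fE scaleN1r mulN1r -subr_eq0 opprK -rel.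
  by apply/eqP; ring.
apply: (@sym_lt (0 + deg_x)); last by apply: filM => //; apply: fil_c.
rewrite /deg_t /deg_x pairMn intmulE add0r /lexlt /= mul1r ltz_nat a30 //.
Qed.

(** The factorization of the leading form of a is transported by the flow,
    which is multiplicative. *)
Lemma Phi_form s a : fil s a -> sym s a != 0 -> exists k p q cs i j,
  [/\ k != 0, all (fun c => c != 0) cs, (i < a3)%N,
   s = deg_mono p q i j + (0, (a2 * d * size cs)%N%:Z) &
   Phi s a = lead k%:P *: (Xb ^+ p * Zb ^+ q * \prod_(c <- cs) Fb c * Tb ^+ i * Yb ^+ j) /\
   (cs = [::] -> sym s a = sym s (k%:A * (x ^+ p * z ^+ q * t ^+ i * y ^+ j)))].
Proof.
move=> sa sn.
have a0 : a != 0.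
  apply: contraNneq sn => ->; rewrite /sym; case: s.1 => // n.
  by rewrite rmorph0 coef0 vcoef0.
have [k [p [q [cs [i [j [k0 cs0 ia H]]]]]]] := leading_form a0.
case: H; set M := emb _ * _; set s' := _ + _ => s'a s'M sMn sMa.
have ss' : s = s'.
  apply: lexle_anti; first exact: exact_le sa sn.
  by apply: exact_le s'a _; rewrite ?sMa.
exists k, p, q, cs, i, j; rewrite ss'.
have [[fx _] [fz _] [fy _] [ft _]] := And4 fil_x fil_z fil_y fil_t.
pose N := k%:A * (x ^+ p * z ^+ q * \prod_(c <- cs) fc c * t ^+ i * y ^+ j).
have ME : M = N.
  rewrite /M /N /leading_monomial !rmorphM !rmorphXn /= emb_x emb_z emb_c rmorph_prod.
  have -> : \prod_(c <- cs) emb (sx ^+ d - c%:P%:P * sz ^+ a2) = \prod_(c <- cs) fc c.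
    apply: eq_bigr => c _; rewrite /fc rmorphD !rmorphXn -mulNr rmorphM rmorphXn /= -!rmorphN.
    by rewrite emb_x emb_z emb_c.
  by rewrite -!mulrA.
have fcs : fil (0, (a2 * d * size cs)%N%:Z) (\prod_(c <- cs) fc c) /\
    Phi (0, (a2 * d * size cs)%N%:Z) (\prod_(c <- cs) fc c) = \prod_(c <- cs) Fb c.
  elim: cs {cs0 s' s'a s'M sMn sMa ss' N M ME} => [|c cs [IH1 IH2]].
    rewrite !big_nil muln0; case: fil1 => f1 s1; split=> //.
    by rewrite -(scale1r (1 : A)) PhiC rmorph1.
  rewrite !big_cons.
  have -> : (0, (a2 * d * size (c :: cs))%N%:Z) = deg_f + (0, (a2 * d * size cs)%N%:Z).
    by rewrite /deg_f pairD addr0 -PoszD -mulnS.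
  by split; [apply: filM | rewrite PhiM // Phi_fc IH2].
split=> //; split.
- rewrite (@Phi_eq s' a M) // ME /N.
  have -> : s' = 0 + (deg_x *+ p + deg_z *+ q + (0, (a2 * d * size cs)%N%:Z) + deg_t *+ i + deg_y *+ j).
    by rewrite /s' /deg_mono add0r; rewrite -!addrA; congr (_ + (_ + _)); rewrite !addrA addrC -!addrA.
  case: fcs => fcs Pcs.
  have [f1 f2 f3 f4] := And4 (@filX _ _ p fx) (@filX _ _ q fz) (@filX _ _ i ft) (@filX _ _ j fy).
  have f12 := filM f1 f2; have f123 := filM f12 fcs; have f1234 := filM f123 f3.
  have fall := filM f1234 f4.
  rewrite PhiM //; last exact: fil_c.
  by rewrite (PhiM f1234 f4) (PhiM f123 f3) (PhiM f12 fcs) (PhiM f1 f2) !PhiX // Pcs PhiC mul_polyC.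
- by move=> cs1; rewrite sMa ME /N cs1 big_nil mulr1.
Qed.

Lemma sym_mono k p q i j :
  fil (deg_mono p q i j) (k%:A * (x ^+ p * z ^+ q * t ^+ i * y ^+ j)) /\
  sym (deg_mono p q i j) (k%:A * (x ^+ p * z ^+ q * t ^+ i * y ^+ j)) =
  lead k%:P * (lead 'X ^+ p * cth ^+ j).
Proof.
have [[fx sx'] [fz sz'] [fy sy] [ft st]] := And4 fil_x fil_z fil_y fil_t.
have [f1 f2 f3 f4] := And4 (@filX _ _ p fx) (@filX _ _ q fz) (@filX _ _ i ft) (@filX _ _ j fy).
have f12 := filM f1 f2; have f123 := filM f12 f3; have f1234 := filM f123 f4.
rewrite -[deg_mono p q i j]add0r; split; first exact: (filM (@fil_c k) f1234).
rewrite (symM (@fil_c k) f1234) sym_c (symM f123 f4) (symM f12 f3) (symM f1 f2).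
by rewrite !symX // sx' sz' sy st !expr1n !mulr1.
Qed.

(** On the kernel Phi is constant, and a factor of a nonzero constant polynomial
    is constant: each of x, z, t, y and x^d - c z^a2 that divides the leading
    form of u is constant along the flow. *)
Lemma ker_form u : D u = 0 -> u != 0 -> exists k p q cs i j,
  let s := deg_mono p q i j + (0, (a2 * d * size cs)%N%:Z) in
  [/\ k != 0, all (fun c => c != 0) cs, fil s u /\ (iota u)`_(i + a3 * j) != 0,
   cs = [::] -> sym s u = lead k%:P * (lead 'X ^+ p * cth ^+ j) &
   [/\ (0 < p)%N -> (size Xb <= 1)%N, (0 < q)%N -> (size Zb <= 1)%N,
     (0 < i)%N -> (size Tb <= 1)%N, (0 < j)%N -> (size Yb <= 1)%N &
     forall c, c \in cs -> (size (Fb c) <= 1)%N]].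
Proof.
move=> Du u0; have [s [su sn]] := exact_exists u0.
have [k [p [q [cs [i [j [k0 cs0 ia sE [PE sym_cs]]]]]]]] := Phi_form su sn.
exists k, p, q, cs, i, j; split=> //.
- rewrite -sE; split=> //; move: sn; rewrite /sym sE deg_monoE /=.
  by rewrite ?addr0 ?addn0; apply: contraNneq => ->; rewrite vcoef0.
- move=> cs_nil; rewrite -sE (sym_cs cs_nil) sE cs_nil muln0.
  rewrite (_ : _ + (0, 0%:Z) = deg_mono p q i j); first by have [] := sym_mono k p q i j.
  exact: addr0.
have P1 : (size (Phi s u) <= 1)%N by rewrite (Phi_ker s Du) size_polyC_leq1.
have P0 : Phi s u != 0 by apply: Phi_neq0.
have lk0 : lead k%:P != 0 by rewrite -(rmorph0 lead) (inj_eq lead_inj) polyC_eq0.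
have pr0 : \prod_(c <- cs) Fb c != 0.
  by rewrite prodf_seq_neq0; apply/allP => c _; rewrite Fb0.
move: P1; rewrite PE size_scale // !size_M_le1 ?mulf_neq0 ?expf_neq0 //.
move=> /andP[/andP[/andP[/andP[H1 H2] H3] H4] H5].
have pow (P : {poly E}) n : (size (P ^+ n) <= 1)%N -> (0 < n)%N -> (size P <= 1)%N.
  by move=> H n0; rewrite -(size_exp_le1 P n0).
split; [exact: pow H1|exact: pow H2|exact: pow H4|exact: pow H5|].
move=> c cc; move: H3 pr0; rewrite (big_rem _ cc) /= => + pr0.
by rewrite size_M_le1 // => /andP[].
Qed.

(** The power of t in a leading form is the t-degree mod a3, since y has t-degree
    a3. *)
Let Tb_dvd s a n : fil s a -> sym s a != 0 -> s.1 = n%:Z -> Tb ^+ (n %% a3) %| Phi s a.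
Proof.
move=> sa sn s1; have [k [p [q [cs [i [j [k0 cs0 ia sE [-> _]]]]]]]] := Phi_form sa sn.
have -> : (n %% a3 = i)%N.
  move: s1; rewrite sE deg_monoE /= ?addr0 ?addn0 => -[<-].
  by rewrite addnC mulnC modnMDl modn_small.
by rewrite -mul_polyC mulrA; apply: dvdp_mulr; rewrite mulrA dvdp_mulIr.
Qed.

Let Tb_Fb : ((size Tb).-1 * a3)%N = ((size Yb).-1 + (size (Fb (-1))).-1 * l)%N.
Proof.
have := congr1 (fun P : {poly E} => size P) Phi_relation; rewrite size_polyN.
rewrite size_mul ?expf_neq0 // => sE.
have {}sE : (size Yb + size (Fb (-1) ^+ l)).-1 = size (Tb ^+ a3) by exact: sE.
rewrite -(size_exp Tb a3) -(size_exp (Fb (-1)) l).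
have h1 : (0 < size Yb)%N by rewrite size_poly_gt0.
have h2 : (0 < size (Fb (-1) ^+ l))%N by rewrite size_poly_gt0 expf_neq0.
by rewrite -sE -(prednK h1) -(prednK h2) addSn addnS.
Qed.

(** Let y and one of x, z be constant along the flow, and let Q be the flow of
    the other one, so that the equation reads a3 deg T = m l deg Q with m = d or
    m = a2.  If e1 is the t-degree of D, then Q' and T' are flows of leading
    forms of t-degree e1 and e1 + 1, whence T^(e1 mod a3) | Q' and
    T^((e1 + 1) mod a3) | T'.  The latter leaves only e1 = -1 mod a3, and then
    (a3 - 1) deg T < deg Q contradicts the equation. *)
Lemma flow_degree s g Q m : jump jmp s g -> s.1 = 0 -> Phi s g = Q ->
  (2 <= m)%N -> (1 < size Q)%N ->
  ((size Tb).-1 * a3)%N = ((size Q).-1 * m * l)%N -> False.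
Proof.
move=> [sg sdg] s1 PQ m2 Q1 tE.
have T1 : (1 < size Tb)%N.
  rewrite ltnNge; apply/negP => T1; move: tE; have -> : (size Tb).-1 = 0%N by slia.
  by rewrite mul0n => /esym /eqP; rewrite !muln_eq0; slia.
have DQ : Q^`() = Phi (s + jmp) (D g) by rewrite -PQ PhiDer.
have DT : Tb^`() = Phi (deg_t + jmp) (D t) by rewrite PhiDer.
have Q'0 := deriv_neq0 Echar0 Q1; have T'0 := deriv_neq0 Echar0 T1.
have sQ : sym (s + jmp) (D g) != 0.
  by apply: contraNneq Q'0 => s0; rewrite DQ (Phi_lower sdg s0).
have sT : sym (deg_t + jmp) (D t) != 0.
  have [_ sdt] := jump_t.
  by apply: contraNneq T'0 => s0; rewrite DT (Phi_lower sdt s0).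
have [e1 e1E] : exists e1 : nat, jmp.1 = e1%:Z.
  move: sQ; rewrite /sym; have -> : (s + jmp).1 = jmp.1 by rewrite /= s1 add0r.
  by case: jmp.1 => [n|n]; [exists n | rewrite eqxx].
have dQ : Tb ^+ (e1 %% a3) %| Q^`().
  by rewrite DQ; apply: Tb_dvd => //=; rewrite s1 add0r.
have dT : Tb ^+ (e1.+1 %% a3) %| Tb^`().
  by rewrite DT; apply: Tb_dvd => //; [case: jump_t | rewrite /= e1E intS].
have b1 := dvdp_leq Q'0 dQ; have b2 := dvdp_leq T'0 dT.
have Q0 : Q != 0 by rewrite -size_poly_gt0 (ltnW Q1).
have b3 := lt_size_deriv Q0; have b4 := lt_size_deriv Tb0.
case r0 : (e1.+1 %% a3)%N => [|r]; last first.
  move: b2; rewrite r0 => b2.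
  have b5 : (size Tb <= size (Tb ^+ r.+1))%N.
    by apply: dvdp_leq; rewrite ?expf_neq0 // exprS dvdp_mulIl.
  by have := leq_ltn_trans (leq_trans b5 b2) b4; rewrite ltnn.
have rE : (e1 %% a3 = a3.-1)%N.
  have r1 : (e1 %% a3 < a3)%N by rewrite ltn_pmod.
  have [rl|r2] := ltnP (e1 %% a3).+1 a3; last first.
    by apply/eqP; rewrite -eqSS prednK // eqn_leq r1 r2.
  by move: r0; rewrite -addn1 -modnDml addn1 modn_small.
have b6 := size_exp Tb a3.-1.
rewrite rE in b1.
have b7 : ((size Tb).-1 * a3.-1 < (size Q).-1)%N.
  have h0 : (0 < size (Tb ^+ a3.-1))%N by rewrite size_poly_gt0 expf_neq0.
  rewrite -b6 -ltnS !prednK ?(ltnW Q1) //; exact: leq_ltn_trans b1 b3.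
have b8 : ((size Q).-1 * m * l * a3.-1 < (size Q).-1 * a3)%N.
  by rewrite -tE mulnAC ltn_mul2r a30.
have b9 : ((size Q).-1 * 2 * a3.-1 <= (size Q).-1 * m * l * a3.-1)%N.
  by rewrite leq_mul2r -[X in (X <= _)%N]muln1 leq_mul ?orbT // leq_mul2l m2 orbT.
have b10 := leq_ltn_trans b9 b8.
move: b10; rewrite -mulnA ltn_mul2l => /andP[_].
by case: (a3) a32 => [|[|n]] //= _; rewrite mul2n -addnn addnS !ltnS ltnNge leq_addl.
Qed.

Let xy_const_flow : (size Xb <= 1)%N -> (size Yb <= 1)%N -> (size Zb <= 1)%N.
Proof.
move=> X1 Y1; rewrite leqNgt; apply/negP => Z1.
apply: (@flow_degree deg_z z Zb a2) => //.
rewrite Tb_Fb; have -> : (size Yb).-1 = 0%N by slia.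
rewrite add0n; congr (_ * _)%N; rewrite -size_exp; congr _.-1.
have lm1 : lead (-1)%:P != 0.
  by rewrite -(rmorph0 lead) (inj_eq lead_inj) polyC_eq0 oppr_eq0 oner_eq0.
have h : (size (Xb ^+ d) <= 1)%N by rewrite size_exp_le1.
rewrite /Fb addrC size_polyDl size_polyN size_scale //.
by rewrite (leq_ltn_trans h) // ltnNge size_exp_le1 // -ltnNge.
Qed.

Let zy_const_flow : (size Zb <= 1)%N -> (size Yb <= 1)%N -> (size Xb <= 1)%N.
Proof.
move=> Z1 Y1; rewrite leqNgt; apply/negP => X1.
apply: (@flow_degree deg_x x Xb d) => //.
rewrite Tb_Fb; have -> : (size Yb).-1 = 0%N by slia.
rewrite add0n; congr (_ * _)%N; rewrite -size_exp; congr _.-1.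
rewrite /Fb size_polyDl // size_polyN size_scale; last first.
  by rewrite -(rmorph0 lead) (inj_eq lead_inj) polyC_eq0 oppr_eq0 oner_eq0.
have h : (size (Zb ^+ a2) <= 1)%N by rewrite size_exp_le1.
by rewrite (leq_ltn_trans h) // ltnNge size_exp_le1 // -ltnNge.
Qed.

(** The equation makes t and y constant together, and the leading part of D does
    not kill all generators. *)
Lemma xz_const_flow : (size Xb <= 1)%N -> (size Zb <= 1)%N ->
  (1 < size Tb)%N /\ (1 < size Yb)%N.
Proof.
move=> X1 Z1.
have F1 : (size (Fb (-1)) <= 1)%N.
  rewrite (leq_trans (size_polyD _ _)) // geq_max size_exp_le1 // X1 size_polyN /=.
  by rewrite (leq_trans (size_scale_leq _ _)) // size_exp_le1.
have TY : (size Tb <= 1)%N = (size Yb <= 1)%N.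
  have h1 : (0 < size Yb)%N by rewrite size_poly_gt0.
  have h2 : (0 < size Tb)%N by rewrite size_poly_gt0.
  have := Tb_Fb; have -> : (size (Fb (-1))).-1 = 0%N by slia.
  rewrite mul0n addn0; move: h1 h2; case: (size Yb) => [|[|u]] //; case: (size Tb) => [|[|w]] //=; lia.
have [T1|T1] := ltnP 1 (size Tb); first by rewrite ltnNge -TY -ltnNge T1.
have Y1 : (size Yb <= 1)%N by rewrite -TY.
case: jmpP => _ _ _ _ [s [g [jg gr sn]]].
have : Phi (s + jmp) (D g) != 0 by apply: Phi_neq0.
rewrite -PhiDer; case/negP; apply/eqP; apply: size1_deriv.
by move: gr; rewrite !inE => /or4P[] /eqP[-> ->].
Qed.

Section RankTwo.
Variable psi : {rmorphism S -> A}.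
Hypothesis psi_c : forall c : K, psi c%:P%:P = c%:A.
Hypothesis psi_inj : injective psi.
Hypothesis psi_ker : forall p, D (psi p) = 0.

(** If all leading forms of the kernel were multiples of powers of a single one,
    the elements of the kernel of degree at most n g would form a space of
    dimension at most n + 1.  But the kernel contains a polynomial ring in two
    variables, where the dimension grows quadratically: N^2 monomials of
    degree less than N in each variable have degree below (N^2 - 1) g once N is
    large. *)
Lemma rank_two (g : int * int) (w : E) : lexlt 0 g -> w != 0 ->
  (forall u, D u = 0 -> u != 0 -> exists m k,
     [/\ k != 0, fil (g *+ m) u & sym (g *+ m) u = lead k%:P * w ^+ m]) -> False.
Proof.
move=> g0 w0 H.
have lk0 (k : K) : k != 0 -> lead k%:P != 0.
  by move=> k0; rewrite -(rmorph0 lead) (inj_eq lead_inj) polyC_eq0.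
pose lev Q (u : A) := D u = 0 /\ (u != 0 -> exists m k,
     [/\ (m < Q)%N, k != 0, fil (g *+ m) u & sym (g *+ m) u = lead k%:P * w ^+ m]).
have Dsc c b : D b = 0 -> D (c *: b) = 0.
  by move=> b0; rewrite -mulr_algl derM derK mul0r b0 mulr0 addr0.
have DN b : D b = 0 -> D (- b) = 0 by move=> b0; rewrite -scaleN1r Dsc.
have levtop Q b : lev Q.+1 b -> ~ lev Q b -> exists2 k, k != 0 &
    [/\ fil (g *+ Q) b & sym (g *+ Q) b = lead k%:P * w ^+ Q].
  move=> [Db lb] nb; have [b0|bn] := eqVneq b 0.
    by case: nb; split=> //; rewrite b0 eqxx.
  have [m [k [mQ k0 fb sb]]] := lb bn; have [mE|ne] := eqVneq m Q; first by rewrite -mE; exists k.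
  by case: nb; split=> // _; exists m, k; split=> //; rewrite ltn_neqAle ne.
have lev0 u : lev 0%N u -> u = 0.
  by move=> [_ lu]; apply/eqP; apply: contrapT => /negP /lu [m [k []]].
have levS Q a b : lev Q.+1 a -> lev Q.+1 b -> ~ lev Q b ->
    exists c : K, lev Q (a - c *: b).
  move=> la lb nb; have [la'|na] := pselect (lev Q a).
    by exists 0; rewrite scale0r subr0.
  have [ka ka0 [fa sa]] := levtop _ _ la na; have [kb kb0 [fb sb]] := levtop _ _ lb nb.
  exists (ka / kb); have Dab : D (a - (ka / kb) *: b) = 0.
    by case: la lb => [Da _] [Db _]; rewrite derD Da add0r DN // Dsc.
  have abE : a - (ka / kb) *: b = a + (- (ka / kb))%:A * b by rewrite mulr_algl scaleNr.
  have fcb : fil (g *+ Q) ((- (ka / kb))%:A * b).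
    by rewrite -[g *+ Q]add0r; apply: filM => //; apply: fil_c.
  have fab : fil (g *+ Q) (a - (ka / kb) *: b) by rewrite abE; apply: filD.
  have sab : sym (g *+ Q) (a - (ka / kb) *: b) = 0.
    rewrite abE symD // sa -[g *+ Q in X in _ + X]add0r symM //; last exact: fil_c.
    rewrite sym_c sb mulrA -mulrDl -rmorphM -rmorphD -rmorphM -rmorphD /=.
    by rewrite mulNr divfK // subrr !rmorph0 mul0r.
  split=> // ab0; have [m [k [k0 fm sm]]] := H _ Dab ab0.
  exists m, k; split=> //.
  have smn : sym (g *+ m) (a - (ka / kb) *: b) != 0.
    by rewrite sm mulf_neq0 ?expf_neq0 // lk0.
  have mQ := lexlt_muln g0 (exact_le fab fm smn).
  rewrite ltn_neqAle mQ andbT; apply: contraNneq smn => ->; exact/eqP.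
have px0 : psi sx != 0 by rewrite -(rmorph0 psi) (inj_eq psi_inj) polyC_eq0 polyX_eq0.
have pz0 : psi sz != 0 by rewrite -(rmorph0 psi) (inj_eq psi_inj) polyX_eq0.
have [mx [kx [kx0 fx sx']]] := H _ (psi_ker _) px0.
have [mz [kz [kz0 fz sz']]] := H _ (psi_ker _) pz0.
pose N := (mx + mz).+2; pose Q := (N * N).-1.
pose v (i : 'I_Q.+1) := psi (sx ^+ (i %/ N) * sz ^+ (i %% N)).
have vlev i : lev Q (v i).
  split=> [|_]; first exact: psi_ker.
  have iN : (i %/ N < N)%N by rewrite ltn_divLR // -[(N * N)%N]prednK.
  have iN' : (i %% N < N)%N by rewrite ltn_pmod.
  exists (mx * (i %/ N) + mz * (i %% N))%N, (kx ^+ (i %/ N) * kz ^+ (i %% N)).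
  split.
  - exact: level_bound.
  - by rewrite mulf_neq0 ?expf_neq0.
  - by rewrite mulrnDr !mulrnA /v rmorphM !rmorphXn; apply: filM; apply: filX.
  rewrite mulrnDr !mulrnA /v rmorphM !rmorphXn symM; try exact: filX.
  rewrite !symX // sx' sz' !rmorphM !rmorphXn /= !exprMn exprD !exprM; ring.
have [al [i0 al0] als] := filtered_dependent lev0 levS vlev.
pose P : S := \sum_i (al i)%:P%:P * (sx ^+ (i %/ N) * sz ^+ (i %% N)).
have P0 : P = 0.
  apply: psi_inj; rewrite rmorph0 rmorph_sum -[RHS]als; apply: eq_bigr => i _.
  by rewrite rmorphM /= psi_c mulr_algl.
have := congr1 (fun p : S => (p`_(i0 %% N))`_(i0 %/ N)) P0.
rewrite !coef0 /P !coef_sum (bigD1 i0) //= big1 => [|i ii].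
  rewrite -rmorphXn mulrA -rmorphM /= coefMXn ltnn subnn coefC eqxx coefCM coefXn eqxx mulr1 addr0.
  by move/eqP; rewrite (negPf al0).
rewrite -rmorphXn mulrA -rmorphM /= coefCM coefXn.
have [qE|_] := eqVneq (i0 %% N)%N (i %% N)%N; last by rewrite mulr0 coef0.
rewrite mulr1 coefCM coefXn; have [pE|_] := eqVneq (i0 %/ N)%N (i %/ N)%N; last by rewrite mulr0.
case/eqP: ii; apply: val_inj; rewrite /= (divn_eq i N) (divn_eq i0 N).
by rewrite qE pE.
Qed.

(** If x and z are constant along the flow, t and y are not, so the leading
    forms of the kernel contain neither t nor y: elements of the kernel have
    t-degree 0.  Otherwise [Fb_const] makes all x^d - c z^a2 with c <> 0
    nonconstant, then so is t by the equation, and at most one of x, z, y is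
    constant.  The leading forms of the kernel are then multiples of powers of
    this single one, which [rank_two] excludes. *)
Theorem ker_in_emb u : D u = 0 -> exists p, u = emb p.
Proof.
move=> Du; have [->|u0] := eqVneq u 0; first by exists 0; rewrite rmorph0.
have [/andP[X1 Z1]|nXZ] := boolP ((size Xb <= 1) && (size Zb <= 1))%N.
  have [T1 Y1] := xz_const_flow X1 Z1.
  have [k [p [q [cs [i [j H]]]]]] := ker_form Du u0; case: H.
  set s := _ + _ => _ _ [su _] _ [_ _ iT jY _].
  have i0 : i = 0%N by case: i iT {s su} => // i /(_ isT); rewrite leqNgt T1.
  have j0 : j = 0%N by case: j jY {s su} => // j /(_ isT); rewrite leqNgt Y1.
  apply: size_iota_le1; apply/leq_sizeP => n n1; apply: (fil_gt su).
  by rewrite /s deg_monoE i0 j0 muln0 /= addr0 ltz_nat.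
have F1 c : c != 0 -> (1 < size (Fb c))%N.
  by move=> c0; rewrite ltnNge; apply: contra nXZ; apply: Fb_const.
have T1 : (1 < size Tb)%N.
  have f1 : (1 < size (Fb (-1)))%N by rewrite F1 // oppr_eq0 oner_eq0.
  rewrite ltnNge; apply/negP => T1; have := Tb_Fb.
  have -> : (size Tb).-1 = 0%N by slia.
  rewrite mul0n => /esym /eqP; rewrite addn_eq0 muln_eq0 => /andP[_ /orP[]] /eqP; slia.
have nXY : ~~ ((size Xb <= 1) && (size Yb <= 1))%N.
  by apply: contra nXZ => /andP[X1 Y1]; rewrite X1 xy_const_flow.
have nZY : ~~ ((size Zb <= 1) && (size Yb <= 1))%N.
  by apply: contra nXZ => /andP[Z1 Y1]; rewrite Z1 zy_const_flow.
have ker2 w : D w = 0 -> w != 0 -> exists k p q j,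
  [/\ k != 0, fil (deg_mono p q 0 j) w,
     sym (deg_mono p q 0 j) w = lead k%:P * (lead 'X ^+ p * cth ^+ j) &
   [/\ (0 < p)%N -> (size Xb <= 1)%N, (0 < q)%N -> (size Zb <= 1)%N &
     (0 < j)%N -> (size Yb <= 1)%N]].
  move=> Dw w0; have [k [p [q [cs [i [j H]]]]]] := ker_form Dw w0.
  case: H => k0 cs0 [fw _] sw [hp hq hi hj hcs].
  have i0 : i = 0%N by case: i hi {fw sw} => // i /(_ isT); rewrite leqNgt T1.
  have cs_nil : cs = [::].
    case: cs cs0 hcs {fw sw} => // c cs /andP[c0 _] /(_ c (mem_head _ _)).
    by rewrite leqNgt F1.
  have sE : deg_mono p q i j + (0, (a2 * d * size cs)%N%:Z) = deg_mono p q 0 j.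
    by rewrite i0 cs_nil muln0; apply: addr0.
  by exists k, p, q, j; rewrite -sE; split=> //; apply: sw.
exfalso; have [X1|X1] := leqP (size Xb) 1.
  apply: (@rank_two deg_x (lead 'X)).
  - by rewrite /lexlt /= ltz_nat a20.
  - by rewrite -(rmorph0 lead) (inj_eq lead_inj) polyX_eq0.
  move=> w Dw w0; have [k [p [q [j [k0 fw sw [hp hq hj]]]]]] := ker2 w Dw w0.
  have q0 : q = 0%N by case: q hq {fw sw} => // q /(_ isT) Z1; rewrite X1 Z1 in nXZ.
  have j0 : j = 0%N by case: j hj {fw sw} => // j /(_ isT) Y1; rewrite X1 Y1 in nXY.
  exists p, k; move: fw sw; rewrite q0 j0 expr0 mulr1 /deg_mono !mulr0n !addr0.
  by split.
have [Z1|Z1] := leqP (size Zb) 1.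
  apply: (@rank_two deg_z 1).
  - by rewrite /lexlt /= ltz_nat d0.
  - exact: oner_neq0.
  move=> w Dw w0; have [k [p [q [j [k0 fw sw [hp hq hj]]]]]] := ker2 w Dw w0.
  have p0 : p = 0%N by case: p hp {fw sw} => // p /(_ isT) X2; rewrite leqNgt X1 in X2.
  have j0 : j = 0%N by case: j hj {fw sw} => // j /(_ isT) Y1; rewrite Z1 Y1 in nZY.
  exists q, k; move: fw sw; rewrite p0 j0 !expr0 mulr1 expr1n /deg_mono !mulr0n !addr0 add0r.
  by split.
apply: (@rank_two deg_y cth) => //.
  by rewrite /lexlt /= ltz_nat a30.
move=> w Dw w0; have [k [p [q [j [k0 fw sw [hp hq hj]]]]]] := ker2 w Dw w0.
have p0 : p = 0%N by case: p hp {fw sw} => // p /(_ isT) X2; rewrite leqNgt X1 in X2.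
have q0 : q = 0%N by case: q hq {fw sw} => // q /(_ isT) Z2; rewrite leqNgt Z1 in Z2.
exists j, k; move: fw sw; rewrite p0 q0 expr0 mul1r /deg_mono !mulr0n !addr0 add0r.
by split.
Qed.

End RankTwo.
End LocallyNilpotent.

(** * The triangular derivation *)

(** The derivation f^l d/dt of F[t] maps A to itself: it sends y to
    - a3 t^(a3-1). *)
Lemma del_exists a : exists b, iota b = toF sf ^+ l *: (iota a)^`().
Proof.
move: a; apply: gen => [c|a b [a' Ha] [b' Hb]|a b [a' Ha] [b' Hb]||||].
- by exists 0; rewrite iota_c derivC scaler0 rmorph0.
- by exists (a' + b'); rewrite !(rmorphD iota) /= derivD scalerDr Ha Hb.
- exists (a' * b + a * b'); rewrite (rmorphD iota) !(rmorphM iota) /= derivM scalerDr Ha Hb.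
  by rewrite -scalerAl -scalerAr.
- by exists 0; rewrite iota_x derivC scaler0 rmorph0.
- exists (- (t ^+ a3.-1 *+ a3)); rewrite rmorphN rmorphMn rmorphXn /= iota_t iota_y.
  rewrite deriv_mulC derivD derivC addr0 derivXn mul_polyC scalerA [_ * theta]mulrC.
  by rewrite theta_mul scaleN1r.
- by exists 0; rewrite iota_z derivC scaler0 rmorph0.
- by exists (emb (sf ^+ l)); rewrite iota_emb iota_t derivX alg_polyC rmorphXn.
Qed.

Definition del a : A := sval (cid (del_exists a)).
Lemma delP a : iota (del a) = toF sf ^+ l *: (iota a)^`().
Proof. exact: svalP (cid (del_exists a)). Qed.

Lemma del_D : {morph del : a b / a + b}.
Proof.
by move=> a b; apply: iota_inj; rewrite (rmorphD iota) !delP (rmorphD iota) derivD scalerDr.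
Qed.

Lemma del_M a b : del (a * b) = del a * b + a * del b.
Proof.
apply: iota_inj; rewrite (rmorphD iota) !(rmorphM iota) !delP (rmorphM iota) derivM scalerDr.
by rewrite -scalerAl -scalerAr.
Qed.

Lemma del_emb p : del (emb p) = 0.
Proof. by apply: iota_inj; rewrite delP iota_emb derivC scaler0 rmorph0. Qed.

Lemma del_locnil a : exists n, iter n del a = 0.
Proof.
have H n : iota (iter n del a) = (toF sf ^+ l) ^+ n *: (iota a)^`(n).
  elim: n => [|n IH]; first by rewrite expr0 scale1r derivn0.
  by rewrite iterS delP IH derivZ scalerA -exprS derivnS.
exists (size (iota a)); apply: iota_inj.
by rewrite H derivn_poly0 // scaler0 rmorph0.
Qed.

Lemma del_t : del t != 0.
Proof.
rewrite -(inj_eq iota_inj) delP iota_t derivX rmorph0 scaler_eq0 oner_eq0 orbF.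
by rewrite expf_neq0 // toF_eq0 sf_neq0.
Qed.

Definition at_t (q : {poly S}) : A := (map_poly emb q).[t].

Lemma iota_at_t q : iota (at_t q) = map_poly toF q.
Proof.
rewrite /at_t !horner_coef.
rewrite rmorph_sum -[RHS]coefK poly_def.
have -> : size (map_poly emb q) = size q by rewrite size_map_inj_poly ?rmorph0 //; apply: emb_inj.
have -> : size (map_poly toF q) = size q by rewrite size_map_inj_poly ?rmorph0 //.
apply: eq_bigr => i _; rewrite !coef_map /= rmorphM rmorphXn /= iota_emb iota_t.
by rewrite mul_polyC.
Qed.

Lemma at_t_inj q : at_t q = 0 -> q = 0.
Proof.
move/(congr1 iota); rewrite iota_at_t rmorph0 => /eqP.
move=> /eqP q0; apply: (map_inj_poly toF_inj (rmorph0 _)).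
by rewrite q0 rmorph0.
Qed.

Lemma at_tD p q : at_t (p + q) = at_t p + at_t q.
Proof. by rewrite /at_t rmorphD hornerD. Qed.
Lemma at_tM p q : at_t (p * q) = at_t p * at_t q.
Proof. by rewrite /at_t rmorphM hornerM. Qed.
Lemma at_tC p : at_t p%:P = emb p.
Proof. by rewrite /at_t map_polyC hornerC. Qed.
Lemma at_tXn n : at_t ('X ^+ n) = t ^+ n.
Proof. by rewrite /at_t map_polyXn hornerXn. Qed.

Lemma clear_denominators a : exists N q, emb (sf ^+ N) * a = at_t q.
Proof.
move: a; apply: gen => [c|a b [N [p Hp]] [M [q Hq]]|a b [N [p Hp]] [M [q Hq]]||||].
- by exists 0%N, c%:P%:P%:P; rewrite expr0 rmorph1 mul1r at_tC emb_c.
- exists (N + M)%N, ((sf ^+ M)%:P * p + (sf ^+ N)%:P * q).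
  by rewrite at_tD !at_tM !at_tC -Hp -Hq exprD rmorphM; ring.
- exists (N + M)%N, (p * q).
  by rewrite at_tM -Hp -Hq exprD rmorphM; ring.
- by exists 0%N, sx%:P; rewrite expr0 rmorph1 mul1r at_tC emb_x.
- exists l, ((-1)%:P * (sx%:P + 'X ^+ a3)).
  rewrite at_tM at_tD !at_tC at_tXn emb_x (rmorphXn emb) /= emb_f.
  have -> : emb (-1) = -1 by apply/eqP; rewrite -addr_eq0 -(rmorph1 emb) -rmorphD addNr rmorph0.
  apply/eqP; rewrite mulN1r -addr_eq0 -rel; apply/eqP; ring.
- by exists 0%N, sz%:P; rewrite expr0 rmorph1 mul1r at_tC emb_z.
- by exists 0%N, ('X ^+ 1); rewrite expr0 rmorph1 mul1r at_tXn expr1.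
Qed.

Lemma unit_const (p q : S) : p * q = 1 -> exists2 k, k != 0 & p = k%:P%:P.
Proof.
move=> pq; have U : p \is a GRing.unit by apply/unitrP; exists q; rewrite mulrC pq.
move: U; rewrite poly_unitE => /andP[/size_poly1P[c c0 ->]]; rewrite coefC /=.
rewrite poly_unitE => /andP[/size_poly1P[k k0 ->] _].
by exists k.
Qed.

(** * Structure of the automorphisms *)

(** The conjugate by phi of the derivation f^l d/dt is locally nilpotent, and its
    kernel contains phi(K[x,z]); so [ker_in_emb] applies to it. *)
Lemma aut_emb (phi phi' : {rmorphism A -> A}) : cancel phi phi' -> cancel phi' phi ->
  (forall c : K, phi c%:A = c%:A) -> forall p, exists q, phi (emb p) = emb q.
Proof.
move=> phiK phi'K phi_c p.
pose D a := phi (del (phi' a)).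
have phi'_c c : phi' c%:A = c%:A by rewrite -[in LHS]phi_c phiK.
apply: (@ker_in_emb D _ _ _ _ _ (phi \o emb)).
- by move=> a b; rewrite /D rmorphD del_D rmorphD.
- by move=> a b; rewrite /D rmorphM del_M rmorphD !rmorphM /= !phi'K.
- by move=> k; rewrite /D phi'_c -emb_c del_emb rmorph0.
- move=> a; have [n an] := del_locnil (phi' a); exists n.
  have -> : iter n D a = phi (iter n del (phi' a)).
    by elim: n {an} => [|n IH]; rewrite ?phi'K // !iterS IH /D phiK.
  by rewrite an rmorph0.
- exists (phi t); rewrite /D phiK -(rmorph0 phi) (inj_eq (can_inj phiK)).
  exact: del_t.
- by move=> c /=; rewrite emb_c phi_c.
- by move=> q q' /= /(can_inj phiK) /emb_inj.
- by move=> q; rewrite /D /= phiK del_emb rmorph0.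
by rewrite /D phiK del_emb rmorph0.
Qed.

Section Restriction.
Variables (phi phi' : {rmorphism A -> A}).
Hypotheses (phiK : cancel phi phi') (phi'K : cancel phi' phi).
Hypothesis phi_c : forall c : K, phi c%:A = c%:A.

Definition restr (p : S) : S := sval (cid (aut_emb phiK phi'K phi_c p)).
Lemma restrP p : emb (restr p) = phi (emb p).
Proof. by rewrite /restr; case: cid => q /= ->. Qed.

Lemma restrD : {morph restr : p q / p + q}.
Proof. by move=> p q; apply: emb_inj; rewrite (rmorphD emb) /= !restrP (rmorphD emb) (rmorphD phi). Qed.
Lemma restrM : {morph restr : p q / p * q}.
Proof. by move=> p q; apply: emb_inj; rewrite (rmorphM emb) /= !restrP (rmorphM emb) (rmorphM phi). Qed.
Lemma restr_c c : restr c%:P%:P = c%:P%:P.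
Proof. by apply: emb_inj; rewrite restrP emb_c phi_c. Qed.
Lemma restr0 : restr 0 = 0. Proof. exact: (restr_c 0). Qed.
Lemma restr1 : restr 1 = 1. Proof. exact: (restr_c 1). Qed.
Lemma restrXn p n : restr (p ^+ n) = restr p ^+ n.
Proof. by elim: n => [|n IH]; rewrite ?restr1 // !exprS restrM IH. Qed.
Lemma restr_inj : injective restr.
Proof.
move=> p q pq; apply: emb_inj; apply: (can_inj phiK); by rewrite -!restrP pq.
Qed.
Lemma restr_eq0 p : (restr p == 0) = (p == 0).
Proof. by rewrite -[RHS](inj_eq restr_inj) restr0. Qed.

(** Up to a denominator in K[x,z], t is a polynomial in phi(t) with coefficients
    in K[x,z], and degrees in t multiply under composition. *)
Lemma size_iota_phi_t : size (iota (phi t)) = 2.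
Proof.
have [N [q Hq]] := clear_denominators (phi' t).
have := congr1 phi Hq; rewrite rmorphM /= phi'K -restrP => H.
pose c i := toF (restr q`_i).
have RE : iota (phi (at_t q)) = (\poly_(i < size q) c i) \Po iota (phi t).
  rewrite /at_t horner_coef rmorph_sum rmorph_sum /=.
  have -> : size (map_poly emb q) = size q by rewrite size_map_inj_poly ?rmorph0 //; apply: emb_inj.
  rewrite poly_def rmorph_sum /=; apply: eq_bigr => i _.
  rewrite coef_map /= !rmorphM !rmorphXn /= -restrP iota_emb.
  by rewrite comp_polyZ comp_Xn_poly mul_polyC.
have := congr1 (fun a => (size (iota a)).-1) H.
rewrite RE rmorphM iota_emb iota_t mul_polyC size_scale; last first.
  by rewrite toF_eq0 restr_eq0 expf_neq0 // sf_neq0.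
rewrite size_polyX size_comp_poly /=.
by move=> /esym /eqP; rewrite muln_eq1 => /andP[_ /eqP]; case: (size _) => [|[|[|n]]].
Qed.

Lemma umon_lt n : (n < a3)%N -> umon n = t ^+ n.
Proof. by move=> na; rewrite /umon modn_small // divn_small // expr0 mulr1. Qed.

Lemma phi_t_lin : exists c0 c1, phi t = emb c0 + emb c1 * t.
Proof.
have [c cE] := nf_exists (phi t); have sc : size c = 2.
  by rewrite -size_iota_nf -cE size_iota_phi_t.
exists c`_0, c`_1; rewrite cE /of_nf sc !big_ord_recl big_ord0 addr0 /=.
by rewrite !umon_lt // expr0 mulr1 expr1.
Qed.

Lemma size_iota_phi_y : size (iota (phi y)) = a3.+1.
Proof.
have := congr1 iota (congr1 phi rel).
rewrite !rmorphD !rmorphM !rmorphXn /= -emb_f -emb_x -!restrP !iota_emb !rmorph0 => H.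
have fn : toF (restr sf) ^+ l != 0 by rewrite expf_neq0 // toF_eq0 restr_eq0 sf_neq0.
have E1 : size (iota (phi y) * (toF (restr sf))%:P ^+ l) = size (iota (phi y)).
  by rewrite mulrC -rmorphXn /= mul_polyC size_scale.
have tn : iota (phi t) != 0 by rewrite -size_poly_gt0 size_iota_phi_t.
have st : size (iota (phi t) ^+ a3) = a3.+1.
  by rewrite polySpred ?expf_neq0 // size_exp size_iota_phi_t mul1n.
have E2 : iota (phi y) * (toF (restr sf))%:P ^+ l
    = - (iota (phi t) ^+ a3 + (toF (restr sx))%:P).
  by apply/eqP; rewrite -addr_eq0 -H; apply/eqP; ring.
rewrite -E1 E2 size_polyN size_polyDl // st.
by rewrite (leq_ltn_trans (size_polyC_leq1 _)).
Qed.

(** In normal form phi(y) = b(t) + b' y with deg b < a3, since phi(y) has t-degree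
    a3.  Inserting it in the image of the equation and multiplying by f^l, to
    eliminate y, gives an identity between polynomials in t. *)
Lemma phi_relation : exists c0 c1 (b : {poly S}) b',
  [/\ phi t = emb c0 + emb c1 * t, (size b <= a3)%N &
   (sf ^+ l)%:P * ((restr sx)%:P + (c0%:P + c1%:P * 'X) ^+ a3) +
   (restr sf ^+ l)%:P * ((sf ^+ l)%:P * b - b'%:P * (sx%:P + 'X ^+ a3)) = 0].
Proof.
have [c0 [c1 tE]] := phi_t_lin.
have [c cE] := nf_exists (phi y); have sc : size c = a3.+1.
  by rewrite -size_iota_nf -cE size_iota_phi_y.
exists c0, c1, (\poly_(i < a3) c`_i), c`_a3; split; [exact: tE | exact: size_poly |].
have yE : phi y = at_t (\poly_(i < a3) c`_i) + emb c`_a3 * y.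
  rewrite cE /of_nf sc big_ord_recr /=; congr (_ + _ * _); last first.
    by rewrite /umon modnn divnn a30 expr0 mul1r expr1.
  rewrite /at_t poly_def rmorph_sum /= horner_sum; apply: eq_bigr => i _.
  by rewrite umon_lt // -mul_polyC rmorphM /= map_polyC map_polyXn hornerM hornerC hornerXn.
have yf : emb (sf ^+ l) * y = - at_t (sx%:P + 'X ^+ a3).
  rewrite at_tD at_tC at_tXn emb_x (rmorphXn emb) /= emb_f.
  by apply/eqP; rewrite -addr_eq0 -rel; apply/eqP; ring.
have rel' : emb (restr sx) + phi y * emb (restr sf ^+ l) + phi t ^+ a3 = 0.
  rewrite (rmorphXn emb) /= !restrP emb_f emb_x -(rmorph0 phi) -rel.
  by rewrite !(rmorphD phi) (rmorphM phi) !(rmorphXn phi) rmorphD !rmorphXn.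
have Xn : at_t ((c0%:P + c1%:P * 'X) ^+ a3) = phi t ^+ a3.
  have XE : at_t (c0%:P + c1%:P * 'X) = phi t.
    by rewrite tE at_tD at_tM !at_tC -['X]expr1 at_tXn expr1.
  by elim: (a3) => [|n IH]; rewrite ?expr0 -?XE ?exprS ?at_tM ?IH ?XE // -polyC1 at_tC rmorph1.
have atN q : at_t (- q) = - at_t q.
  by apply/eqP; rewrite -addr_eq0 -at_tD addNr -polyC0 at_tC rmorph0.
apply: at_t_inj; rewrite !at_tD !at_tM at_tD !at_tC Xn at_tD at_tM atN at_tM !at_tC.
move: yf rel'; rewrite yE; set u := at_t (sx%:P + _); set w := at_t (\poly_(i < a3) _).
move=> yf rel'.
transitivity (emb (sf ^+ l) * (emb (restr sx) + (w + emb c`_a3 * y) * emb (restr sf ^+ l) + phi t ^+ a3)).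
  have uE : u = - (emb (sf ^+ l) * y) by rewrite yf opprK.
  by rewrite uE; ring.
by rewrite rel' mulr0.
Qed.

Let coef_relation (P Q X0 c0 c1 b' s : S) (b : {poly S}) n i :
  (P%:P * (X0%:P + (c0%:P + c1%:P * 'X) ^+ n) +
   Q%:P * (P%:P * b - b'%:P * (s%:P + 'X ^+ n)))`_i =
  P * ((if i == 0%N then X0 else 0) + c0 ^+ (n - i) * c1 ^+ i *+ 'C(n, i)) +
  Q * (P * b`_i - b' * ((if i == 0%N then s else 0) + (i == n)%:R)).
Proof.
by rewrite coefD !coefCM coefD coefC coef_lin_exp coefB !coefCM coefD coefC coefXn.
Qed.

Lemma phi_coefs : exists c0 c1 b' b0 b1,
  [/\ phi t = emb c0 + emb c1 * t,
    sf ^+ l * c1 ^+ a3 = restr sf ^+ l * b',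
    sf ^+ l * (c0 * c1 ^+ a3.-1 *+ a3) + restr sf ^+ l * (sf ^+ l * b1) = 0 &
    sf ^+ l * (restr sx + c0 ^+ a3) + restr sf ^+ l * (sf ^+ l * b0 - b' * sx) = 0].
Proof.
have [c0 [c1 [b [b' [tE sb G0]]]]] := phi_relation.
have a31 : (a3.-1 == 0)%N = false by case: (a3) a32 => [|[|n]].
have a33 : (a3.-1 == a3) = false by case: (a3) a30 => // n _; rewrite /= ltn_eqF.
have a34 : (a3 - a3.-1)%N = 1%N by case: (a3) a30 => // n _; rewrite /= subSnn.
have a35 : 'C(a3, a3.-1) = a3 by rewrite -[X in 'C(X, _)](prednK a30) binSn prednK.
have b0 : b`_a3 = 0 by rewrite nth_default.
have H i := etrans (esym (coef_relation (sf ^+ l) (restr sf ^+ l) (restr sx) c0 c1 b' sx b a3 i))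
  (congr1 (fun q : {poly S} => q`_i) G0).
exists c0, c1, b', b`_0, b`_(a3.-1); split=> //.
- have := H a3; rewrite coef0 b0 eqxx (gtn_eqF a30) subnn expr0 mul1r binn !add0r mulr0 sub0r mulr1.
  by rewrite mulrN => /eqP; rewrite subr_eq0 => /eqP.
- have := H a3.-1; rewrite coef0 a31 a33 a34 a35 !add0r mulr0 subr0 expr1.
  by [].
have := H 0%N; rewrite coef0 (ltn_eqF a30) eqxx subn0 expr0 mulr1 bin0 addr0.
by [].
Qed.

End Restriction.

(** The fraction p / q is a root of 'X^n - k, which splits over K. *)
Lemma proportional_of_powers (p q : S) n (k : K) : (0 < n)%N -> q != 0 ->
  p ^+ n = k%:P%:P * q ^+ n -> exists mu : K, p = mu%:P%:P * q.
Proof.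
move=> n0 q0 pq; have [r rE] := closed_field_poly_normal ('X^n - k%:P).
have : ('X^n - k%:P) \is monic by rewrite monicXnsubC.
move=> /monicP lc1; rewrite lc1 scale1r in rE.
have q0' : toF q != 0 by rewrite toF_eq0.
pose g : {rmorphism K -> F} := toF \o (polyC \o polyC).
have : (map_poly g ('X^n - k%:P)).[toF p / toF q] = 0.
  rewrite rmorphB /= map_polyXn map_polyC hornerD hornerN hornerC hornerXn exprMn exprVn.
  by rewrite -!rmorphXn pq rmorphM mulfK ?subrr // rmorphXn expf_neq0.
rewrite rE rmorph_prod horner_prod => /eqP; rewrite prodf_seq_eq0 => /hasP[c cr /=].
rewrite rmorphB /= map_polyX map_polyC hornerXsubC subr_eq0 => /eqP H.
exists c; apply: toF_inj; rewrite rmorphM; apply: (canRL (divfK q0')).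
exact: H.
Qed.

(** The coefficients of t^a3, t^(a3-1) and 1 in the image of the equation give
    phi(f)^l = const f^l, then f^l | phi(t) - k t, and then
    phi(x) = k^a3 x + f^l g.  So phi multiplies f by a constant, and
    [plane_weight] bounds the weight of phi(x) by that of x, which forces g = 0
    and makes phi(z) linear in z. *)
Theorem aut_structure (phi phi' : {rmorphism A -> A}) : cancel phi phi' -> cancel phi' phi ->
  (forall c : K, phi c%:A = c%:A) -> exists k g p,
  [/\ k != 0, phi x = (k ^+ a3)%:A * x, phi z = g%:A * z,
      phi t = k%:A * t + emb (sf ^+ l * p) & g ^+ a2 = k ^+ (a3 * d)].
Proof.
move=> phiK phi'K phi_c.
have phi'_c c : phi' c%:A = c%:A by rewrite -[in LHS]phi_c phiK.
pose r := restr phiK phi'K phi_c; pose r' := restr phi'K phiK phi'_c.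
have rP p : emb (r p) = phi (emb p) by exact: restrP.
have r'P p : emb (r' p) = phi' (emb p) by exact: restrP.
have rr' p : r (r' p) = p by apply: emb_inj; rewrite rP r'P phi'K.
have rD : {morph r : p q / p + q} by exact: restrD.
have rM : {morph r : p q / p * q} by exact: restrM.
have rX p n : r (p ^+ n) = r p ^+ n by exact: restrXn.
have r_c c : r c%:P%:P = c%:P%:P by exact: restr_c.
have r_eq0 p : (r p == 0) = (p == 0) by exact: restr_eq0.
have [c0 [c1 [b [b0 [b1 [tE eqb eq1 eq0]]]]]] := phi_coefs phiK phi'K phi_c.
have [c0' [c1' [b' [_ [_ [tE' eqb' _ _]]]]]] := phi_coefs phi'K phiK phi'_c.
rewrite -/r in eqb eq1 eq0; rewrite -/r' in eqb'.
have f0 := sf_neq0; have fl0 := expf_neq0 l f0.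
have rf0 : r sf != 0 by rewrite r_eq0.
have rfl0 := expf_neq0 l rf0.
have cXn (c : K) n : (c%:P%:P : S) ^+ n = (c ^+ n)%:P%:P by rewrite !rmorphXn.
(* phi and its inverse both send t to a linear polynomial in t, so c1 is a unit. *)
have c1c1' : r' c1 * c1' = 1.
  have tX : at_t 'X = t by rewrite -['X]expr1 at_tXn expr1.
  have H : at_t ((r' c0 + r' c1 * c0')%:P + (r' c1 * c1')%:P * 'X) = t.
    rewrite at_tD at_tM !at_tC tX (rmorphD emb) !(rmorphM emb) /=.
    rewrite -[RHS]phiK tE !r'P (rmorphD phi') (rmorphM phi') tE'; ring.
  have H0 : at_t ((r' c0 + r' c1 * c0')%:P + (r' c1 * c1')%:P * 'X + (-1)%:P * 'X) = 0.
    rewrite at_tD H at_tM at_tC tX.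
    have -> : emb (-1) = -1 by apply/eqP; rewrite -addr_eq0 -(rmorph1 emb) -rmorphD addNr rmorph0.
    by rewrite mulN1r subrr.
  have := congr1 (fun q : {poly S} => q`_1) (at_t_inj H0).
  rewrite !coefD coefC !coefCM coefX !mulr1 coef0 add0r => /eqP.
  by rewrite subr_eq0 => /eqP.
have [k k0 r'c1] := unit_const c1c1'.
have c1E : c1 = k%:P%:P by rewrite -[c1]rr' r'c1 r_c.
have [k' k'0 c1'E] : exists2 k', k' != 0 & c1' = k'%:P%:P.
  by apply: (@unit_const _ (r' c1)); rewrite mulrC.
(* The relation for phi^-1, moved by phi, provides an inverse of b. *)
pose C : S := (((k * k') ^+ a3)^-1)%:P%:P.
have bb : b * (r b' * C) = 1.
  have kk0 : (k * k') ^+ a3 != 0 by rewrite expf_neq0 // mulf_neq0.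
  have e1 : (r sf) ^+ l * (k' ^+ a3)%:P%:P = sf ^+ l * r b'.
    have := congr1 r eqb'; rewrite c1'E cXn !rM !rX r_c rr' => <-.
    by rewrite mulrC.
  have e2 : sf ^+ l * (k ^+ a3)%:P%:P = r sf ^+ l * b by rewrite -eqb c1E cXn.
  have e3 : (k' ^+ a3)%:P%:P * (k ^+ a3)%:P%:P * C = 1 :> S.
    by rewrite -!rmorphM /= -exprMn [k' * k]mulrC divff.
  move: C e3 => C e3; apply: (mulfI rfl0); rewrite mulr1 [LHS]mulrA -e2.
  move: e1 e3; set kA := (k ^+ a3)%:P%:P; set kB := (k' ^+ a3)%:P%:P.
  set P := sf ^+ l; set Q := r sf ^+ l; move: kA kB P Q (r b') => kA kB P Q bb e1 e3.
  transitivity ((P * bb) * (kA * C)); first by ring.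
  by rewrite -e1 -mulrA [kB * _]mulrA e3 mulr1.
have [be be0 bE] := unit_const bb.
have rfl : r sf ^+ l = (k ^+ a3 / be)%:P%:P * sf ^+ l.
  apply: (@mulIf _ be%:P%:P); first by rewrite !polyC_eq0.
  have -> : r sf ^+ l * be%:P%:P = sf ^+ l * (k ^+ a3)%:P%:P by rewrite -bE -eqb c1E cXn.
  by rewrite mulrAC -!rmorphM /= divfK // mulrC.
have [mu rfE] := proportional_of_powers l1 f0 rfl.
have mu0 : mu != 0.
  by apply: contraNneq rf0 => m0; rewrite rfE m0 mul0r.
(* phi(f)^l is u f^l, so the other two coefficients give c0 and phi(x) mod f^l. *)
have ka0 : k ^+ a3 != 0 by rewrite expf_neq0.
pose u := k ^+ a3 / be.
have u0 : u != 0 by rewrite mulf_neq0 ?invr_eq0.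
have [p c0E] : exists p, c0 = sf ^+ l * p.
  pose w := (k ^+ a3.-1 * a3%:R).
  have w0 : w != 0 by rewrite mulf_neq0 ?expf_neq0 // -(prednK a30) char0.
  exists ((- (u / w))%:P%:P * b1).
  apply: (@mulfI _ w%:P%:P); first by rewrite !polyC_eq0.
  have : sf ^+ l * (w%:P%:P * c0 + u%:P%:P * (sf ^+ l * b1)) = 0.
    rewrite -[RHS]eq1 rfl c1E cXn /w !rmorphM !rmorph_nat -/u; ring.
  move=> /eqP; rewrite mulf_eq0 (negPf fl0) addr_eq0 => /eqP ->.
  have cd : w%:P%:P * (- (u / w))%:P%:P = - u%:P%:P :> S.
    by rewrite -!rmorphM /= mulrN mulrC divfK // !polyCN.
  move: cd; set cw := w%:P%:P; set cu := u%:P%:P; set cd := (- (u / w))%:P%:P.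
  move: cw cu cd (sf ^+ l) => cw cu cd P ce.
  transitivity (cw * cd * (P * b1)); first by rewrite ce mulNr.
  by ring.
have [g xE] : exists g, r sx = (k ^+ a3)%:P%:P * sx + sf ^+ l * g.
  exists (- (u%:P%:P * b0) - sf ^+ (l * a3.-1) * p ^+ a3).
  have : sf ^+ l * (r sx + c0 ^+ a3 + u%:P%:P * (sf ^+ l * b0 - b * sx)) = 0.
    rewrite -[RHS]eq0 rfl -/u; ring.
  move=> /eqP; rewrite mulf_eq0 (negPf fl0) -addrA addr_eq0 => /eqP ->.
  have ub : u%:P%:P * b = (k ^+ a3)%:P%:P.
    by rewrite bE -!rmorphM /= divfK.
  have c0a : c0 ^+ a3 = sf ^+ l * (sf ^+ (l * a3.-1) * p ^+ a3).
    by rewrite c0E exprMn mulrA exprM -exprS prednK.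
  rewrite c0a -ub; move: (sf ^+ l) (sf ^+ _) (p ^+ a3) (u%:P%:P) => P Q pp cu.
  ring.
(* phi restricts to an automorphism of K[x,z]: its Jacobian cannot vanish. *)
have sx0 : sx != 0 by rewrite polyC_eq0 polyX_eq0.
have X0 : r sx != 0 by rewrite r_eq0.
have Z0 : r sz != 0 by rewrite r_eq0 polyX_eq0.
have Jn : jac (r sx) (r sz) != 0.
  apply/negP => /eqP J0.
  have Jr q : jac (r sx) (r q) = 0.
    elim/poly2_ind: q => [c||| q q' Hq Hq'| q q' Hq Hq'].
    - by rewrite r_c jac_c.
    - exact: jacpp.
    - exact: J0.
    - by rewrite rD jacD Hq Hq' addr0.
    - by rewrite rM jacM Hq Hq' mul0r mulr0 addr0.
  have Ja q : jac (r sx) q = 0 by rewrite -[q]rr'.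
  have dxX : dx (r sx) = 0.
    by have := Ja sz; rewrite /jac; have [-> ->] := partials_z K; rewrite mulr1 mulr0 subr0.
  have dzX : dz (r sx) = 0.
    have := Ja sx; rewrite /jac; have [-> ->] := partials_x K; rewrite mulr1 mulr0 sub0r.
    by move=> /eqP; rewrite oppr_eq0 => /eqP.
  have [c cE] := dx0_dz0 char0 dxX dzX.
  have : sx = c%:P%:P by apply: (restr_inj (phiK := phiK) (phi'K := phi'K) (phi_c := phi_c)); rewrite -/r cE r_c.
  by move/polyC_inj/(congr1 (fun q : {poly K} => size q)) ; rewrite size_polyX size_polyC; case: (c != 0).
have XZ : r sx ^+ d + r sz ^+ a2 = mu%:P%:P * sf by rewrite -rfE rD !rX.
have [wX wZ] := plane_weight char0 d2 a22 cop X0 Z0 Jn mu0 XZ.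
have g0 : g = 0.
  apply/eqP; apply: contraT => gn.
  have flg : sf ^+ l * g != 0 by rewrite mulf_neq0.
  have wfg : (a2 < weight d a2 (sf ^+ l * g))%N.
    rewrite (wtM _ d2) // (wtX _ d2) // (wt_cusp K a2 d2).
    apply: leq_trans (leq_addr _ _); rewrite mulnCA -[X in (X < _)%N]muln1 ltn_mul2l a20.
    by apply: leq_trans d2 _; rewrite leq_pmull.
  have wsx : weight d a2 ((k ^+ a3)%:P%:P * sx) = a2 by rewrite wtZ // wt_sx.
  by have := wtDl d2 (a2 := a2) (p := (k ^+ a3)%:P%:P * sx) flg; rewrite wsx -xE => /(_ wfg) wE; move: wfg; rewrite -wE ltnNge wX.
rewrite g0 mulr0 addr0 in xE.
have [q [ga zE]] := wt_le_z d2 a22 cop wZ.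
have := XZ; rewrite xE zE => /(plane_linear char0 a22 mu0)[q0 gE aE].
exists k, ga, p; split=> //.
- by rewrite -emb_x -rP xE (rmorphM emb) /= emb_c.
- by rewrite -emb_z -rP zE q0 polyC0 add0r (rmorphM emb) /= emb_c.
- by rewrite tE c1E emb_c c0E addrC.
by rewrite gE -aE exprM.
Qed.

End Model.

(** * A field with a degree that contains the plane *)

Section FractionModel.

Variables (K : closedFieldType) (d a2 : nat).
Hypothesis d0 : (0 < d)%N.
Local Notation S := {poly {poly K}}.

(** The substitution x = v tau^a2, z = tau^d embeds K[x,z] in the field of rational
    functions in tau over K(v), where the weighted degree becomes the degree in
    tau and the leading form the leading coefficient. *)
Lemma model_exists : exists (F E : fieldType) (toF : {rmorphism S -> F})
  (lead : {rmorphism {poly K} -> E}) (V : degree_valuation F E),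
  [/\ injective toF, injective lead,
    forall (p : S) m, p != 0 -> (vle V m (toF p) <-> (weight d a2 p)%:Z <= m) &
    forall p : S, p != 0 -> vcoef V (weight d a2 p) (toF p) = lead (lead_coef (wsubst d a2 p))].
Proof.
pose E : fieldType := {fraction {poly K}}.
pose F : fieldType := {fraction {poly E}}.
pose lead : {rmorphism {poly K} -> E} := @FracField.tofrac {poly K}.
pose fr : {rmorphism {poly E} -> F} := @FracField.tofrac {poly E}.
pose toF : {rmorphism S -> F} := fr \o (map_poly lead \o @wsubst K d a2).
have lead_inj : injective lead by move=> p q /eqP; rewrite tofrac_eq => /eqP.
have fr_inj : injective fr by move=> p q /eqP; rewrite tofrac_eq => /eqP.
have mlead_inj : injective (map_poly lead) by apply: map_inj_poly => //; exact: rmorph0.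
have toFE p : toF p = fr (map_poly lead (wsubst d a2 p)) by [].
have psize p : size (map_poly lead (wsubst d a2 p)) = size (wsubst d a2 p).
  by rewrite size_map_inj_poly ?rmorph0.
have mn0 p : p != 0 -> map_poly lead (wsubst d a2 p) != 0.
  move=> p0; rewrite -(rmorph0 (map_poly lead)) (inj_eq mlead_inj).
  by rewrite (wsubst_eq0 _ d0).
exists F, E, toF, lead, (ratfun_degree E); split=> //.
- by move=> p q; rewrite !toFE => /fr_inj /mlead_inj /(wsubst_inj d0).
- move=> p m p0; rewrite toFE.
  have h0 : (0 < size (wsubst d a2 p))%N by rewrite size_poly_gt0 (wsubst_eq0 _ d0).
  split=> [/(deg_le_fracE (mn0 _ p0))|H].
    by rewrite psize /weight; slia.
  by apply: deg_le_frac; rewrite psize; move: H; rewrite /weight; slia.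
move=> p p0; rewrite toFE.
have h0 : (0 < size (wsubst d a2 p))%N by rewrite size_poly_gt0 (wsubst_eq0 _ d0).
rewrite [LHS]deg_coef_frac; last first.
  by apply: deg_le_frac; rewrite psize /weight; slia.
by rewrite /= coef_map /weight lead_coefE.
Qed.

End FractionModel.

(** * Algebra automorphisms and regular families *)

Section RingMap.
Variables (A B : comNzRingType) (h : A -> B).
(** The proofs are arguments so that the structure of ring morphism can be
    attached to a function that is known to be a morphism only inside a proof. *)
Definition ring_map (hD : {morph h : a b / a - b}) (hM : monoid_morphism h) := h.
Variables (hD : {morph h : a b / a - b}) (hM : monoid_morphism h).
HB.instance Definition _ := GRing.isZmodMorphism.Build A B (ring_map hD hM) hD.
HB.instance Definition _ := GRing.isMonoidMorphism.Build A B (ring_map hD hM) hM.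
Definition to_rmorphism : {rmorphism A -> B} := ring_map hD hM.
End RingMap.

Section AlgebraAutomorphisms.
Variables (K : fieldType) (A : comAlgType K).

Lemma rmorph_is_alg_aut (h h' : {rmorphism A -> A}) :
  (forall c, h c%:A = c%:A) -> cancel h h' -> cancel h' h -> is_alg_aut h.
Proof.
move=> hc hK h'K; split; last by exists h'.
  by move=> c u v; rewrite -mulr_algl rmorphD rmorphM /= hc mulr_algl.
by split=> [|u v]; rewrite ?rmorph1 ?rmorphM.
Qed.

Lemma alg_autB (g : alg_aut A) : {morph g : a b / a - b}.
Proof.
case: g => g [gL _ _] a b /=.
by rewrite -[- b]scaleN1r addrC gL scaleN1r addrC.
Qed.

Lemma alg_autM (g : alg_aut A) : monoid_morphism g.
Proof. by case: g => g []. Qed.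

Definition aut_rmorphism (g : alg_aut A) : {rmorphism A -> A} :=
  to_rmorphism (alg_autB g) (alg_autM g).

Lemma alg_autZ (g : alg_aut A) c a : g (c *: a) = c *: g a.
Proof.
have g0 : g 0 = 0 := rmorph0 (aut_rmorphism g).
by case: g g0 => g [gL _ _] /= g0; rewrite -[c *: a]addr0 gL g0 addr0.
Qed.

Lemma alg_aut_alg (g : alg_aut A) c : g c%:A = c%:A.
Proof. by have [g1 _] := alg_autM g; rewrite alg_autZ g1. Qed.

Lemma alg_aut_inj (g : alg_aut A) : injective g.
Proof. by have [_ _ gB] := alg_autP g; apply: bij_inj gB. Qed.

Section Family.
Variables (D : {pred K}) (OG : (K -> K) -> Prop).
Hypothesis OGc : forall c, OG (fun=> c).
Hypothesis OGM : forall c c', OG c -> OG c' -> OG (fun s => c s * c' s).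

(** The elements of OG (x) A, as functions on D. *)
Definition regular_map (w : K -> A) : Prop :=
  exists (n : nat) (c : 'I_n -> K -> K) (v : 'I_n -> A),
    (forall i, OG (c i)) /\ {in D, forall s, w s = \sum_(i < n) c i s *: v i}.

Lemma regular_finType (I : finType) (c : I -> K -> K) (v : I -> A) :
  (forall i, OG (c i)) -> regular_map (fun s => \sum_i c i s *: v i).
Proof.
move=> Hc; exists #|I|, (fun i => c (enum_val i)), (fun i => v (enum_val i)).
split=> [i|s _]; first by apply: Hc.
by rewrite (reindex _ (onW_bij _ (enum_val_bij I))).
Qed.

Lemma eq_regular (w w' : K -> A) :
  {in D, w =1 w'} -> regular_map w -> regular_map w'.
Proof.
by move=> E [n [c [v [Hc H]]]]; exists n, c, v; split=> // s Ds; rewrite -E // H.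
Qed.

Lemma regularZ c a : OG c -> regular_map (fun s => c s *: a).
Proof.
move=> Hc; apply: eq_regular (@regular_finType 'I_1 (fun=> c) (fun=> a) _) => // s _.
by rewrite big_ord1.
Qed.

Lemma regular_cst a : regular_map (fun=> a).
Proof. by apply: eq_regular (regularZ a (OGc 1)) => s _; rewrite scale1r. Qed.

Lemma regularD w w' : regular_map w -> regular_map w' ->
  regular_map (fun s => w s + w' s).
Proof.
move=> [n [c [v [Hc E]]]] [n' [c' [v' [Hc' E']]]].
pose C (i : 'I_n + 'I_n') := match i with inl i => c i | inr i => c' i end.
pose V (i : 'I_n + 'I_n') := match i with inl i => v i | inr i => v' i end.
apply: eq_regular (@regular_finType _ C V _) => [s Ds|[i|i]]; last exact: Hc'.
  by rewrite big_sumType /= E // E'.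
by apply: Hc.
Qed.

Lemma regularM w w' : regular_map w -> regular_map w' ->
  regular_map (fun s => w s * w' s).
Proof.
move=> [n [c [v [Hc E]]]] [n' [c' [v' [Hc' E']]]].
pose C (i : 'I_n * 'I_n') s := c i.1 s * c' i.2 s.
pose V (i : 'I_n * 'I_n') := v i.1 * v' i.2.
apply: eq_regular (@regular_finType _ C V _) => [s Ds|i]; last exact: OGM.
rewrite E // E' // big_distrlr pair_big; apply: eq_bigr => i _ /=.
by rewrite -scalerAl -scalerAr scalerA.
Qed.

Lemma regularX w n : regular_map w -> regular_map (fun s => w s ^+ n).
Proof.
move=> Hw; elim: n => [|n IH]; first exact: regular_cst.
by apply: eq_regular (regularM Hw IH) => s _; rewrite exprS.
Qed.

Lemma regular_sum n (w : 'I_n -> K -> A) : (forall i, regular_map (w i)) ->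
  regular_map (fun s => \sum_(i < n) w i s).
Proof.
elim: n w => [|n IH] w Hw.
  by apply: eq_regular (regular_cst 0) => s _; rewrite big_ord0.
apply: eq_regular (regularD (IH _ (fun i => Hw (widen_ord (leqnSn n) i))) (Hw ord_max)).
by move=> s _; rewrite big_ord_recr.
Qed.
End Family.

Lemma regular_Ga_cst c : regular_Ga (fun=> c : K).
Proof. by exists c%:P => s; rewrite hornerC. Qed.
Lemma regular_Ga_id : regular_Ga (fun s : K => s).
Proof. by exists 'X => s; rewrite hornerX. Qed.
Lemma regular_GaM (c c' : K -> K) : regular_Ga c -> regular_Ga c' ->
  regular_Ga (fun s => c s * c' s).
Proof. by move=> [p E] [p' E']; exists (p * p') => s; rewrite hornerM E E'. Qed.

Lemma regular_Gm_cst c : regular_Gm (fun=> c : K).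
Proof. by exists c%:P, 0%N => s _; rewrite hornerC divr1. Qed.
Lemma regular_GmX n : regular_Gm (fun s : K => s ^+ n).
Proof. by exists 'X^n, 0%N => s _; rewrite hornerXn divr1. Qed.
Lemma regular_GmV n : regular_Gm (fun s : K => (s ^+ n)^-1).
Proof. by exists 1, n => s _; rewrite hornerC mul1r. Qed.
Lemma regular_GmM (c c' : K -> K) : regular_Gm c -> regular_Gm c' ->
  regular_Gm (fun s => c s * c' s).
Proof.
move=> [p [k E]] [p' [k' E']]; exists (p * p'), (k + k')%N => s s0.
by rewrite hornerM E // E' // exprD invfM mulrACA.
Qed.

End AlgebraAutomorphisms.

(** * Additive and multiplicative one-parameter groups *)

Section Generation.
Variables (K : closedFieldType) (d l a2 a3 : nat) (A : comAlgType K) (x y z t : A).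
Local Notation f := (x ^+ d + z ^+ a2).
Hypothesis rel : x + y * f ^+ l + t ^+ a3 = 0.
Hypothesis gen : forall Pr : A -> Prop,
  (forall c, Pr c%:A) -> (forall a b, Pr a -> Pr b -> Pr (a + b)) ->
  (forall a b, Pr a -> Pr b -> Pr (a * b)) ->
  Pr x -> Pr y -> Pr z -> Pr t -> forall a, Pr a.
Hypothesis domA : forall a b : A, a * b = 0 -> a = 0 \/ b = 0.
Hypothesis f0 : f != 0.
Hypothesis lift : forall x' y' z' t' : A,
  x' + y' * (x' ^+ d + z' ^+ a2) ^+ l + t' ^+ a3 = 0 ->
  exists h : {rmorphism A -> A}, (forall c, h c%:A = c%:A) /\
    [/\ h x = x', h y = y', h z = z' & h t = t'].

Lemma domX (a b : A) n : a != 0 -> b * a ^+ n = 0 -> b = 0.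
Proof.
move=> a0; elim: n => [|n IH]; first by rewrite mulr1.
by rewrite exprSr mulrA => /domA[//|/eqP]; rewrite (negPf a0).
Qed.

(** The equation determines the image of y by cancelling the image of f^l. *)
Lemma hom_ext (h h' : {rmorphism A -> A}) :
  (forall c, h c%:A = c%:A) -> (forall c, h' c%:A = c%:A) ->
  h x = h' x -> h z = h' z -> h t = h' t -> h f != 0 -> h =1 h'.
Proof.
move=> hc h'c ex ez et hf.
have ey : h y = h' y.
  apply/eqP; rewrite -subr_eq0; apply/eqP; apply: (@domX (h f) _ l hf).
  have hf' : h' f = h f by rewrite !rmorphD !rmorphXn /= ex ez.
  have : h (x + y * f ^+ l + t ^+ a3) = h' (x + y * f ^+ l + t ^+ a3) by rewrite rel !rmorph0.
  rewrite !(rmorphD _ (_ + _) (t ^+ _)) !(rmorphD _ x) !rmorphM !(rmorphXn _ l) !(rmorphXn _ a3) /=.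
  by rewrite hf' -ex -et => /addIr /addrI e; rewrite mulrBl e subrr.
by apply: gen => [c|a b Ha Hb|a b Ha Hb||||] //;
  rewrite ?hc ?h'c ?rmorphD ?rmorphM ?Ha ?Hb.
Qed.

Lemma alg_aut_eq (g g' : alg_aut A) : g x = g' x -> g z = g' z -> g t = g' t -> g = g'.
Proof.
move=> ex ez et; apply: alg_aut_ext.
apply: (@hom_ext (aut_rmorphism g) (aut_rmorphism g')) => //; try exact: alg_aut_alg.
apply: contra_neq f0 => fz; apply: (@alg_aut_inj _ _ g).
by rewrite [LHS]fz; apply/esym/(rmorph0 (aut_rmorphism g)).
Qed.

Lemma fixed_gens (h : {rmorphism A -> A}) : (forall c, h c%:A = c%:A) ->
  h x = x -> h z = z -> h t = t -> h =1 id.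
Proof.
move=> hc hx hz ht; apply: (@hom_ext h [the {rmorphism A -> A} of idfun]) => //.
by rewrite rmorphD !rmorphXn /= hx hz.
Qed.

Lemma aut_exists (h h' : {rmorphism A -> A}) : (forall c, h c%:A = c%:A) ->
  (forall c, h' c%:A = c%:A) ->
  [/\ h' (h x) = x, h' (h z) = z & h' (h t) = t] ->
  [/\ h (h' x) = x, h (h' z) = z & h (h' t) = t] ->
  exists g : alg_aut A, g =1 h.
Proof.
move=> hc h'c [ex ez et] [ex' ez' et'].
have hK : cancel h h'.
  by apply: (@fixed_gens (h' \o h)) => //= c; rewrite hc h'c.
have h'K : cancel h' h.
  by apply: (@fixed_gens (h \o h')) => //= c; rewrite h'c hc.
by exists (AlgAut (rmorph_is_alg_aut hc hK h'K)).
Qed.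

(** Regular maps form a K-algebra, so it is enough to follow the generators. *)
Lemma algebraic_on_gens (D : {pred K}) (OG : (K -> K) -> Prop) (rho : K -> alg_aut A) :
  (forall c, OG (fun=> c)) ->
  (forall c c', OG c -> OG c' -> OG (fun s => c s * c' s)) ->
  regular_map D OG (rho^~ x) -> regular_map D OG (rho^~ y) ->
  regular_map D OG (rho^~ z) -> regular_map D OG (rho^~ t) ->
  algebraic_family D OG rho.
Proof.
move=> Oc OM rx ry rz rt; suff H u : regular_map D OG (rho^~ u) by exact: H.
move: u; apply: gen => // [c|a b Ha Hb|a b Ha Hb].
- by apply: eq_regular (regular_cst D Oc c%:A) => s _; rewrite alg_aut_alg.
- apply: eq_regular (regularD Ha Hb) => s _.
  exact/esym/(rmorphD (aut_rmorphism (rho s))).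
- apply: eq_regular (regularM OM Ha Hb) => s _.
  exact/esym/(rmorphM (aut_rmorphism (rho s))).
Qed.

Section Additive.
Variable q : A.
Hypothesis fix_q : forall h : {rmorphism A -> A}, (forall c, h c%:A = c%:A) ->
  h x = x -> h z = z -> h q = q.

(** The flow of t when x and z are fixed: t moves by s f^l q, and the factor f^l
    is what lets y absorb the change of t^a3. *)
Definition shear_t (s : K) := t + s *: (f ^+ l * q).
Definition shear_y (s : K) :=
  y - s *: q * \sum_(i < a3) shear_t s ^+ (a3.-1 - i) * t ^+ i.

(** t'^a3 - t^a3 is t' - t, that is s f^l q, times the sum of the
    t'^(a3-1-i) t^i. *)
Lemma shear_hom s : exists h : {rmorphism A -> A}, (forall c, h c%:A = c%:A) /\
  [/\ h x = x, h y = shear_y s, h z = z & h t = shear_t s].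
Proof.
apply: lift; rewrite -[RHS]rel /shear_y.
have := subrXX (shear_t s) t a3; move: (\sum_(i < a3) _) => sm.
rewrite {2}/shear_t [_ - t]addrC addKr => /eqP; rewrite subr_eq => /eqP ->.
by rewrite -[s *: q]mulr_algl -[s *: (_ * q)]mulr_algl; ring.
Qed.

Lemma shear_comp (h : {rmorphism A -> A}) a b : (forall c, h c%:A = c%:A) ->
  h x = x -> h z = z -> h t = shear_t b -> h (shear_t a) = shear_t (a + b).
Proof.
move=> hc hx hz ht; rewrite {1}/shear_t -mulr_algl !(rmorphD, rmorphM, rmorphXn) /=.
by rewrite ht hc hx hz fix_q // /shear_t mulr_algl scalerDl addrAC addrA.
Qed.

Lemma shear_action : exists rho : K -> alg_aut A, Ga_action rho /\
  forall s, [/\ rho s x = x, rho s z = z & rho s t = shear_t s].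
Proof.
have t0 : shear_t 0 = t by rewrite /shear_t scale0r addr0.
have /choice[rho rhoP] : forall s, exists g : alg_aut A,
    [/\ g x = x, g y = shear_y s, g z = z & g t = shear_t s].
  move=> s; have [h [hc [hx hy hz ht]]] := shear_hom s.
  have [h' [h'c [h'x _ h'z h't]]] := shear_hom (- s).
  have [||g gE] := @aut_exists h h' hc h'c.
  - by split; rewrite ?hx ?hz ?h'x ?h'z // ht (shear_comp _ h'c h'x h'z h't) subrr t0.
  - by split; rewrite ?h'x ?h'z ?hx ?hz // h't (shear_comp _ hc hx hz ht) addNr t0.
  by exists g; rewrite !gE.
exists rho; split; last by move=> s; have [] := rhoP s.
split=> [a b|].
  have [ax _ az at_] := rhoP a; have [bx _ bz bt] := rhoP b.
  have [cx _ cz ct] := rhoP (a + b).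
  apply: alg_aut_eq; rewrite ?cx ?cz ?ct /= ?bx ?bz ?bt ?ax ?az //.
  rewrite [RHS](@shear_comp (aut_rmorphism (rho a)) b a) // 1?addrC //.
  exact: alg_aut_alg.
have rt : regular_map predT (@regular_Ga K) shear_t.
  apply: regularD; first exact: (regular_cst _ (@regular_Ga_cst K)).
  exact: regularZ (@regular_Ga_id K).
have cst := regular_cst (A := A) predT (@regular_Ga_cst K).
apply: algebraic_on_gens; [exact: regular_Ga_cst|exact: regular_GaM|..].
- by apply: eq_regular (cst x) => s _; have [->] := rhoP s.
- apply: (@eq_regular _ _ _ _ shear_y) => [s _|]; first by have [_ ->] := rhoP s.
  rewrite /shear_y.
  apply: (@eq_regular _ _ _ _ (fun s => y + (s * -1) *: q *
     \sum_(i < a3) shear_t s ^+ (a3.-1 - i) * t ^+ i)) => [s _|].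
    by rewrite mulrN1 scaleNr mulNr.
  have GM := @regular_GaM K; have Gc := @regular_Ga_cst K.
  apply: (regularD (cst y)); apply: (regularM GM).
    by apply: (regularZ _ _ (c := fun s => s * -1)); apply: GM => //; apply: regular_Ga_id.
  apply: (regular_sum Gc) => i.
  by apply: (regularM GM) => //; apply: (regularX Gc GM).
- by apply: eq_regular (cst z) => s _; have [_ _ ->] := rhoP s.
- by apply: eq_regular rt => s _; have [_ _ _ ->] := rhoP s.
Qed.
End Additive.

(** The weights (a2 a3, d a3, a2) of x, z and t make f^l homogeneous of degree
    a2 a3 d l and all terms of the equation of degree a2 a3. *)
Lemma torus_hom s : s != 0 -> exists h : {rmorphism A -> A}, (forall c, h c%:A = c%:A) /\
  [/\ h x = s ^+ (a2 * a3) *: x,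
      h y = (s ^+ (a2 * a3) * (s ^+ (a2 * a3 * d * l))^-1) *: y,
      h z = s ^+ (d * a3) *: z & h t = s ^+ a2 *: t].
Proof.
move=> s0; apply: lift; rewrite -[RHS](scaler0 _ (s ^+ (a2 * a3))) -rel.
rewrite !exprZn -!exprM (_ : d * a3 * a2 = a2 * a3 * d)%N; last by lia.
rewrite -scalerDr exprZn -exprM -scalerAl -scalerAr scalerA.
by rewrite mulfVK ?expf_neq0 // !scalerDr.
Qed.

Lemma torus_comp (h : {rmorphism A -> A}) (k c : K) a : (forall c, h c%:A = c%:A) ->
  h a = c *: a -> h (k *: a) = (k * c) *: a.
Proof. by move=> hc ha; rewrite -mulr_algl rmorphM /= hc ha mulr_algl scalerA. Qed.

Lemma torus_action : exists rho : K -> alg_aut A, Gm_action rho /\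
  forall s, s != 0 -> [/\ rho s x = s ^+ (a2 * a3) *: x,
    rho s z = s ^+ (d * a3) *: z & rho s t = s ^+ a2 *: t].
Proof.
have /choice[rho rhoP] : forall s, exists g : alg_aut A, s != 0 ->
    [/\ g x = s ^+ (a2 * a3) *: x,
      g y = (s ^+ (a2 * a3) * (s ^+ (a2 * a3 * d * l))^-1) *: y,
      g z = s ^+ (d * a3) *: z & g t = s ^+ a2 *: t].
  move=> s; have [->|s0] := eqVneq s 0; first by exists 1%g.
  have [h [hc [hx hy hz ht]]] := torus_hom s0.
  have sV : s^-1 != 0 by rewrite invr_eq0.
  have [h' [h'c [h'x _ h'z h't]]] := torus_hom sV.
  have [||g gE] := @aut_exists h h' hc h'c.
  - by split; rewrite ?hx ?hz ?ht;
      rewrite (torus_comp _ h'c h'x, torus_comp _ h'c h'z, torus_comp _ h'c h't)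
        -exprMn mulfV // expr1n scale1r.
  - by split; rewrite ?h'x ?h'z ?h't;
      rewrite (torus_comp _ hc hx, torus_comp _ hc hz, torus_comp _ hc ht)
        -exprMn mulVf // expr1n scale1r.
  by exists g; rewrite !gE.
exists rho; split; last by move=> s s0; have [] := rhoP s s0.
split=> [a b|].
  rewrite !inE => a0 b0; have [ax _ az at_] := rhoP a a0; have [bx _ bz bt] := rhoP b b0.
  have [cx _ cz ct] := rhoP (a * b) (mulf_neq0 a0 b0).
  have ac := alg_aut_alg (rho a); pose h := aut_rmorphism (rho a).
  apply: alg_aut_eq; rewrite ?cx ?cz ?ct /= ?bx ?bz ?bt exprMn mulrC.
  - by rewrite [RHS](@torus_comp h _ _ _ ac ax).
  - by rewrite [RHS](@torus_comp h _ _ _ ac az).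
  - by rewrite [RHS](@torus_comp h _ _ _ ac at_).
apply: algebraic_on_gens; [exact: regular_Gm_cst|exact: regular_GmM|..].
- apply: (eq_regular _ (regularZ _ x (@regular_GmX K (a2 * a3)))) => s s0.
  by have [->] := rhoP s s0.
- apply: (eq_regular _ (regularZ _ y (regular_GmM (@regular_GmX K (a2 * a3))
    (@regular_GmV K (a2 * a3 * d * l))))) => s s0.
  by have [_ ->] := rhoP s s0.
- apply: (eq_regular _ (regularZ _ z (@regular_GmX K (d * a3)))) => s s0.
  by have [_ _ ->] := rhoP s s0.
- apply: (eq_regular _ (regularZ _ t (@regular_GmX K a2))) => s s0.
  by have [_ _ _ ->] := rhoP s s0.
Qed.

(** Start with a root s0 of s0^a2 = k.  Then g / s0^(d a3) is an a2-th root of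
    unity, and since d a3 is invertible mod a2 it is the (d a3)-th power of a
    power of itself, by which s0 can be corrected. *)
Lemma torus_parameter (k g : K) : (0 < a2)%N -> (0 < d * a3)%N -> coprime (d * a3) a2 ->
  k != 0 -> g ^+ a2 = k ^+ (a3 * d) ->
  exists2 s, s != 0 & s ^+ a2 = k /\ s ^+ (d * a3) = g.
Proof.
move=> a20 da0 co k0 gE.
have [s0 s0E] : exists s, s ^+ a2 = k.
  have /closed_rootP[s] : size ('X^a2 - k%:P) != 1 by rewrite size_XnsubC // eqSS -lt0n.
  by rewrite /root !(hornerE, hornerXn) subr_eq0 => /eqP; exists s.
have s00 : s0 != 0 by apply: contra_neq k0 => s00; rewrite -s0E s00 expr0n gtn_eqF.
pose w := g / s0 ^+ (d * a3).
have w1 : w ^+ a2 = 1.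
  rewrite expr_div_n gE -exprM (mulnC (d * a3)) [s0 ^+ _]exprM s0E (mulnC a3) divff //.
  by rewrite expf_neq0.
have w0 : w != 0 by apply/eqP => w0; move: w1; rewrite w0 expr0n gtn_eqF // => /eqP; rewrite eq_sym oner_eq0.
have [m n mn _] := egcdnP a2 da0.
exists (s0 * w ^+ m); first by rewrite mulf_neq0 ?expf_neq0.
split; first by rewrite exprMn exprAC w1 expr1n mulr1.
rewrite exprMn -exprM mn (eqP co) exprD.
rewrite [w ^+ (_ * a2)]exprM exprAC w1 expr1n mul1r expr1.
by rewrite mulrC divfK // expf_neq0.
Qed.

Hypothesis structure : forall h h' : {rmorphism A -> A}, cancel h h' -> cancel h' h ->
  (forall c, h c%:A = c%:A) -> exists k g q,
  [/\ k != 0, h x = (k ^+ a3)%:A * x, h z = g%:A * z, h t = k%:A * t + f ^+ l * q &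
      g ^+ a2 = k ^+ (a3 * d) /\
      forall h : {rmorphism A -> A}, (forall c, h c%:A = c%:A) ->
        h x = x -> h z = z -> h q = q].
Hypotheses (a20 : (0 < a2)%N) (da0 : (0 < d * a3)%N) (co : coprime (d * a3) a2).

(** An automorphism with x -> k^a3 x, z -> g z, t -> k t + f^l q is the
    composition of an element of the torus with an element of the additive
    group of the shear of direction q, taken at time 1 / k. *)
Theorem generated_from_normal_form : generated_by (fun g : alg_aut A => in_Ga_image g \/ in_Gm_image g).
Proof.
move=> g H Hcl HS; have gc := alg_aut_alg g.
have gK : cancel (aut_rmorphism g) (aut_rmorphism g^-1%g).
  by move=> a; apply: (congr1 (fun e : alg_aut A => e a) (mulVg g)).
have gK' : cancel (aut_rmorphism g^-1%g) (aut_rmorphism g).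
  by move=> a; apply: (congr1 (fun e : alg_aut A => e a) (mulgV g)).
have [k [ga [q [k0 gx gz gt [gaE fq]]]]] := structure gK gK' gc.
have [s s0 [sk sg]] := torus_parameter a20 da0 co k0 gaE.
have [rho [rhoA rhoE]] := shear_action fq.
have [tau [tauA tauE]] := torus_action.
have [tx tz tt] := tauE s s0; have [rx rz rt] := rhoE k^-1.
have -> : g = (rho (k^-1)%R * tau s)%g.
  apply: alg_aut_eq; rewrite /= ?tx ?tz ?tt alg_autZ ?rx ?rz ?rt.
  - by rewrite [LHS]gx mulr_algl exprM sk.
  - by rewrite [LHS]gz mulr_algl sg.
  - by rewrite [LHS]gt mulr_algl sk scalerDr scalerA mulfV // scale1r.
apply: (group_closedM Hcl); apply: HS; [left|right].
  by exists rho => //; exists k^-1.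
by exists tau => //; exists s.
Qed.

End Generation.

(** * Generation of the automorphism group *)

Section Assembly.
Variables (K : closedFieldType) (d l a2 a3 : nat) (A : comAlgType K) (x y z t : A).
Hypothesis char0 : forall n, n.+1%:R != 0 :> K.
Hypotheses (d2 : (2 <= d)%N) (l1 : (1 <= l)%N) (a22 : (2 <= a2)%N) (a32 : (2 <= a3)%N).
Hypotheses (cop : coprime a2 d) (cop' : coprime a2 a3).
Hypothesis rel : x + y * (x ^+ d + z ^+ a2) ^+ l + t ^+ a3 = 0.
Hypothesis gen : forall Pr : A -> Prop,
  (forall c, Pr c%:A) -> (forall a b, Pr a -> Pr b -> Pr (a + b)) ->
  (forall a b, Pr a -> Pr b -> Pr (a * b)) ->
  Pr x -> Pr y -> Pr z -> Pr t -> forall a, Pr a.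
Hypothesis lift : forall (B : comNzRingType) (g : {rmorphism K -> B}) (x' y' z' t' : B),
  x' + y' * (x' ^+ d + z' ^+ a2) ^+ l + t' ^+ a3 = 0 ->
  exists h : {rmorphism A -> B}, (forall c, h c%:A = g c) /\
    [/\ h x = x', h y = y', h z = z' & h t = t'].

(** The universal property of A provides the embedding in F[t], with
    y = - (x + t^a3) / f^l, on which the structure theorem rests. *)
Theorem hypersurface_aut_generated : generated_by (fun g : alg_aut A => in_Ga_image g \/ in_Gm_image g).
Proof.
have [F [E [toF [lead [V [toF_inj lead_inj vle_toF vcoef_toF]]]]]] :=
  model_exists K a2 (ltnW d2).
pose sx : {poly {poly K}} := 'X%:P; pose sz : {poly {poly K}} := 'X.
pose sf := sx ^+ d + sz ^+ a2.
have sf0 : toF sf != 0 by rewrite toF_eq0 // sf_neq0.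
pose theta : F := - (toF sf)^-1 ^+ l.
pose g : {rmorphism K -> {poly F}} := polyC \o (toF \o (polyC \o polyC)).
have sfE : (toF sx)%:P ^+ d + (toF sz)%:P ^+ a2 = (toF sf)%:P :> {poly F}.
  by rewrite /sf !(rmorphD, rmorphXn).
have [|iota [iota_c [iota_x iota_y iota_z iota_t]]] := @lift {poly F} g (toF sx)%:P
    (theta%:P * ('X^a3 + (toF sx)%:P)) (toF sz)%:P 'X.
  rewrite sfE.
  have -> : theta%:P * ('X^a3 + (toF sx)%:P) * (toF sf)%:P ^+ l =
      - ('X^a3 + (toF sx)%:P) :> {poly F}.
    rewrite mulrAC -rmorphXn -rmorphM /= mulNr -exprMn mulVf // expr1n.
    by rewrite polyCN mulN1r.
  by rewrite opprD addrCA subrr addr0 addNr.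
have f0 : x ^+ d + z ^+ a2 != 0.
  have := inj_eq (iota_inj a22 a32 toF_inj rel gen iota_c iota_x iota_z iota_t iota_y).
  move=> <-; rewrite rmorph0 rmorphD !rmorphXn /= iota_x iota_z.
  by rewrite sfE polyC_eq0.
have dom := mulA_eq0 a22 a32 toF_inj rel gen iota_c iota_x iota_z iota_t iota_y.
apply: (generated_from_normal_form rel gen) => //.
- by move=> a b /eqP; rewrite dom => /orP[] /eqP; [left|right].
- move=> x' y' z' t' rel'; apply: (lift (in_alg A)) rel'.
- move=> h h' hK h'K hc.
  have [k [ga [p [k0 hx hz ht gE]]]] := aut_structure char0 d2 a22 a32 l1 cop toF_inj rel gen
    iota_c iota_x iota_z iota_t iota_y lead_inj vle_toF vcoef_toF hK h'K hc.
  exists k, ga, (emb x z p); split=> //.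
    by rewrite ht (rmorphM (emb x z)) (rmorphXn (emb x z)) /= emb_f.
  split=> // e ec ex ez; apply: (@rmorph2_ext _ _ (e \o emb x z) (emb x z)) => [c||] /=.
  - by rewrite emb_c ec.
  - by rewrite emb_x ex.
  - by rewrite emb_z ez.
- exact: ltnW.
- by rewrite muln_gt0 (ltnW d2) (ltnW a32).
- by rewrite coprime_sym coprimeMr cop cop'.
Qed.
End Assembly.

(** * Generators and universal property of the quotient ring *)

Section HypersurfaceRing.
Local Open Scope quotient_scope.
Variables (R : realType) (d l a2 a3 : nat).
Local Notation K := R[i].
Local Notation A := (hypersurface_ring R d l a2 a3).
Local Notation I := (@hypersurface_ideal R d l a2 a3).
Local Notation Q := {ideal_quot I}.

Definition coord (i : 'I_4) : A := \pi_Q 'X_i.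
Local Notation o0 := (@Ordinal 4 0 isT).
Local Notation o1 := (@Ordinal 4 1 isT).
Local Notation o2 := (@Ordinal 4 2 isT).
Local Notation o3 := (@Ordinal 4 3 isT).

Lemma pi_scalar (c : K) : c%:A = \pi_Q c%:MP :> A.
Proof.
transitivity (quot_scale c (\pi_Q 1)); first by rewrite rmorph1.
by rewrite pi_quot_scale alg_mpolyC.
Qed.

Lemma hypersurface_ind (Pr : A -> Prop) :
  (forall c, Pr c%:A) -> (forall a b, Pr a -> Pr b -> Pr (a + b)) ->
  (forall a b, Pr a -> Pr b -> Pr (a * b)) ->
  (forall i, Pr (coord i)) -> forall a, Pr a.
Proof.
move=> Pc PD PM Pi a.
rewrite -[a]reprK; elim/mpolyind: (repr a) => [|c m p _ _ IH].
  rewrite -mpolyC0.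
  by have -> : \pi_Q 0%:MP = 0%:A :> A by rewrite pi_scalar.
have -> : \pi_Q (c *: 'X_[m] + p) = c%:A * \pi_Q 'X_[m] + \pi_Q p :> A.
  by rewrite rmorphD -mul_mpolyC rmorphM pi_scalar.
apply: (PD) IH; apply: (PM) => //; rewrite mpolyXE_id rmorph_prod; apply: (big_ind Pr) => //.
  by rewrite -(scale1r (1 : A)).
move=> i _; rewrite rmorphXn; elim: (m i) => [|n IHn].
  by rewrite expr0 -(scale1r (1 : A)).
by rewrite exprS; apply: PM => //; apply: Pi.
Qed.

Lemma coord_rel :
  coord o0 + coord o1 * (coord o0 ^+ d + coord o2 ^+ a2) ^+ l + coord o3 ^+ a3 = 0.
Proof.
rewrite -!rmorphXn -rmorphD -rmorphXn -rmorphM -!rmorphD -[0 : A](rmorph0 \pi_Q).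
apply/eqP; rewrite -Quotient.idealrBE subr0.
by apply/asboolP; exists 1; rewrite mul1r.
Qed.

Lemma lift_exists (B : comNzRingType) (g : {rmorphism K -> B}) (v : 'I_4 -> B) :
  v o0 + v o1 * (v o0 ^+ d + v o2 ^+ a2) ^+ l + v o3 ^+ a3 = 0 ->
  exists h : {rmorphism A -> B}, (forall c, h c%:A = g c) /\ (forall i, h (coord i) = v i).
Proof.
move=> rel; pose h0 (a : A) : B := mmap g v (repr a).
have h0pi p : h0 (\pi_Q p) = mmap g v p.
  apply/eqP; rewrite -subr_eq0 -rmorphB.
  have /asboolP[q ->] : repr (\pi_Q p) - p \in I by rewrite Quotient.idealrBE reprK.
  rewrite rmorphM /hypersurface_eq !(rmorphD, rmorphM, rmorphXn) /= !mmapX !mmap1U.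
  by rewrite rel mulr0.
have hD : {morph h0 : a b / a - b}.
  by move=> a b; rewrite -[a]reprK -[b]reprK -rmorphB !h0pi rmorphB.
have hM : monoid_morphism h0.
  split; first by rewrite -[1 : A](rmorph1 \pi_Q) h0pi rmorph1.
  by move=> a b; rewrite -[a]reprK -[b]reprK -rmorphM !h0pi rmorphM.
exists (to_rmorphism hD hM); split=> [c|i].
  by rewrite -[LHS]/(h0 _) pi_scalar h0pi mmapC.
by rewrite -[LHS]/(h0 _) h0pi mmapX mmap1U.
Qed.

End HypersurfaceRing.

Theorem corollary2 (R : realType) (d l a2 a3 : nat)
    (hd : (2 <= d)%N) (hl : (1 <= l)%N)
    (ha2 : (2 <= a2)%N) (ha23 : (a2 <= a3)%N)
    (hgcd : gcdn a2 d = 1%N) (hgcd' : gcdn a2 a3 = 1%N) :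
  generated_by (fun g : alg_aut (hypersurface_ring R d l a2 a3) =>
    in_Ga_image g \/ in_Gm_image g).
Proof.
pose o (i : nat) := @inord 3 i.
have oE i (p : (i < 4)%N) : Ordinal p = o i by apply: val_inj; rewrite /= inordK.
apply: (@hypersurface_aut_generated R[i] d l a2 a3 _ (coord R d l a2 a3 (o 0)) (coord R d l a2 a3 (o 1))
  (coord R d l a2 a3 (o 2)) (coord R d l a2 a3 (o 3))) => //.
- by move=> n; rewrite pnatr_eq0.
- exact: leq_trans ha23.
- exact/eqP.
- exact/eqP.
- by rewrite -!oE; apply: coord_rel.
- move=> Pr Pc PD PM Px Py Pz Pt; apply: hypersurface_ind => // i.
  by case: i => [[|[|[|[|i]]]]] p //; rewrite oE.
- move=> B g x' y' z' t' rel.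
  have [|h [hc hv]] := @lift_exists R d l a2 a3 B g
    (fun i : 'I_4 => nth 0 [:: x'; y'; z'; t'] i); first exact: rel.
  by exists h; split=> //; rewrite !hv !inordK.
Qed.
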